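(* Let $T>0$, $\rho>0$, and consider on $(0,\pi)\times(0,T)$ the initial boundary value problem $$u_{tt}+A_N^2u+\rho\tilde A_N^{\alpha}u_t=0,\quad u_x(0,t)=u_{xxx}(0,t)=0,\quad u_x(\pi,t)=f(t),\quad u_{xxx}(\pi,t)=g(t),$$ $$u(x,0)=u^0(x),\quad u_t(x,0)=u^1(x),$$ with $u^0=u^1=0$, understood in the weak sense defined in the context. A) (Neumann control) Let $g=0$, $f\in L^2(0,T)$ and $\alpha\in(0,1)$. Then there exists a unique weak solution $u^f$, and the mapping $f\mapsto u^f$ is continuous from $L^2(0,T)$ to $C([0,T];X_N^0)\cap C^1([0,T];X_N^{-2})$. B) (Shear control) Let $f=0$, $g\in L^2(0,T)$ and $\alpha\in(0,1]$. Then there exists a unique weak solution $u^g$, and the mapping $g\mapsto u^g$ is continuous from $L^2(0,T)$ to $C([0,T];X_N^2)\cap C^1([0,T];X_N^0)$.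
   Context: $A_N=-\partial_x^2$ is the Neumann Laplacian on $(0,\pi)$, with eigenvalues $n^2$, $n\ge0$, and orthonormal eigenfunctions $\varphi_0=1/\sqrt\pi$, $\varphi_n=\sqrt{2/\pi}\cos(nx)$ for $n\ge1$. For $p\in\mathbb R$, $X_N^p$ is the space of (generalized) series $v=\sum_{n\ge0}a_n\varphi_n$ with $\|v\|_{X_N^p}^2=|a_0|^2+\sum_{n\ge1}n^{2p}|a_n|^2<\infty$. The operators $A_N^{\alpha}$ act by $A_N^\alpha\sum a_n\varphi_n=\sum n^{2\alpha}a_n\varphi_n$. The symbol $\langle\cdot,\cdot\rangle$ denotes the duality pairing of $X_N^p$ and $X_N^{-p}$ extending the $L^2$ pairing: $\langle\sum a_n\varphi_n,\sum b_n\varphi_n\rangle=\sum a_nb_n$. For $\alpha\in(0,1)$ the extended operator is $\tilde A_N^{\alpha}v(x)=\mathrm{PV}\int_0^\pi(v(x)-v(y))J_N(x,y)\,dy$, where $J_N(x,y)=\frac{\alpha}{\Gamma(1-\alpha)}\int_0^\infty p_N(t,x,y)t^{-\alpha-1}dt$ and $p_N$ is the heat kernel of $A_N$. The initial boundary value problem is formal; its precise meaning is the following weak formulation (for $\alpha=1$ the weak formulation is used with $A_N^1=A_N$). Adjoint solutions. For $\tau\in(0,T]$ and data $(w^0,w^1)$, with $w^0=\sum w^0_n\varphi_n$ and $w^1=\sum w_n^1\varphi_n$, let $w(x,t)=\sum_{n\ge0}w_n(t)\varphi_n(x)$, $t\in[0,\tau]$, where $w_n''-\rho n^{2\alpha}w_n'+n^4w_n=0$,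 $w_n(\tau)=w_n^0$, $w_n'(\tau)=w_n^1$. This is the solution of $w_{tt}+A_N^2w-\rho A_N^\alpha w_t=0$, $w_x=w_{xxx}=0$ at $x=0,\pi$, with $w(\cdot,\tau)=w^0$, $w_t(\cdot,\tau)=w^1$. The traces $w_{xx}(\pi,t)=-\sum n^2\varphi_n(\pi)w_n(t)$ and $w(\pi,t)=\sum\varphi_n(\pi)w_n(t)$ are understood as limits in $L^2(0,\tau)$ of partial sums. Weak solution in case A ($g=0$, zero initial data): a function $u\in C([0,T];X_N^0)\cap C^1([0,T];X_N^{-2})$ with $u(\cdot,0)=u_t(\cdot,0)=0$ such that for every $\tau\in(0,T]$ and all $(w^0,w^1)\in X_N^2\times X_N^0$, $$0=\langle w^1-\rho A_N^{\alpha}w^0,u(\cdot,\tau)\rangle-\langle w^0,u_t(\cdot,\tau)\rangle-\int_0^\tau w_{xx}(\pi,t)f(t)\,dt .$$ Weak solution in case B ($f=0$, zero initial data): a function $u\in C([0,T];X_N^2)\cap C^1([0,T];X_N^0)$ with $u(\cdot,0)=u_t(\cdot,0)=0$ such that for every $\tau\in(0,T]$ and all $(w^0,w^1)\in X_N^0\times X_N^{-2}$, $$0=\langle w^1-\rho A_N^{\alpha}w^0,u(\cdot,\tau)\rangle-\langle w^0,u_t(\cdot,\tau)\rangle-\int_0^\tau w(\pi,t)g(t)\,dt .$$ *)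

(* Defs.v *)
From HB Require Import structures.
From mathcomp Require Import all_boot all_order all_algebra.
From mathcomp Require Import all_classical all_reals all_analysis.

Set Implicit Arguments.
Unset Strict Implicit.
Unset Printing Implicit Defensive.

Import Order.TTheory GRing.Theory Num.Theory.
Import numFieldNormedType.Exports.

Local Open Scope classical_set_scope.
Local Open Scope ring_scope.

(* A generalized series [\sum_n a_n phi_n] is represented by its (real)
   coefficient sequence [a : nat -> R], and a function of time with values in
   such series by a map [u : R -> nat -> R], of which only the restriction to
   the closed interval under consideration matters. *)

Definition phi {R : realType} (n : nat) (x : R) : R :=
  if n == 0%N then (Num.sqrt pi)^-1 else Num.sqrt (2 / pi) * cos (n%:R * x).

(* Extended-real valued: it is [+oo] exactly on the series outside X_N^p. *)
Definition normX {R : realType} (p : R) (a : nat -> R) : \bar R :=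
  (((a 0%N ^+ 2)%:E + \sum_(1 <= n <oo) (n%:R `^ (2 * p) * a n ^+ 2)%:E)
     `^ 2^-1)%E.

Definition inX {R : realType} (p : R) (a : nat -> R) : Prop :=
  (normX p a < +oo)%E.

(* Only meant for [alpha] nonzero, where the mode [n = 0] is multiplied by
   [0 `^ (2 * alpha) = 0]. *)
Definition AN {R : realType} (alpha : R) (a : nat -> R) : nat -> R :=
  fun n => n%:R `^ (2 * alpha) * a n.

Definition pairing {R : realType} (a b : nat -> R) : R :=
  limn (series (fun n => a n * b n)).

Definition quotientI {R : realType} (g : R -> R) (t s : R) : R :=
  (g s - g t) / (s - t).

(* Derivative relative to the closed interval [a, b]: one-sided at the
   endpoints. *)
Definition derivableI {R : realType} (a b : R) (g : R -> R) (t : R) : Prop :=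
  cvg (quotientI g t s @[s --> within `[a, b] t^']).

Definition deriveI {R : realType} (a b : R) (g : R -> R) (t : R) : R :=
  lim (quotientI g t s @[s --> within `[a, b] t^']).

(* Time derivative, mode by mode; [C1X] below requires that it be the
   derivative in the norm of the target space. *)
Definition Dt {R : realType} (T : R) (u : R -> nat -> R) : R -> nat -> R :=
  fun t n => deriveI 0 T (u ^~ n) t.

(* u belongs to C([0, T]; X_N^p) *)
Definition C0X {R : realType} (T p : R) (u : R -> nat -> R) : Prop :=
  forall t : R, t \in `[0, T] ->
    inX p (u t) /\
    normX p (u s - u t) @[s --> within `[0, T] (nbhs t)] --> 0%E.

(* u belongs to C^1([0, T]; X_N^p) *)
Definition C1X {R : realType} (T p : R) (u : R -> nat -> R) : Prop :=
  [/\ C0X T p u,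
      C0X T p (Dt T u) &
      forall t : R, t \in `[0, T] ->
        normX p ((s - t)^-1 *: (u s - u t) - Dt T u t)
          @[s --> within `[0, T] t^'] --> 0%E].

Definition normC0X {R : realType} (T p : R) (u : R -> nat -> R) : \bar R :=
  ereal_sup [set normX p (u t) | t in `[0, T]].

Definition normC1X {R : realType} (T p : R) (u : R -> nat -> R) : \bar R :=
  (normC0X T p u + normC0X T p (Dt T u))%E.

(* Functions on (0, T) are represented by functions on R, of which only the
   restriction to (0, T) matters. *)
Definition inL2 {R : realType} (T : R) (f : R -> R) : Prop :=
  f \_ `]0, T[ \in Lfun lebesgue_measure 2%:E.

Definition normL2 {R : realType} (T : R) (f : R -> R) : \bar R :=
  'N[lebesgue_measure]_2%:E[EFin \o (f \_ `]0, T[)].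

(* [w n] is the coefficient w_n of the adjoint solution on [0, tau] with data
   (w0, w1) at time tau. *)
Definition adjoint_solution {R : realType} (rho alpha tau : R)
    (w0 w1 : nat -> R) (w : nat -> R -> R) : Prop :=
  forall n,
    [/\ forall t : R, t \in `[0, tau] ->
          [/\ derivableI 0 tau (w n) t,
              derivableI 0 tau (deriveI 0 tau (w n)) t &
              deriveI 0 tau (deriveI 0 tau (w n)) t
              - rho * n%:R `^ (2 * alpha) * deriveI 0 tau (w n) t
              + n%:R ^+ 4 * w n t = 0],
        w n tau = w0 n &
        deriveI 0 tau (w n) tau = w1 n].

(* [z] is the trace [\sum_n c_n w_n(t)], as an L^2(0, tau)-limit of partial
   sums. *)
Definition is_trace {R : realType} (tau : R) (c : nat -> R)
    (w : nat -> R -> R) (z : R -> R) : Prop :=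
  inL2 tau z /\
  normL2 tau (fun t => (\sum_(n < N) c n * w n t) - z t) @[N --> \oo] --> 0%E.

(* Weak solution with zero initial data in
   C([0, T]; X_N^p) `&` C^1([0, T]; X_N^(p - 2)), where the control h is
   integrated against the trace [\sum_n c_n w_n] of the adjoint solution; the
   final adjoint data range over the duals X_N^(2 - p) and X_N^(- p). *)
Definition weak_solution {R : realType} (rho alpha T p : R) (c : nat -> R)
    (h : R -> R) (u : R -> nat -> R) : Prop :=
  [/\ C0X T p u,
      C1X T (p - 2) u,
      u 0 = 0,
      Dt T u 0 = 0 &
      forall (tau : R) (w0 w1 : nat -> R) (w : nat -> R -> R),
        0 < tau <= T -> inX (2 - p) w0 -> inX (- p) w1 ->
        adjoint_solution rho alpha tau w0 w1 w ->
        exists2 z, is_trace tau c w z &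
          0 = pairing (w1 - rho *: AN alpha w0) (u tau)
              - pairing w0 (Dt T u tau)
              - \int[lebesgue_measure]_(t in `]0, tau[) (z t * h t)].

(* Neumann control f, trace w_xx(pi, t) *)
Definition weak_solution_Neumann {R : realType} (rho alpha T : R) :=
  weak_solution rho alpha T 0 (fun n => - (n%:R ^+ 2 * phi n pi)).

(* Shear control g, trace w(pi, t) *)
Definition weak_solution_shear {R : realType} (rho alpha T : R) :=
  weak_solution rho alpha T 2 (fun n => phi n pi).

(* Continuity of a map S from L^2(0, T) to
   C([0, T]; X_N^p) `&` C^1([0, T]; X_N^q) with the norm
   [normC0X T p + normC1X T q]. *)
Definition continuous_L2_C0X_C1X {R : realType} (T p q : R)
    (S : (R -> R) -> R -> nat -> R) : Prop :=
  forall f0, inL2 T f0 -> forall eps : R, 0 < eps ->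
    exists2 delta : R, 0 < delta &
      forall f, inL2 T f -> (normL2 T (f - f0)%R < delta%:E)%E ->
        (normC0X T p (S f - S f0)%R + normC1X T q (S f - S f0)%R < eps%:E)%E.

(* Main.v *)
(* In the basis [phi_n] the problem decouples.  Let [K_n] solve
   [K'' + rho n^(2 alpha) K' + n^4 K = 0], [K(0) = 0], [K'(0) = 1].  Testing with
   one adjoint mode at a time forces [u_n = - c_n (K_n * h)], where [h] is the
   control and [sum_n c_n w_n] the trace paired with it; this gives uniqueness.
   Since [|c_n| <= C n^(2 - p)] in both cases, existence and continuity reduce to
   the Bessel inequality
     [sum_n |int n^2 K_n h|^2 + sum_n |int K_n' h|^2 <= C |h|^2],
   whose dual form makes the traces converge in L^2.

   The inequality follows by Schur's test from
     [|int n^2 K_n k^2 K_k| + |int K_n' K_k'| <= C / (n - k)^2] for [n <> k].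
   No formula for [K_n] enters: differentiating the four products of
   [K_n, K_n'] with [K_k, K_k'] gives linear relations between their integrals,
   in which the damping terms are controlled by the dissipation identity
   [2 rho n^(2 alpha) int K_n'^2 <= 1]; this works uniformly in [0 < alpha <= 1].

   Continuity in time: the addition formula for [K_n] bounds [u_n(s)] by the data
   [u_n(t0), u_n'(t0)] at one earlier time [t0] plus the convolution over
   [(t0, s)], so the tails of the series are uniformly small near each time. *)

Require Import Defs.
From mathcomp Require Import all_boot all_order all_algebra.
From mathcomp Require Import all_classical all_reals all_analysis.
From mathcomp Require Import measurable_realfun ring lra.
Import Order.TTheory GRing.Theory Num.Theory.
Import numFieldNormedType.Exports.
Set Implicit Arguments.
Unset Strict Implicit.
Unset Printing Implicit Defensive.
Local Open Scope classical_set_scope.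
Local Open Scope ring_scope.

(** * Integration of square integrable functions on segments *)

(** Modewise bounds cannot suffice: each [|int n^2 K_n h|] is only bounded uniformly in [n], so
    square summability has to come from the near orthogonality of different kernels. Its source is
    the spectral gap. Solving the linear relations between the integrals divides by
    [n^4 - k^4 = (n - k) (n + k) (n^2 + k^2)], twice in the damped terms; the last two factors
    absorb the numerators, and [(n - k)^2] remains. The obstacle is the damping. For [alpha = 1] it
    has the order [n^2] of the frequency itself, so it is no perturbation, and kernels may be
    under-, over- or critically damped. Dissipation bounds each kernel by its own damping
    coefficient, while the mixed terms pair the larger coefficient with the slower mode. That
    mismatch is paid for by the monotonicity of [m_n / n^2] and costs only a factor [n / k], which
    the gap still absorbs. Mode 0 has neither damping nor restoring force and is always treated
    apart. *)

Lemma measurable_itvR (R : realType) (i : interval R) :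
  measurable ([set` i] : set (measurableTypeR R)).
Proof. exact: measurable_itv. Qed.

Section integration.
Context {R : realType}.
Implicit Types (a b c : R) (f g h : R -> R).

Definition itg a b f : Prop :=
  lebesgue_measure.-integrable `]a, b[ (EFin \o f).

Definition integ a b f : R := \int[lebesgue_measure]_(x in `]a, b[) f x.

(** Measurability is demanded of [f] itself, since that of [f ^+ 2] does not imply it. *)
Definition sqitg a b f : Prop :=
  measurable_fun `]a, b[ f /\ itg a b (fun x => f x ^+ 2).

Lemma eq_integ a b f g : (forall x, a < x < b -> f x = g x) ->
  integ a b f = integ a b g.
Proof. by move=> fg; apply: eq_Rintegral => x; rewrite inE/= in_itv/= => /fg. Qed.

Lemma eq_itg a b f g : (forall x, a < x < b -> f x = g x) ->
  itg a b f -> itg a b g.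
Proof.
move=> fg; apply: eq_integrable => //= x; rewrite inE/= in_itv/= => /fg /= ->//.
Qed.

Lemma itgD a b f g : itg a b f -> itg a b g -> itg a b (fun x => f x + g x).
Proof.
move=> fi gi; have := integrableD (measurable_itvR `]a, b[) fi gi.
by apply: eq_integrable => // x _ /=; rewrite EFinD.
Qed.

Lemma itgZ a b r f : itg a b f -> itg a b (fun x => r * f x).
Proof.
move=> fi; have := integrableZl (measurable_itvR `]a, b[) r fi.
by apply: eq_integrable => // x _ /=; rewrite EFinM.
Qed.

Lemma itgB a b f g : itg a b f -> itg a b g -> itg a b (fun x => f x - g x).
Proof.
move=> fi gi; have := integrableB (measurable_itvR `]a, b[) fi gi.
by apply: eq_integrable => // x _ /=; rewrite EFinB.
Qed.

Lemma itg_sum a b n (f : nat -> R -> R) : (forall i, itg a b (f i)) ->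
  itg a b (fun x => \sum_(i < n) f i x).
Proof.
move=> fi.
have := @integrable_sum _ _ _ _ _ (measurable_itvR `]a, b[) _
  (index_enum 'I_n) xpredT _
  (fun i _ => fi i).
by apply: eq_integrable => // x _ /=; rewrite sumEFin.
Qed.

Lemma itgS a b c d f : a <= c -> d <= b -> itg a b f -> itg c d f.
Proof.
move=> ac db; apply: (integrableS (measurable_itvR _) (measurable_itvR _)).
by apply: subset_itv; rewrite bnd_simp.
Qed.

Lemma itg_cont a b f : continuous f -> itg a b f.
Proof.
move=> cf; apply: (integrableS (measurable_itvR `[a, b]) (measurable_itvR _)).
  by apply: subset_itv; rewrite bnd_simp.
apply: continuous_compact_integrable; first exact: segment_compact.
by apply: continuous_subspaceT.
Qed.

Lemma itg_le a b f g : measurable_fun `]a, b[ f ->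
  (forall x, a < x < b -> `|f x| <= g x) -> itg a b g -> itg a b f.
Proof.
move=> mf fg; apply: le_integrable => //; first exact/measurable_EFinP.
move=> x /=; rewrite in_itv/= lee_fin => /fg H; exact: le_trans H (ler_norm _).
Qed.

Lemma itg_meas a b f : itg a b f -> measurable_fun `]a, b[ f.
Proof. by move=> /measurable_int /measurable_EFinP. Qed.

Lemma integD a b f g : itg a b f -> itg a b g ->
  integ a b (fun x => f x + g x) = integ a b f + integ a b g.
Proof. by move=> *; exact: RintegralD. Qed.

Lemma integB a b f g : itg a b f -> itg a b g ->
  integ a b (fun x => f x - g x) = integ a b f - integ a b g.
Proof. by move=> *; exact: RintegralB. Qed.

Lemma integZ a b r f : itg a b f ->
  integ a b (fun x => r * f x) = r * integ a b f.
Proof. by move=> *; exact: RintegralZl. Qed.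

Lemma integ_sum a b n (f : nat -> R -> R) : (forall i, itg a b (f i)) ->
  integ a b (fun x => \sum_(i < n) f i x) = \sum_(i < n) integ a b (f i).
Proof.
move=> fi; elim: n => [|n IH].
  rewrite big_ord0 (@eq_integ _ _ _ (fun x => 0 * 0)).
    by rewrite integZ ?mul0r//; apply: itg_cont; exact: cst_continuous.
  by move=> x _; rewrite big_ord0 mul0r.
rewrite big_ord_recr/= -IH -integD//; last exact: itg_sum.
by apply: eq_integ => x _; rewrite big_ord_recr.
Qed.

Lemma le_integ a b f g : itg a b f -> itg a b g ->
  (forall x, a < x < b -> f x <= g x) -> integ a b f <= integ a b g.
Proof.
move=> fi gi fg; apply: le_Rintegral => // x /=; rewrite in_itv/=; exact: fg.
Qed.

Lemma integ_ge0 a b f : (forall x, a < x < b -> 0 <= f x) -> 0 <= integ a b f.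
Proof. by move=> f0; apply: Rintegral_ge0 => x /=; rewrite in_itv/=; exact: f0. Qed.

Lemma itg_norm a b f : itg a b f -> itg a b (fun x => `|f x|).
Proof. exact: integrable_norm. Qed.

Lemma ler_norm_integ a b f : itg a b f ->
  `|integ a b f| <= integ a b (fun x => `|f x|).
Proof. by move=> fi; exact: le_normr_Rintegral. Qed.

Lemma integ_cst a b r : a <= b -> integ a b (fun=> r) = r * (b - a).
Proof.
move=> ab; rewrite /integ Rintegral_cst//= lebesgue_measure_itv/= lte_fin.
by case: ltgtP ab => //= <-; rewrite subrr.
Qed.

Lemma integ_nil a f : integ a a f = 0.
Proof. by rewrite /integ set_itvoo0 ?Rintegral_set0. Qed.

Lemma integ_split a c b f : a <= c <= b -> itg a b f ->
  integ a b f = integ a c f + integ c b f.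
Proof.
move=> /andP[]; rewrite le_eqVlt => /predU1P[->|ac].
  by rewrite integ_nil add0r.
rewrite le_eqVlt => /predU1P[->|cb] fi; first by rewrite integ_nil addr0.
have -> : integ a c f = \int[lebesgue_measure]_(x in `]a, c]) f x.
  by apply: Rintegral_itv_bndo_bndc; exact: itgS (lexx a) (ltW cb) fi.
rewrite {2}/integ -(@Rintegral_itvB _ f (BRight a) (BLeft b) c) ?bnd_simp//.
  by rewrite addrC subrK.
exact: ltW.
Qed.

Lemma FTC a b (F f : R -> R) : a <= b ->
  (forall x : R, is_derive x 1 F (f x)) ->
  continuous f -> integ a b f = F b - F a.
Proof.
rewrite le_eqVlt => /predU1P[-> _ _|ab dF cf]; first by rewrite integ_nil subrr.
have cF : continuous F.
  move=> x; apply: differentiable_continuous; apply/derivable1_diffP.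
  by case: (dF x).
rewrite /integ Rintegral_itv_bndo_bndc; last exact: itg_cont.
rewrite Rintegral_itv_obnd_cbnd; last first.
  apply: (integrableS (measurable_itvR `[a, b]) (measurable_itvR _)).
    by apply: subset_itv; rewrite bnd_simp.
  apply: continuous_compact_integrable; first exact: segment_compact.
  exact: continuous_subspaceT.
rewrite /Rintegral (@continuous_FTC2 _ _ F)//.
- exact: continuous_subspaceT.
- split=> [x _||]; first by case: (dF x).
    apply: cvg_at_right_filter; exact: cF.
  apply: cvg_at_left_filter; exact: cF.
- by move=> x _; rewrite derive1E; case: (dF x).
Qed.

Lemma sqitg_mul a b f g : sqitg a b f -> sqitg a b g ->
  itg a b (fun x => f x * g x).
Proof.
move=> [mf fi] [mg gi]; apply: (itg_le (g := fun x => f x ^+ 2 + g x ^+ 2)).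
- exact: measurable_funM.
- move=> x _; rewrite normrM -(normr_id (f x)) -[g x ^+ 2]real_normK ?num_real//.
  rewrite -[f x ^+ 2]real_normK ?num_real// normr_id.
  by move: `|f x| `|g x| => u v; nra.
- exact: itgD.
Qed.

Lemma sqitgD a b f g : sqitg a b f -> sqitg a b g ->
  sqitg a b (fun x => f x + g x).
Proof.
move=> fi gi; split; first by apply: measurable_funD; [case: fi|case: gi].
apply: (@eq_itg _ _ (fun x => (f x * f x + 2 * (f x * g x)) + g x * g x)).
  by move=> x _; ring.
apply: itgD; last exact: sqitg_mul.
apply: itgD; first exact: sqitg_mul.
by apply: itgZ; exact: sqitg_mul.
Qed.

Lemma sqitgZ a b r f : sqitg a b f -> sqitg a b (fun x => r * f x).
Proof.
move=> [mf fi]; split; first exact: measurable_funM.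
apply: (@eq_itg _ _ (fun x => r ^+ 2 * f x ^+ 2)); first by move=> x _; ring.
exact: itgZ.
Qed.

Lemma sqitgB a b f g : sqitg a b f -> sqitg a b g ->
  sqitg a b (fun x => f x - g x).
Proof.
move=> fi gi; have := sqitgD fi (sqitgZ (- 1) gi).
by under eq_fun do rewrite mulN1r.
Qed.

Lemma sqitgS a b c d f : a <= c -> d <= b -> sqitg a b f -> sqitg c d f.
Proof.
move=> ac db [mf fi]; split; last exact: itgS fi.
apply: measurable_funS mf => //.
by apply: subset_itv; rewrite bnd_simp.
Qed.

Lemma sqitg_cont a b f : continuous f -> sqitg a b f.
Proof.
move=> cf; split; first by apply: itg_meas; exact: itg_cont.
apply: itg_cont => x; under eq_fun do rewrite expr2.
by apply: cvgM; exact: cf.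
Qed.

Lemma sqitg_sum a b n (f : nat -> R -> R) : (forall i, sqitg a b (f i)) ->
  sqitg a b (fun x => \sum_(i < n) f i x).
Proof.
move=> fi; elim: n => [|n IH].
  under eq_fun do rewrite big_ord0; apply: sqitg_cont; exact: cst_continuous.
by under eq_fun do rewrite big_ord_recr/=; exact: sqitgD.
Qed.

Lemma sqitg_itg a b f : sqitg a b f -> itg a b f.
Proof.
move=> fi.
have := sqitg_mul (sqitg_cont a b (@cst_continuous R R 1)) fi.
by apply: eq_itg => x _; rewrite mul1r.
Qed.

(* Expand [0 <= \int (h - eps * \sum_n (\int e_n h) e_n)^2] with [eps = B^-1]. *)
Lemma bessel_of_riesz a b (B : R) (e : nat -> R -> R) h N : 0 < B ->
  (forall n, sqitg a b (e n)) -> sqitg a b h ->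
  (forall x : nat -> R, integ a b (fun s => (\sum_(n < N) x n * e n s) ^+ 2) <=
     B * \sum_(n < N) x n ^+ 2) ->
  \sum_(n < N) integ a b (fun s => e n s * h s) ^+ 2 <=
    B * integ a b (fun s => h s ^+ 2).
Proof.
move=> B0 ei hi eB.
pose x n := integ a b (fun s => e n s * h s).
pose S := \sum_(n < N) x n ^+ 2.
pose g s := \sum_(n < N) x n * e n s.
have gi : sqitg a b g.
  by apply: (@sqitg_sum _ _ _ (fun n s => x n * e n s)) => n; exact: sqitgZ.
have gh : integ a b (fun s => g s * h s) = S.
  rewrite (@eq_integ _ _ _ (fun s => \sum_(n < N) x n * (e n s * h s))).
    rewrite (@integ_sum _ _ _ (fun n s => x n * (e n s * h s))); last first.
      by move=> n; apply: itgZ; exact: sqitg_mul.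
    apply: eq_bigr => n _; rewrite integZ ?expr2//; exact: sqitg_mul.
  by move=> s _; rewrite /g mulr_suml; apply: eq_bigr => n _; rewrite mulrA.
have : 0 <= integ a b (fun s => (h s - B^-1 * g s) ^+ 2).
  by apply: integ_ge0 => s _; exact: sqr_ge0.
rewrite (@eq_integ _ _ _ (fun s =>
   (h s ^+ 2 - 2 * B^-1 * (g s * h s)) + B^-1 ^+ 2 * g s ^+ 2)); last first.
  by move=> s _; ring.
have ghi : itg a b (fun s => g s * h s) by exact: sqitg_mul.
have [_ hi2] := hi; have [_ gi2] := gi.
rewrite integD ?integB ?integZ//; [|exact: itgZ|exact/itgB/itgZ|exact: itgZ].
rewrite gh.
have : integ a b (fun s => g s ^+ 2) <= B * S := eB x.
set H := integ a b (fun s => h s ^+ 2); set G := integ _ _ _ => GS ge0.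
change (S <= B * H).
have : B^-1 ^+ 2 * G <= B^-1 * S.
  rewrite expr2 -mulrA ler_wpM2l ?invr_ge0 ?(ltW B0)//.
  by rewrite mulrC ler_pdivrMr// mulrC.
move=> GS'; have : B^-1 * S <= H by lra.
by rewrite mulrC ler_pdivrMr// mulrC.
Qed.

(** The case of a single function in [bessel_of_riesz]. The constant there must be positive, so the
    integral of [f^2] is enlarged by [d], chosen so that the excess [d * int g^2] is at most
    [eps]. *)
Lemma cauchy_schwarz_integ a b f g : sqitg a b f -> sqitg a b g ->
  integ a b (fun s => f s * g s) ^+ 2 <=
  integ a b (fun s => f s ^+ 2) * integ a b (fun s => g s ^+ 2).
Proof.
move=> fi gi; apply/ler_addgt0Pr => eps eps0.
have g0 : 0 <= integ a b (fun s => g s ^+ 2).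
  by apply: integ_ge0 => s _; exact: sqr_ge0.
have f0 : 0 <= integ a b (fun s => f s ^+ 2).
  by apply: integ_ge0 => s _; exact: sqr_ge0.
pose d := eps / (integ a b (fun s => g s ^+ 2) + 1).
have d0 : 0 < d by rewrite divr_gt0// ltr_wpDl.
have := @bessel_of_riesz a b (integ a b (fun s => f s ^+ 2) + d) (fun=> f) g 1.
rewrite big_ord1 => H; apply: (le_trans (H _ _ _ _)) => //.
- by rewrite ltr_wpDl.
- move=> x; rewrite big_ord1; under eq_integ do rewrite big_ord1 exprMn.
  rewrite integZ; last by case: fi.
  by rewrite [leLHS]mulrC ler_wpM2r ?sqr_ge0// lerDl ltW.
rewrite mulrDl lerD2l /d -mulrA ger_pMr// mulrC ler_pdivrMr ?ltr_wpDl//.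
by rewrite mul1r lerDl.
Qed.

(** Absolute continuity of the integral: intervals inside the window of radius [eta] about [t] are
    short. This makes the right side of the Bessel inequality small over short times. *)
Lemma integ_small (T t eps : R) h : itg 0 T (fun s => h s ^+ 2) -> 0 < eps ->
  exists2 eta, 0 < eta & forall a b, 0 <= a -> b <= T ->
    t - eta < a -> b < t + eta -> integ a b (fun s => h s ^+ 2) < eps.
Proof.
move=> hi eps0.
pose f := (fun s => h s ^+ 2) \_ `]0, T[.
have fi : lebesgue_measure.-integrable setT (EFin \o f).
  by rewrite -restrict_EFin; apply/integrable_restrict => //=; rewrite setTI.
have [d [d0 Hd]] := integral_normr_continuous fi eps0.
exists (d / 2); first by rewrite divr_gt0.
move=> a b a0 bT ta bt.
have [ba|ab] := leP b a.
  by rewrite /integ set_itv_ge ?bnd_simp -?leNgt// Rintegral_set0.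
have ab_d : (lebesgue_measure `]a, b[%classic < d%:E)%E.
  by rewrite lebesgue_measure_itv/= lte_fin ab -EFinD lte_fin; lra.
apply: le_lt_trans (Hd _ (measurable_itvR `]a, b[) ab_d).
rewrite le_eqVlt; apply/orP; left; apply/eqP; apply: eq_integ => x /andP[ax xb].
rewrite /f patchE mem_set/=; last first.
  by rewrite in_itv/= (le_lt_trans a0 ax) (lt_le_trans xb bT).
by rewrite ger0_norm ?sqr_ge0.
Qed.

End integration.

(** * The damped oscillator *)

Section oscillator.
Context {R : realType}.
Implicit Types (m v x : R) (K dK : R -> R).

(** [K] is the impulse response of [K'' + m K' + v K = 0]. Its derivative is carried as a second
    function, so that the equation is a first order system with two-sided derivatives on the whole
    line. *)
Definition oscillator m v K dK : Prop :=
  [/\ K 0 = 0, dK 0 = 1,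
      forall x : R, is_derive x 1 K (dK x) &
      forall x : R, is_derive x 1 dK (- m * dK x - v * K x)].

Lemma is_derive_continuous (f df : R -> R) :
  (forall x : R, is_derive x 1 f (df x)) -> continuous f.
Proof.
move=> H x; apply/differentiable_continuous/derivable1_diffP.
by case: (H x).
Qed.

Lemma is_derive_lin (c x : R) : is_derive x 1 (fun y => c * y) c.
Proof. by apply: is_derive_eq; rewrite /GRing.scale/= mulr1. Qed.

Lemma is_derive_compl (f df : R -> R) (c x : R) :
  (forall y : R, is_derive y 1 f (df y)) ->
  is_derive x 1 (fun y => f (c * y)) (c * df (c * x)).
Proof.
move=> H; have := is_derive1_comp (H (c * x)) (is_derive_lin c x).
by rewrite mulrC.
Qed.

Lemma is_derive_compr (f df : R -> R) (b x : R) :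
  (forall y : R, is_derive y 1 f (df y)) ->
  is_derive x 1 (fun y => f (b - y)) (- df (b - x)).
Proof.
move=> H; have Hb : is_derive x 1 (fun y : R => b - y) (-1).
  by have := is_deriveB (is_derive_cst b x 1) (is_derive_id x 1); rewrite sub0r.
have := @is_derive1_comp R f (fun y => b - y) x _ _ (H (b - x)) Hb.
by rewrite mulrN1.
Qed.

Lemma is_deriveMR (f g : R -> R) (df dg x : R) :
  is_derive x 1 f df -> is_derive x 1 g dg ->
  is_derive x 1 (fun y => f y * g y) (df * g x + f x * dg).
Proof.
move=> Hf Hg; apply: is_derive_eq.
by rewrite /GRing.scale/=; ring.
Qed.

Lemma is_deriveDR (f g : R -> R) (df dg x : R) :
  is_derive x 1 f df -> is_derive x 1 g dg ->
  is_derive x 1 (fun y => f y + g y) (df + dg).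
Proof. by move=> Hf Hg; apply: is_derive_eq. Qed.

Lemma is_deriveZR (f : R -> R) (c df x : R) :
  is_derive x 1 f df -> is_derive x 1 (fun y => c * f y) (c * df).
Proof. by move=> Hf; apply: is_derive_eq. Qed.

Lemma is_deriveBR (f g : R -> R) (df dg x : R) :
  is_derive x 1 f df -> is_derive x 1 g dg ->
  is_derive x 1 (fun y => f y - g y) (df - dg).
Proof. by move=> Hf Hg; apply: is_derive_eq. Qed.

Lemma is_derive_expl (c x : R) :
  is_derive x 1 (fun y => expR (c * y)) (c * expR (c * x)).
Proof. by apply: is_derive_compl => y; exact: is_derive_expR. Qed.

(** The sign of [v - (m / 2)^2] selects the underdamped, overdamped or critical formula; [r1] and
    [r2] are the characteristic roots. *)
Lemma oscillator_exists m v : exists KdK : (R -> R) * (R -> R),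
  oscillator m v KdK.1 KdK.2.
Proof.
pose E x := expR (- (m / 2) * x).
have dE (x : R) : is_derive x 1 E (- (m / 2) * E x) by exact: is_derive_expl.
have [D0|D0|D0] := ltgtP 0 (v - (m / 2) ^+ 2).
- pose w := Num.sqrt (v - (m / 2) ^+ 2).
  have w0 : w != 0 by rewrite gt_eqF// sqrtr_gt0.
  have w2 : w ^+ 2 = v - (m / 2) ^+ 2 by rewrite sqr_sqrtr// ltW.
  have dS (x : R) : is_derive x 1 (fun y => sin (w * y)) (w * cos (w * x)).
    by apply: is_derive_compl => y; exact: is_derive_sin.
  have dC (x : R) : is_derive x 1 (fun y => cos (w * y)) (w * - sin (w * x)).
    by apply: (@is_derive_compl _ (fun y => - sin y)) => y; exact: is_derive_cos.
  exists ((fun x => w^-1 * (E x * sin (w * x))),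
    (fun x => E x * cos (w * x) - m / 2 / w * (E x * sin (w * x)))); split => /=.
  + by rewrite mulr0 sin0 !mulr0.
  + by rewrite mulr0 sin0 cos0 /E mulr0 expR0 !mulr0 subr0 mulr1.
  + move=> x; have d1 := dE x; have d2 := dS x.
    apply: (is_derive_eq (is_deriveZR _ (is_deriveMR d1 d2))).
    by field.
  + move=> x; have d1 := dE x; have d2 := dS x; have d3 := dC x.
    apply: (is_derive_eq (is_deriveBR (is_deriveMR d1 d3)
      (is_deriveZR _ (is_deriveMR d1 d2)))).
    have -> : v = w ^+ 2 + (m / 2) ^+ 2 by rewrite w2 subrK.
    by field.
- pose w := Num.sqrt (- (v - (m / 2) ^+ 2)).
  have w0 : w != 0 by rewrite gt_eqF// sqrtr_gt0 oppr_gt0.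
  have w2 : w ^+ 2 = - (v - (m / 2) ^+ 2) by rewrite sqr_sqrtr// oppr_ge0 ltW.
  pose r1 := - (m / 2) + w; pose r2 := - (m / 2) - w.
  have d1 := is_derive_expl r1; have d2 := is_derive_expl r2.
  exists ((fun x => (2 * w)^-1 * (expR (r1 * x) - expR (r2 * x))),
    (fun x => (2 * w)^-1 * (r1 * expR (r1 * x) - r2 * expR (r2 * x)))); split => /=.
  + by rewrite !mulr0 expR0 subrr mulr0.
  + rewrite !mulr0 expR0 !mulr1 /r1 /r2; by field.
  + by move=> x; exact: (is_deriveZR _ (is_deriveBR (d1 x) (d2 x))).
  + move=> x; apply: (is_derive_eq (is_deriveZR _
      (is_deriveBR (is_deriveZR _ (d1 x)) (is_deriveZR _ (d2 x))))).
    have -> : v = (m / 2) ^+ 2 - w ^+ 2 by rewrite w2 opprK addrC subrK.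
    rewrite /r1 /r2; move: (expR _) (expR _) => e1 e2; by field.
- have {}D0 : v = (m / 2) ^+ 2 by apply/eqP; rewrite -subr_eq0 -D0.
  exists ((fun x => x * E x), (fun x => E x - m / 2 * (x * E x))); split => /=.
  + by rewrite mul0r.
  + by rewrite /E mul0r !mulr0 expR0 subr0.
  + move=> x; apply: (is_derive_eq (is_deriveMR (is_derive_id x 1) (dE x))).
    by rewrite mul1r; ring.
  + move=> x; apply: (is_derive_eq (is_deriveBR (dE x)
      (is_deriveZR _ (is_deriveMR (is_derive_id x 1) (dE x))))).
    by rewrite D0; field.
Qed.

Lemma mvt (f df : R -> R) (a b : R) : a <= b ->
  (forall x : R, is_derive x 1 f (df x)) ->
  exists2 c, a <= c <= b & f b - f a = df c * (b - a).
Proof.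
move=> ab H; have [|c] := @MVT_segment R f df a b ab (fun x _ => H x).
  exact/continuous_subspaceT/(is_derive_continuous H).
by rewrite in_itv/=; exists c.
Qed.

Lemma mvt_le (f df : R -> R) (a b M : R) : a <= b ->
  (forall x : R, is_derive x 1 f (df x)) ->
  (forall x, a <= x <= b -> `|df x| <= M) -> `|f b - f a| <= M * (b - a).
Proof.
move=> ab H HM; have [c cab ->] := mvt ab H.
by rewrite normrM [`|b - a|]ger0_norm ?subr_ge0// ler_wpM2r ?subr_ge0// HM.
Qed.

(** The substitution [x = b - s] is built in, because kernels occur as [K (b - s)] inside
    convolutions. *)
Lemma FTC_rev (f df : R -> R) (a b : R) : a <= b ->
  (forall x : R, is_derive x 1 f (df x)) -> continuous df ->
  integ a b (fun s => df (b - s)) = f (b - a) - f 0.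
Proof.
move=> ab H cdf.
have -> : integ a b (fun s => df (b - s)) =
    (- f (b - b)) - (- f (b - a)); last by rewrite subrr; ring.
apply: (@FTC _ a b (fun s => - f (b - s))) => //.
  move=> x; have Hx := @is_derive_compr _ _ b x H.
  by apply: (is_derive_eq (is_deriveN Hx)); rewrite opprK.
move=> x; apply: continuous_comp; last exact: cdf.
by apply: cvgB; [exact: cvg_cst|exact: cvg_id].
Qed.

(** * Energy, small-time expansions and addition formulas of one kernel *)

Section kernel.
Variables (m v : R) (K dK : R -> R).
Hypotheses (osc : oscillator m v K dK) (m0 : 0 <= m) (v0 : 0 <= v).

Lemma osc0 : K 0 = 0. Proof. by case: osc. Qed.
Lemma osc_d0 : dK 0 = 1. Proof. by case: osc. Qed.
Lemma osc_derive (x : R) : is_derive x 1 K (dK x). Proof. by case: osc. Qed.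
Lemma osc_derive2 (x : R) : is_derive x 1 dK (- m * dK x - v * K x).
Proof. by case: osc. Qed.
Lemma osc_cont : continuous K.
Proof. exact: is_derive_continuous osc_derive. Qed.
Lemma osc_contd : continuous dK.
Proof. exact: is_derive_continuous osc_derive2. Qed.

Lemma osc_derive_energy (x : R) :
  is_derive x 1 (fun y => dK y * dK y + v * (K y * K y)) (- (2 * m) * dK x ^+ 2).
Proof.
have d1 := osc_derive x; have d2 := osc_derive2 x.
apply: (is_derive_eq (is_deriveDR (is_deriveMR d2 d2)
  (is_deriveZR v (is_deriveMR d1 d1)))).
by ring.
Qed.

(** The energy [K'^2 + v K^2] equals 1 at time 0 and has derivative [- 2 m K'^2 <= 0]. *)
Lemma osc_energy x : 0 <= x -> dK x ^+ 2 + v * K x ^+ 2 <= 1.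
Proof.
move=> x0; have [c _] := mvt x0 osc_derive_energy.
rewrite osc0 osc_d0 subr0 => H.
have : 0 <= 2 * m * dK c ^+ 2 * x.
  by apply: mulr_ge0 => //; apply: mulr_ge0; [exact: mulr_ge0|exact: sqr_ge0].
rewrite !expr2 in H *; lra.
Qed.

Lemma osc_d_le1 x : 0 <= x -> `|dK x| <= 1.
Proof.
move=> x0; have := osc_energy x0; have : 0 <= v * K x ^+ 2 by rewrite mulr_ge0 ?sqr_ge0.
move=> h1 h2; have h : dK x ^+ 2 <= 1 by lra.
by rewrite ler_norml; apply/andP; split; nra.
Qed.

Lemma osc_le_id x : 0 <= x -> `|K x| <= x.
Proof.
move=> x0; have := @mvt_le K dK 0 x 1 x0 osc_derive.
rewrite osc0 !subr0 mul1r; apply => y /andP[y0 _]; exact: osc_d_le1.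
Qed.

Lemma osc_scaled_le1 (w x : R) : 0 <= w -> v = w ^+ 2 -> 0 <= x -> `|w * K x| <= 1.
Proof.
move=> w0 vw x0; have := osc_energy x0; have : 0 <= dK x ^+ 2 by exact: sqr_ge0.
rewrite vw -exprMn => h1 h2; have h : (w * K x) ^+ 2 <= 1 by lra.
by rewrite ler_norml; apply/andP; split; nra.
Qed.

Lemma osc_derive2_le x y : 0 <= y <= x -> `|- m * dK y - v * K y| <= m + v * x.
Proof.
move=> /andP[y0 yx]; apply: le_trans (ler_normB _ _) _.
rewrite !normrM normrN (ger0_norm m0) (ger0_norm v0); apply: lerD.
  by rewrite ler_piMr// osc_d_le1.
by rewrite ler_wpM2l// (le_trans _ yx)// osc_le_id.
Qed.

Lemma osc_d_near1 x : 0 <= x -> `|dK x - 1| <= (m + v * x) * x.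
Proof.
move=> x0; have := mvt_le x0 osc_derive2 (@osc_derive2_le x).
by rewrite osc_d0 subr0.
Qed.

Lemma osc_near_id x : 0 <= x -> `|K x - x| <= (m + v * x) * x * x.
Proof.
move=> x0.
have := @mvt_le (fun y => K y - y) (fun y => dK y - 1) 0 x ((m + v * x) * x) x0.
rewrite osc0 !subr0; apply => [y|y /andP[y0 yx]].
  exact: (is_deriveBR (osc_derive y) (is_derive_id y 1)).
apply: le_trans (osc_d_near1 y0) _.
have h1 : 0 <= v * y by exact: mulr_ge0.
have h2 : v * y <= v * x by rewrite ler_wpM2l.
by apply: ler_pM => //; [exact: addr_ge0|rewrite lerD2l].
Qed.

(** The derivative of [K' + m K] is [- v K], so the first order term of [K' - 1] cancels. An error
    of second order survives the division by the time step when a convolution is differentiated. *)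
Lemma osc_dm_near1 x : 0 <= x -> `|dK x + m * K x - 1| <= v * x * x.
Proof.
move=> x0.
have := @mvt_le (fun y => dK y + m * K y) (fun y => - v * K y) 0 x (v * x) x0.
rewrite osc0 osc_d0 mulr0 addr0 subr0; apply => [y|y /andP[y0 yx]].
  apply: (is_derive_eq (is_deriveDR (osc_derive2 y) (is_deriveZR m (osc_derive y)))).
  by ring.
rewrite normrM normrN (ger0_norm v0); apply: ler_wpM2l => //.
exact: le_trans (osc_le_id y0) yx.
Qed.

(** The expression in [s] below is constant; [s = 0] and [s = x] give the two sides. [K' + m K] and
    [K] are the solutions with initial data 1, 0 and 0, 1, so this propagates a state over the time
    [x]. *)
Lemma osc_add (x y : R) : K (x + y) = (dK x + m * K x) * K y + K x * dK y.
Proof.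
have Hc (s : R) : is_derive s 1 (fun s => K s * dK (x + y - s)
   + (dK s + m * K s) * K (x + y - s)) 0.
  have d1 := osc_derive s; have d2 := osc_derive2 s.
  have d3 := @is_derive_compr _ _ (x + y) s osc_derive.
  have d4 := @is_derive_compr _ _ (x + y) s osc_derive2.
  apply: (is_derive_eq (is_deriveDR (is_deriveMR d1 d4)
    (is_deriveMR (is_deriveDR d2 (is_deriveZR m d1)) d3))).
  by ring.
have := @is_derive_0_is_cst R _ x 0 Hc.
rewrite osc0 osc_d0 subr0 mul0r mulr0 addr0 add0r mul1r => <-.
have -> : x + y - x = y by ring.
by ring.
Qed.

Lemma osc_addd (x y : R) : dK (x + y) = dK x * dK y - v * (K x * K y).
Proof.
have Hc (s : R) : is_derive s 1 (fun s => dK s * dK (x + y - s)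
   - v * (K s * K (x + y - s))) 0.
  have d1 := osc_derive s; have d2 := osc_derive2 s.
  have d3 := @is_derive_compr _ _ (x + y) s osc_derive.
  have d4 := @is_derive_compr _ _ (x + y) s osc_derive2.
  apply: (is_derive_eq (is_deriveBR (is_deriveMR d2 d4)
    (is_deriveZR v (is_deriveMR d1 d3)))).
  by ring.
have := @is_derive_0_is_cst R _ x 0 Hc.
rewrite osc0 osc_d0 subr0 mul0r mulr0 subr0 mul1r => <-.
by have -> : x + y - x = y by ring.
Qed.

(** The energy lost over a time span cannot exceed the initial energy 1, however strong the damping
    is. *)
Lemma osc_dissipation (a b : R) : a <= b ->
  2 * m * integ a b (fun s => dK (b - s) ^+ 2) <= 1.
Proof.
move=> ab; have ba : 0 <= b - a by rewrite subr_ge0.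
have cd2 : continuous (fun x => dK x ^+ 2).
  by move=> x; under eq_fun do rewrite expr2; apply: cvgM; exact: osc_contd.
have := FTC_rev ab osc_derive_energy.
rewrite osc0 osc_d0 !mulr0 addr0 mulr1 integZ; last first.
  apply: itg_cont => x; apply: (@continuous_comp _ _ _ (fun s => b - s)
    (fun x => dK x ^+ 2)); last exact: cd2.
  by apply: cvgB; [exact: cvg_cst|exact: cvg_id].
have c2m : continuous (fun x => - (2 * m) * dK x ^+ 2).
  by move=> x; apply: cvgM; [exact: cvg_cst|exact: cd2].
move=> /(_ c2m) H.
have : 0 <= dK (b - a) * dK (b - a) + v * (K (b - a) * K (b - a)).
  by rewrite -!expr2; apply: addr_ge0; [|apply: mulr_ge0]; rewrite ?sqr_ge0.
by lra.
Qed.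

End kernel.
End oscillator.

(** * The Gram matrix of the oscillators *)

Section gram.
Context {R : realType}.

Lemma normM_le (u v U V : R) : `|u| <= U -> `|v| <= V -> `|u * v| <= U * V.
Proof. by move=> uU vV; rewrite normrM; exact: ler_pM. Qed.

Lemma normD_le (u v U V : R) : `|u| <= U -> `|v| <= V -> `|u + v| <= U + V.
Proof. by move=> uU vV; apply: le_trans (ler_normD _ _) _; exact: lerD. Qed.

(* [a], [p], [q], [z] stand for the integrals of the products [K1 K2],
   [K1' K2], [K1 K2'], [K1' K2'] and [A], [P], [Q], [Z] for the increments of
   these products. *)
Lemma gram_algebra (x y rho m1 m2 a p q z A P Q Z : R) :
  1 <= y -> y < x -> 0 <= rho ->
  0 <= m1 <= rho * x ^+ 2 -> 0 <= m2 <= rho * y ^+ 2 ->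
  `|x ^+ 2 * y ^+ 2 * A| <= 1 -> `|y ^+ 2 * P| <= 1 -> `|x ^+ 2 * Q| <= 1 ->
  `|Z| <= 2 -> `|y * ((m1 + m2) * z)| <= x ->
  p + q = A ->
  - (m1 + m2) * z - x ^+ 4 * q - y ^+ 4 * p = Z ->
  (x ^+ 4 - y ^+ 4) * a + m1 * p - m2 * q = Q - P ->
  (x ^+ 4 - y ^+ 4) * z + y ^+ 4 * m1 * p - x ^+ 4 * m2 * q =
    x ^+ 4 * Q - y ^+ 4 * P ->
  `|x ^+ 2 * y ^+ 2 * a| <= (1 + 8 * rho) / (x - y) ^+ 2 /\
  `|z| <= (1 + 8 * rho) / (x - y) ^+ 2.
Proof.
move=> y1 yx; have yx1 : y <= x by exact: ltW.
have y0 : 0 < y by lra.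
have x0 : 0 < x by lra.
have xy0 : 0 < x - y by lra.
have xDy : 0 < x + y by exact: addr_gt0.
have x_le : x <= x + y by lra.
have xBy_le : x - y <= x + y by lra.
move=> rho0 /andP[m10 m1x] /andP[m20 m2y] hA hP hQ hZ hz e1 e2 e3 e4.
pose D := x ^+ 4 - y ^+ 4.
have x2 : 0 <= x ^+ 2 by exact: sqr_ge0.
have y2 : 0 <= y ^+ 2 by exact: sqr_ge0.
have yx2 : y ^+ 2 <= x ^+ 2 by rewrite ler_pXn2r// nnegrE ltW.
have DE : D = (x - y) * ((x + y) * (x ^+ 2 + y ^+ 2)) by rewrite /D; ring.
have D0 : 0 < D.
  rewrite DE; apply: mulr_gt0 => //; apply: mulr_gt0 => //.
  by apply: ltr_pwDl => //; exact: exprn_gt0.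
have hM1 : `|m1| <= rho * x ^+ 2 by rewrite ger0_norm.
have hM2 : `|m2| <= rho * y ^+ 2 by rewrite ger0_norm.
have nX k : `|x ^+ k| <= x ^+ k by rewrite ger0_norm// exprn_ge0// ltW.
have nY k : `|y ^+ k| <= y ^+ k by rewrite ger0_norm// exprn_ge0// ltW.
have nD : `|D| <= D by rewrite ger0_norm// ltW.
(* [e1] and [e2] are a linear system for [p] and [q] with determinant [D] up to sign, once the term
   [(m1 + m2) * z] counts as known through [hz]. *)
have hq : `|D * y * q| <= 4 * x.
  have -> : D * y * q = - (y * Z) - (y * ((m1 + m2) * z))
     - y ^+ 3 * (y ^+ 2 * A).
    by rewrite /D -e1 -e2; ring.
  have h : `|y ^+ 2 * A| <= x ^- 2.
    rewrite -[leRHS]mul1r ler_pdivlMr ?exprn_gt0//.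
    by rewrite -[x ^+ 2]ger0_norm// -normrM [_ * x ^+ 2]mulrC mulrA.
  have h3 : y ^+ 3 * x ^- 2 <= x.
    rewrite ler_pdivrMr ?exprn_gt0// [y ^+ 3]exprS.
    by apply: ler_pM => //; exact: ltW.
  have h1 := normM_le (nY 1%N) hZ; have h2 := normM_le (nY 3%N) h.
  rewrite expr1 in h1.
  have := normD_le (normD_le h1 hz) h2.
  rewrite -normrN !opprD; lra.
have hp : `|D * y ^+ 2 * p| <= 4 * x ^+ 2.
  have -> : D * y ^+ 2 * p = x ^+ 2 * (x ^+ 2 * y ^+ 2 * A) + y ^+ 2 * Z
     + y * (y * ((m1 + m2) * z)).
    by rewrite /D -e1 -e2; ring.
  have := normD_le (normD_le (normM_le (nX 2%N) hA) (normM_le (nY 2%N) hZ))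
    (normM_le (nY 1%N) hz).
  rewrite expr1; have : y * x <= x ^+ 2 by rewrite expr2 ler_wpM2r// ltW.
  lra.
(* [e3] and [e4] express [D a] and [D z] through [p] and [q]; inserting [hp] and [hq] costs a second
   factor [D]. In both cases the boundary terms contribute [D (x^2 + y^2)] and each of the two
   damping terms at most [4 rho x^6]. *)
pose B := D * (x ^+ 2 + y ^+ 2) + 8 * rho * x ^+ 6.
have ha : `|D ^+ 2 * (x ^+ 2 * y ^+ 2 * a)| <= B.
  have -> : D ^+ 2 * (x ^+ 2 * y ^+ 2 * a) =
     D * (y ^+ 2 * (x ^+ 2 * Q)) - D * (x ^+ 2 * (y ^+ 2 * P))
     - x ^+ 2 * (m1 * (D * y ^+ 2 * p))
     + (x ^+ 2 * y ^+ 1) * (m2 * (D * y * q)).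
    have -> : Q = D * a + m1 * p - m2 * q + P by rewrite /D e3 subrK.
    by ring.
  have h1 := normM_le nD (normM_le (nY 2%N) hQ).
  have h2 := normM_le nD (normM_le (nX 2%N) hP).
  have h3 := normM_le (nX 2%N) (normM_le hM1 hp).
  have h4 := normM_le (normM_le (nX 2%N) (nY 1%N)) (normM_le hM2 hq).
  rewrite -normrN in h2; rewrite -normrN in h3.
  apply: le_trans (normD_le (normD_le (normD_le h1 h2) h3) h4) _.
  have : x ^+ 3 * y ^+ 3 <= x ^+ 6.
    rewrite [x ^+ 6](exprD x 3 3) ler_wpM2l ?exprn_ge0 ?(ltW x0)//.
    by rewrite ler_pXn2r// ?nnegrE ltW.
  move=> /(ler_wpM2l rho0); rewrite /B; lra.
have hzz : `|D ^+ 2 * z| <= B.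
  have -> : D ^+ 2 * z =
     D * (x ^+ 2 * (x ^+ 2 * Q)) - D * (y ^+ 2 * (y ^+ 2 * P))
     - y ^+ 2 * (m1 * (D * y ^+ 2 * p))
     + x ^+ 4 * (m2 * (D * q)).
    have Dz : D * z = x ^+ 4 * Q - y ^+ 4 * P - y ^+ 4 * m1 * p + x ^+ 4 * m2 * q.
      by rewrite -e4 /D; ring.
    by rewrite expr2 -mulrA Dz; ring.
  have hq' : `|y * (m2 * (D * q))| <= rho * y ^+ 2 * (4 * x).
    by have := normM_le hM2 hq; congr (`|_| <= _); ring.
  have hq2 : `|x ^+ 4 * (m2 * (D * q))| <= 4 * rho * x ^+ 6.
    rewrite -(ler_pM2l y0) -{1}(gtr0_norm y0) -normrM mulrCA.
    apply: le_trans (normM_le (nX 4%N) hq') _.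
    have : x ^+ 5 * y ^+ 2 <= x ^+ 6 * y.
      have -> : x ^+ 5 * y ^+ 2 = x ^+ 5 * y * y by ring.
      have -> : x ^+ 6 * y = x ^+ 5 * y * x by ring.
      by rewrite ler_wpM2l// mulr_ge0 ?exprn_ge0// ltW.
    move=> /(ler_wpM2l rho0); lra.
  have h1 := normM_le nD (normM_le (nX 2%N) hQ).
  have h2 := normM_le nD (normM_le (nY 2%N) hP).
  have h3 := normM_le (nY 2%N) (normM_le hM1 hp).
  rewrite -normrN in h2; rewrite -normrN in h3.
  apply: le_trans (normD_le (normD_le (normD_le h1 h2) h3) hq2) _.
  have : x ^+ 4 * y ^+ 2 <= x ^+ 6.
    by rewrite [x ^+ 6](exprD x 4 2) ler_wpM2l ?exprn_ge0 ?(ltW x0).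
  move=> /(ler_wpM2l rho0); rewrite /B; lra.
(* [D^2 = (x - y)^2 E], and [E] dominates both [D (x^2 + y^2)] and [x^6]. *)
have BD : B <= (1 + 8 * rho) / (x - y) ^+ 2 * D ^+ 2.
  rewrite mulrAC ler_pdivlMr ?exprn_gt0//.
  pose E := (x + y) ^+ 2 * (x ^+ 2 + y ^+ 2) ^+ 2.
  have xE : x ^+ 6 <= E.
    rewrite [x ^+ 6](exprD x 2 4) (exprM x 2 2).
    apply: ler_pM; rewrite ?exprn_ge0 ?(ltW x0)//.
      by rewrite ler_pXn2r// nnegrE ltW.
    by rewrite ler_pXn2r ?nnegrE ?addr_ge0// lerDl.
  have DB : D * (x ^+ 2 + y ^+ 2) <= E.
    have -> : D * (x ^+ 2 + y ^+ 2) = (x - y) * (x + y) * (x ^+ 2 + y ^+ 2) ^+ 2.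
      by rewrite DE; ring.
    by rewrite ler_wpM2r ?sqr_ge0// expr2 ler_wpM2r// ltW.
  have -> : (1 + 8 * rho) * D ^+ 2 = (1 + 8 * rho) * E * (x - y) ^+ 2.
    by rewrite DE /E; ring.
  rewrite ler_wpM2r ?sqr_ge0//.
  have := ler_wpM2l rho0 xE; rewrite /B; lra.
have D2 : 0 < D ^+ 2 by exact: exprn_gt0.
split; rewrite -(ler_pM2r D2) (le_trans _ BD)//.
  by rewrite -{1}(gtr0_norm D2) -normrM mulrC.
by rewrite -{1}(gtr0_norm D2) -normrM mulrC.
Qed.

End gram.

(** * Schur's test for Gram matrices with inverse square decay *)

Section schur.
Context {R : realType}.

(** Lowering [j^2] to [j^2 - 1/4] makes the inverse squares telescope over half-integers. *)
Let inv_sqr_step (j : R) : 1 <= j ->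
  (j ^+ 2)^-1 <= (j - 2^-1)^-1 - (j + 2^-1)^-1.
Proof.
move=> j1; have h1 : 0 < j - 2^-1 by lra.
have h2 : 0 < j + 2^-1 by lra.
have -> : (j - 2^-1)^-1 - (j + 2^-1)^-1 = ((j - 2^-1) * (j + 2^-1))^-1.
  by field; apply/andP; split; apply: lt0r_neq0; lra.
rewrite lef_pV2 ?posrE; [|apply: exprn_gt0; lra|exact: mulr_gt0].
by rewrite -subr_sqr gerBl sqr_ge0.
Qed.

Let natrB1 (k n : nat) : (k < n)%N -> (1 : R) <= n%:R - k%:R.
Proof. by move=> kn; rewrite -natrB ?(ltnW kn)// ler1n subn_gt0. Qed.

Let sum_lt (n N : nat) : (N <= n)%N ->
  \sum_(k < N) (if (k < n)%N then ((n%:R - k%:R : R) ^+ 2)^-1 else 0) <=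
  (n%:R - N%:R + 2^-1)^-1.
Proof.
elim: N => [_|N IH Nn].
  by rewrite big_ord0 invr_ge0 subr0 addr_ge0.
rewrite big_ord_recr/= Nn; have := IH (ltnW Nn).
have := inv_sqr_step (natrB1 Nn); rewrite -[N.+1%:R]natr1.
have -> : n%:R - (N%:R + 1) + 2^-1 = n%:R - N%:R - 2^-1 :> R by lra.
lra.
Qed.

Let sum_gt (n N : nat) : (n < N)%N ->
  \sum_(k < N) (if (n < k)%N then ((n%:R - k%:R : R) ^+ 2)^-1 else 0) <=
  2 - (N%:R - n%:R - 2^-1)^-1.
Proof.
elim: N => // N IH; rewrite ltnS leq_eqVlt => /predU1P[<-|nN].
  rewrite big1 => [|k _]; last by rewrite ltnNge -ltnS ltn_ord.
  have -> : n.+1%:R - n%:R - 2^-1 = 2^-1 :> R by rewrite -[n.+1%:R]natr1; lra.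
  by rewrite invrK subrr.
rewrite big_ord_recr/= nN; have := IH nN.
have := inv_sqr_step (natrB1 nN); rewrite -[N.+1%:R]natr1.
have -> : N%:R + 1 - n%:R - 2^-1 = N%:R - n%:R + 2^-1 :> R by lra.
rewrite -[(n%:R - N%:R) ^+ 2]sqrrN opprB; lra.
Qed.

(** Each side of the diagonal telescopes to at most 2. *)
Lemma sum_inv_sqr (n N : nat) : (n < N)%N ->
  \sum_(k < N) (if n == k then 0 else ((n%:R - k%:R : R) ^+ 2)^-1) <= 4.
Proof.
move=> nN; have h1 : \sum_(k < N)
    (if (k < n)%N then ((n%:R - k%:R : R) ^+ 2)^-1 else 0) <= 2.
  rewrite -(subnKC (ltnW nN)) big_split_ord/= [X in _ + X]big1 => [|k _].
    by have := sum_lt (leqnn n); rewrite subrr add0r invrK addr0.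
  by rewrite ltnNge leq_addr.
have h2 := sum_gt nN.
have h3 : 0 <= (N%:R - n%:R - 2^-1 : R)^-1.
  by rewrite invr_ge0; have := natrB1 nN; lra.
apply: (@le_trans _ _ (2 + 2)); last by lra.
apply: le_trans (lerD h1 (le_trans h2 _)); last by lra.
rewrite -big_split/=; apply: ler_sum => k _.
by case: (ltngtP n k); rewrite ?addr0 ?add0r.
Qed.

(** The Gram matrix is dominated entrywise by the symmetric matrix [g], whose rows sum to at most
    [d + 4 c]. *)
Lemma riesz_of_gram (a b c d : R) (e : nat -> R -> R) (N : nat) (x : nat -> R) :
  0 <= c -> (forall n, sqitg a b (e n)) ->
  (forall n, integ a b (fun s => e n s ^+ 2) <= d) ->
  (forall n k, (k < n)%N -> `|integ a b (fun s => e n s * e k s)| <=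
     c / (n%:R - k%:R) ^+ 2) ->
  integ a b (fun s => (\sum_(n < N) x n * e n s) ^+ 2) <=
    (d + 4 * c) * \sum_(n < N) x n ^+ 2.
Proof.
move=> c0 ei ed ec.
have eei n k : itg a b (fun s => x n * x k * (e n s * e k s)).
  by apply: itgZ; exact: sqitg_mul.
pose g (n k : nat) : R := if n == k then d else c / (n%:R - k%:R) ^+ 2.
have d0 : 0 <= d.
  by apply: le_trans (ed 0%N); apply: integ_ge0 => s _; exact: sqr_ge0.
have gC n k : g n k = g k n.
  by rewrite /g eq_sym; case: ifP => // _; rewrite -sqrrN opprB.
have g0 n k : 0 <= g n k.
  by rewrite /g; case: ifP => // _; rewrite divr_ge0 ?sqr_ge0.
have Gg n k : `|integ a b (fun s => e n s * e k s)| <= g n k.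
  have [nk|nk|<-] := ltngtP n k.
  - rewrite gC /g gtn_eqF//; under eq_integ do rewrite mulrC; exact: ec.
  - by rewrite /g gtn_eqF//; exact: ec.
  - rewrite /g eqxx; under eq_integ do rewrite -expr2.
    by rewrite ger0_norm//; apply: integ_ge0 => s _; exact: sqr_ge0.
have -> : integ a b (fun s => (\sum_(n < N) x n * e n s) ^+ 2) =
    \sum_(n < N) \sum_(k < N) x n * x k * integ a b (fun s => e n s * e k s).
  rewrite (@eq_integ _ _ _ _
      (fun s => \sum_(n < N) \sum_(k < N) x n * x k * (e n s * e k s))).
    rewrite (@integ_sum _ _ _ _
      (fun n s => \sum_(k < N) x n * x k * (e n s * e k s))); last first.
      by move=> n; apply: (@itg_sum _ _ _ _ (fun k s => x n * x k * (e n s * e k s))).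
    apply: eq_bigr => n _.
    rewrite (@integ_sum _ _ _ _ (fun k s => x n * x k * (e n s * e k s)))//.
    by apply: eq_bigr => k _; rewrite integZ//; exact: sqitg_mul.
  move=> s _; rewrite expr2 mulr_suml; apply: eq_bigr => n _.
  by rewrite mulr_sumr; apply: eq_bigr => k _; ring.
(* Here [|x_n x_k| <= (x_n^2 + x_k^2) / 2]; by the symmetry of [g] both halves lead to the same row
   sums. *)
apply: (@le_trans _ _ (\sum_(n < N) \sum_(k < N)
    (2^-1 * (g n k * x n ^+ 2) + 2^-1 * (g k n * x k ^+ 2)))).
  apply: ler_sum => n _; apply: ler_sum => k _.
  apply: le_trans (ler_norm _) _; rewrite normrM.
  apply: (@le_trans _ _ (`|x n * x k| * g n k)); first by rewrite ler_wpM2l.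
  rewrite (gC k n) normrM -(real_normK (num_real (x n))).
  rewrite -(real_normK (num_real (x k))).
  have := mulr_ge0 (g0 n k) (sqr_ge0 (`|x n| - `|x k|)); lra.
under eq_bigr do rewrite big_split/=.
rewrite big_split/= [X in _ + X]exchange_big/= -big_split/= mulr_sumr.
apply: ler_sum => n _; rewrite -mulr_sumr -mulrDl.
rewrite (_ : 2^-1 + 2^-1 = 1) ?mul1r -?mulr_suml; last by lra.
rewrite ler_wpM2r ?sqr_ge0//.
apply: (@le_trans _ _ (\sum_(k < N) ((if n == k then d else 0) +
    c * (if n == k :> nat then 0 else ((n%:R - k%:R : R) ^+ 2)^-1)))).
  apply: ler_sum => k _; rewrite /g -[n == k]/(n == k :> nat).
  by case: ifP; rewrite ?mulr0 ?addr0 ?add0r.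
rewrite big_split/= -mulr_sumr; apply: lerD.
  by rewrite -big_mkcond/= (big_pred1 n)// => k; rewrite eq_sym.
by rewrite mulrC ler_wpM2r// sum_inv_sqr.
Qed.

End schur.

(** * Riesz and Bessel inequalities for the whole family of kernels *)

Section family.
Context {R : realType}.

Lemma continuous_rev (f : R -> R) (b : R) : continuous f ->
  continuous (fun s => f (b - s)).
Proof.
move=> cf x; apply: (@continuous_comp _ _ _ (fun s => b - s) f); last exact: cf.
by apply: cvgB; [exact: cvg_cst|exact: cvg_id].
Qed.

Lemma continuousM (f g : R -> R) : continuous f -> continuous g ->
  continuous (fun s => f s * g s).
Proof. by move=> cf cg x; apply: cvgM; [exact: cf|exact: cg]. Qed.

(** Index 1 is the faster mode [n], index 2 the slower mode [k]. The span of the four products is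
    stable under differentiation, which is why the relations close up; [ftc] extracts one relation
    per product. *)
Lemma gram_oscillators (rho m1 m2 a b : R) (k n : nat) (K1 dK1 K2 dK2 : R -> R) :
  0 <= rho -> a <= b -> (0 < k < n)%N ->
  oscillator m1 (n%:R ^+ 4) K1 dK1 -> oscillator m2 (k%:R ^+ 4) K2 dK2 ->
  0 <= m2 <= m1 -> m1 <= rho * n%:R ^+ 2 -> m2 <= rho * k%:R ^+ 2 ->
  m1 * k%:R ^+ 2 <= m2 * n%:R ^+ 2 ->
  `|n%:R ^+ 2 * k%:R ^+ 2 * integ a b (fun s => K1 (b - s) * K2 (b - s))| <=
    (1 + 8 * rho) / (n%:R - k%:R) ^+ 2 /\
  `|integ a b (fun s => dK1 (b - s) * dK2 (b - s))| <=
    (1 + 8 * rho) / (n%:R - k%:R) ^+ 2.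
Proof.
move=> rho0 ab /andP[k0 kn] o1 o2 /andP[m20 m21] m1n m2k m12.
set x : R := n%:R; set y : R := k%:R.
have y1 : 1 <= y by rewrite ler1n.
have yx : y < x by rewrite ltr_nat.
have x0 : 0 < x by lra.
have y0 : 0 < y by lra.
have m10 : 0 <= m1 by lra.
have v1 : 0 <= x ^+ 4 by rewrite exprn_ge0// ltW.
have v2 : 0 <= y ^+ 4 by rewrite exprn_ge0// ltW.
have d0 : 0 <= b - a by rewrite subr_ge0.
have cK1 := osc_cont o1; have cdK1 := osc_contd o1.
have cK2 := osc_cont o2; have cdK2 := osc_contd o2.
pose J f := integ a b (fun s => f (b - s)).
pose fA s := K1 s * K2 s; pose fP s := dK1 s * K2 s.
pose fQ s := K1 s * dK2 s; pose fZ s := dK1 s * dK2 s.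
have cA : continuous fA by exact: continuousM.
have cP : continuous fP by exact: continuousM.
have cQ : continuous fQ by exact: continuousM.
have cZ : continuous fZ by exact: continuousM.
have itgJ f : continuous f -> itg a b (fun s => f (b - s)).
  by move=> cf; apply: itg_cont; exact: continuous_rev.
have lin (c1 c2 c3 c4 : R) : J (fun s => c1 * fA s + c2 * fP s + c3 * fQ s + c4 * fZ s)
    = c1 * J fA + c2 * J fP + c3 * J fQ + c4 * J fZ.
  have iA := itgZ c1 (itgJ _ cA); have iP := itgZ c2 (itgJ _ cP).
  have iQ := itgZ c3 (itgJ _ cQ); have iZ := itgZ c4 (itgJ _ cZ).
  by rewrite /J 3?integD ?integZ//; do ?[exact: itgJ|exact: itgD|apply: itgD].
have clin (c1 c2 c3 c4 : R) :
    continuous (fun s => c1 * fA s + c2 * fP s + c3 * fQ s + c4 * fZ s).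
  move=> s; apply: cvgD; [apply: cvgD; [apply: cvgD|]|];
    (apply: cvgM; [exact: cvg_cst|]); [exact: cA|exact: cP|exact: cQ|exact: cZ].
have ftc (f : R -> R) (c1 c2 c3 c4 : R) : (forall s : R, is_derive s 1 f
    (c1 * fA s + c2 * fP s + c3 * fQ s + c4 * fZ s)) ->
    c1 * J fA + c2 * J fP + c3 * J fQ + c4 * J fZ = f (b - a) - f 0.
  by move=> H; rewrite -lin /J (FTC_rev ab H).
have D1 := osc_derive o1; have D1' := osc_derive2 o1.
have D2 := osc_derive o2; have D2' := osc_derive2 o2.
have A0 : fA 0 = 0 by rewrite /fA (osc0 o1) mul0r.
have P0 : fP 0 = 0 by rewrite /fP (osc0 o2) mulr0.
have Q0 : fQ 0 = 0 by rewrite /fQ (osc0 o1) mul0r.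
have Z0 : fZ 0 = 1 by rewrite /fZ (osc_d0 o1) (osc_d0 o2) mulr1.
have eA : J fP + J fQ = fA (b - a).
  have dA (s : R) : is_derive s 1 fA (0 * fA s + 1 * fP s + 1 * fQ s + 0 * fZ s).
    apply: (is_derive_eq (is_deriveMR (D1 s) (D2 s))).
    by rewrite /fA /fP /fQ /fZ; ring.
  by have := ftc _ _ _ _ _ dA; rewrite A0 subr0 => <-; ring.
have eZ : - (m1 + m2) * J fZ - x ^+ 4 * J fQ - y ^+ 4 * J fP = fZ (b - a) - 1.
  have dd (s : R) : is_derive s 1 fZ
      (0 * fA s + (- y ^+ 4) * fP s + (- x ^+ 4) * fQ s + (- (m1 + m2)) * fZ s).
    apply: (is_derive_eq (is_deriveMR (D1' s) (D2' s))).
    by rewrite /fA /fP /fQ /fZ -/x -/y; ring.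
  by have := ftc _ _ _ _ _ dd; rewrite Z0 => <-; ring.
have eP : J fZ - x ^+ 4 * J fA - m1 * J fP = fP (b - a).
  have dd (s : R) : is_derive s 1 fP
      ((- x ^+ 4) * fA s + (- m1) * fP s + 0 * fQ s + 1 * fZ s).
    apply: (is_derive_eq (is_deriveMR (D1' s) (D2 s))).
    by rewrite /fA /fP /fQ /fZ -/x -/y; ring.
  by have := ftc _ _ _ _ _ dd; rewrite P0 subr0 => <-; ring.
have eQ : J fZ - y ^+ 4 * J fA - m2 * J fQ = fQ (b - a).
  have dd (s : R) : is_derive s 1 fQ
      ((- y ^+ 4) * fA s + 0 * fP s + (- m2) * fQ s + 1 * fZ s).
    apply: (is_derive_eq (is_deriveMR (D1 s) (D2' s))).
    by rewrite /fA /fP /fQ /fZ -/x -/y; ring.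
  by have := ftc _ _ _ _ _ dd; rewrite Q0 subr0 => <-; ring.
have bK1 : `|x ^+ 2 * K1 (b - a)| <= 1.
  by apply: (osc_scaled_le1 o1) => //; [exact: exprn_ge0|rewrite -exprM].
have bK2 : `|y ^+ 2 * K2 (b - a)| <= 1.
  by apply: (osc_scaled_le1 o2) => //; [exact: exprn_ge0|rewrite -exprM].
have bd1 := osc_d_le1 o1 m10 v1 d0; have bd2 := osc_d_le1 o2 m20 v2 d0.
(* Weighted AM-GM gives [2 x y |z| <= x^2 I1 + y^2 I2], and dissipation bounds [2 m1 I1] and
   [2 m2 I2] by 1. The mismatched product [m1 y^2 I2] is first replaced by [m2 x^2 I2], using the
   last hypothesis. *)
have hz : `|y * ((m1 + m2) * J fZ)| <= x.
  have i1 : itg a b (fun s => dK1 (b - s) ^+ 2).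
    under eq_fun do rewrite expr2; apply: itgJ (fun s => dK1 s * dK1 s) _.
    exact: continuousM.
  have i2 : itg a b (fun s => dK2 (b - s) ^+ 2).
    under eq_fun do rewrite expr2; apply: itgJ (fun s => dK2 s * dK2 s) _.
    exact: continuousM.
  have e1 := osc_dissipation o1 v1 ab.
  have e2 := osc_dissipation o2 v2 ab.
  set I1 := integ a b (fun s => dK1 (b - s) ^+ 2) in e1.
  set I2 := integ a b (fun s => dK2 (b - s) ^+ 2) in e2.
  have I20 : 0 <= I2 by apply: integ_ge0 => s _; exact: sqr_ge0.
  have I10 : 0 <= I1 by apply: integ_ge0 => s _; exact: sqr_ge0.
  have xyz : 2 * (x * y) * `|J fZ| <= x ^+ 2 * I1 + y ^+ 2 * I2.
    apply: (@le_trans _ _ (2 * (x * y) * integ a b (fun s => `|fZ (b - s)|))).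
      rewrite ler_wpM2l ?mulr_ge0 ?(ltW x0) ?(ltW y0)//.
      by apply: ler_norm_integ; exact: itgJ.
    rewrite -integZ; last exact/itg_norm/itgJ.
    rewrite -!integZ// -integD; [|exact: itgZ|exact: itgZ].
    apply: le_integ; [exact/itgZ/itg_norm/itgJ|by apply: itgD; exact: itgZ|].
    move=> s _; rewrite /fZ normrM -(real_normK (num_real (dK1 _))).
    rewrite -(real_normK (num_real (dK2 _))).
    have := sqr_ge0 (x * `|dK1 (b - s)| - y * `|dK2 (b - s)|); lra.
  rewrite 2!normrM (gtr0_norm y0) ger0_norm ?addr_ge0//.
  rewrite -(ler_pM2l x0).
  have h1 : (m1 + m2) * (2 * (x * y) * `|J fZ|) <=
      2 * m1 * (x ^+ 2 * I1 + y ^+ 2 * I2).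
    apply: ler_pM; rewrite ?addr_ge0// ?mulr_ge0// ?(ltW x0) ?(ltW y0)//; lra.
  have h2 : m1 * y ^+ 2 * I2 <= m2 * x ^+ 2 * I2 by rewrite ler_wpM2r.
  have h3 := ler_wpM2l (sqr_ge0 x) e1.
  have h4 := ler_wpM2l (sqr_ge0 x) e2.
  lra.
have [] := @gram_algebra R x y rho m1 m2 (J fA) (J fP) (J fQ) (J fZ)
  (fA (b - a)) (fP (b - a)) (fQ (b - a)) (fZ (b - a) - 1) y1 yx rho0.
- by rewrite m10.
- by rewrite m20.
- have := normM_le bK1 bK2; rewrite mulr1 /fA; congr (`|_| <= _); ring.
- have := normM_le bd1 bK2; rewrite mulr1 /fP; congr (`|_| <= _); ring.
- have := normM_le bK1 bd2; rewrite mulr1 /fQ; congr (`|_| <= _); ring.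
- have := normM_le bd1 bd2; rewrite mulr1 => h.
  have := normD_le h (_ : `|- 1| <= 1 :> R); rewrite normrN1; exact.
- exact: hz.
- exact: eA.
- exact: eZ.
- by rewrite -eP -eQ; ring.
- by rewrite -eP -eQ; ring.
by [].
Qed.

(** Abstract form of the damping [rho n^(2 alpha)]: growth at most quadratic, [m n] nondecreasing
    and [m n / n^2] nonincreasing, the latter without division so that mode 0 is included. The
    growth bound forces [m 0 = 0]. *)
Definition oscillator_family (rho : R) (m : nat -> R) (K dK : nat -> R -> R) :=
  [/\ 0 <= rho,
      forall n, oscillator (m n) (n%:R ^+ 4) (K n) (dK n),
      forall n, 0 <= m n <= rho * n%:R ^+ 2 &
      forall k n, (k <= n)%N ->
        m k <= m n /\ m n * k%:R ^+ 2 <= m k * n%:R ^+ 2].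

(* The value at [n = 0] matches the weight of the mode [0] in X_N^p:
   multiplication by [freq] maps X_N^p isometrically onto X_N^(p - 2). *)
Definition freq (n : nat) : R := if n == 0%N then 1 else n%:R ^+ 2.

Lemma freq_ge1 n : 1 <= freq n.
Proof. by rewrite /freq; case: n => // n; rewrite exprn_ege1// ler1n. Qed.

Lemma freq_gt0 n : 0 < freq n.
Proof. exact: lt_le_trans ltr01 (freq_ge1 n). Qed.

Lemma sqr_le_freq n : n%:R ^+ 2 <= freq n.
Proof. by rewrite /freq; case: n => [|n]//; rewrite expr0n. Qed.

(** The factors 2 come from splitting off mode 0. The first term is the Schur bound for [n >= 1],
    with diagonal at most [T]; the second bounds the square integral of mode 0, which is at most
    [1 + T] pointwise. *)
Definition bessel_bound (rho T : R) : R :=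
  2 * (T + 4 * (1 + 8 * rho)) + 2 * (T * (1 + T) ^+ 2).

Section bessel.
Variables (rho T : R) (m : nat -> R) (K dK : nat -> R -> R).
Hypotheses (F : oscillator_family rho m K dK) (T0 : 0 <= T).

Let B := bessel_bound rho T.

Lemma bessel_bound_gt0 : 0 < B.
Proof.
have [rho0 _ _ _] := F; have t0 := T0; rewrite /B /bessel_bound.
have := mulr_ge0 T0 (sqr_ge0 (1 + T)); lra.
Qed.

Lemma family_osc n : oscillator (m n) (n%:R ^+ 4) (K n) (dK n).
Proof. by case: F. Qed.

Lemma family_m0 n : 0 <= m n.
Proof. by case: F => _ _ H _; have /andP[] := H n. Qed.

Lemma family_v0 n : 0 <= n%:R ^+ 4 :> R.
Proof. exact: exprn_ge0. Qed.

Lemma family_cont n b : continuous (fun s => freq n * K n (b - s)).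
Proof.
apply: continuousM; first exact: cst_continuous.
exact: continuous_rev (osc_cont (family_osc n)).
Qed.

Lemma family_contd n b : continuous (fun s => dK n (b - s)).
Proof. exact: continuous_rev (osc_contd (family_osc n)). Qed.

Lemma family_d_le1 n (x : R) : 0 <= x -> `|dK n x| <= 1.
Proof.
by move=> x0; apply: (osc_d_le1 (family_osc n) (family_m0 n) (family_v0 n) x0).
Qed.

(** For [n >= 1] the energy gives the bound 1. Mode 0 has no restoring force and may grow linearly,
    hence the summand [x]. *)
Lemma family_scaled_le n (x : R) : 0 <= x -> `|freq n * K n x| <= 1 + x.
Proof.
move=> x0; rewrite /freq; case: eqP => [->|_].
  rewrite mul1r.
  have := osc_le_id (family_osc 0) (family_m0 0) (family_v0 0) x0; lra.
have vE : n%:R ^+ 4 = (n%:R ^+ 2) ^+ 2 :> R by rewrite -exprM.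
have := osc_scaled_le1 (family_osc n) (family_m0 n) (sqr_ge0 _) vE x0; lra.
Qed.

Lemma integ_sqr_le (a b M : R) (f : R -> R) : a <= b -> 0 <= M -> continuous f ->
  (forall s, a < s < b -> `|f s| <= M) ->
  integ a b (fun s => f s ^+ 2) <= M ^+ 2 * (b - a).
Proof.
move=> ab M0 cf fM; rewrite -integ_cst//; apply: le_integ.
- by have [] := sqitg_cont a b cf.
- by apply: itg_cont; exact: cst_continuous.
- move=> s /fM h; rewrite -real_normK ?num_real// ler_pXn2r ?nnegrE//.
Qed.

(** The Gram estimate needs positive frequencies, so mode 0 is separated by
    [(u + v)^2 <= 2 u^2 + 2 v^2] and the remaining modes, shifted by one, go through Schur's
    test. *)
Let riesz_aux (a b : R) (e : nat -> R -> R) N (x : nat -> R) :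
  0 <= a -> a <= b -> b <= T -> (forall n, continuous (e n)) ->
  (forall s, a < s < b -> `|e 0%N s| <= 1 + T) ->
  (forall n s, a < s < b -> `|e n.+1 s| <= 1) ->
  (forall n k, (k < n)%N -> `|integ a b (fun s => e n.+1 s * e k.+1 s)| <=
     (1 + 8 * rho) / (n%:R - k%:R) ^+ 2) ->
  integ a b (fun s => (\sum_(n < N) x n * e n s) ^+ 2) <=
    B * \sum_(n < N) x n ^+ 2.
Proof.
move=> a0 ab bT ce e0 e1 eg; have t0 := T0; have [rho0 _ _ _] := F.
have ei n : sqitg a b (e n) by exact: sqitg_cont.
case: N => [|N].
  rewrite big_ord0 mulr0 (@eq_integ _ _ _ _ (fun=> 0)) ?integ_cst ?mul0r//.
  by move=> s _; rewrite big_ord0 expr0n.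
rewrite big_ord_recl.
pose g s := \sum_(n < N) x n.+1 * e n.+1 s.
have gi : sqitg a b g.
  by apply: (@sqitg_sum _ _ _ _ (fun n s => x n.+1 * e n.+1 s)) => n; exact: sqitgZ.
have [_ gi2] := gi; have [_ ei2] := ei 0%N.
have xei : itg a b (fun s => 2 * x 0%N ^+ 2 * e 0%N s ^+ 2) by exact: itgZ.
have gi3 : itg a b (fun s => 2 * g s ^+ 2) by exact: itgZ.
apply: (@le_trans _ _ (integ a b
    (fun s => 2 * x 0%N ^+ 2 * e 0%N s ^+ 2 + 2 * g s ^+ 2))).
  apply: le_integ; last first.
  - move=> s _; rewrite big_ord_recl/=.
    have := sqr_ge0 (x 0%N * e 0%N s - g s); rewrite -/(g s); lra.
  - exact: itgD.
  - have [_] := sqitgD (sqitgZ (x 0%N) (ei 0%N)) gi.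
    by apply: eq_itg => s _; rewrite big_ord_recl.
rewrite integD// !integZ//.
have h0 : integ a b (fun s => e 0%N s ^+ 2) <= T * (1 + T) ^+ 2.
  apply: le_trans (@integ_sqr_le a b (1 + T) _ ab _ (ce 0%N) e0) _; first by lra.
  by rewrite mulrC ler_wpM2r ?sqr_ge0//; lra.
have h1 : integ a b (fun s => g s ^+ 2) <=
    (T + 4 * (1 + 8 * rho)) * \sum_(n < N) x n.+1 ^+ 2.
  apply: (@riesz_of_gram _ _ _ _ _ (fun n => e n.+1) N (fun n => x n.+1)) => //.
    by lra.
  move=> n; apply: le_trans (@integ_sqr_le a b 1 _ ab _ (ce n.+1) (e1 n)) _ => //.
  rewrite expr1n mul1r; lra.
have S0 : 0 <= \sum_(n < N) x n.+1 ^+ 2 by apply: sumr_ge0 => n _; exact: sqr_ge0.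
have h2 := ler_wpM2l (sqr_ge0 (x 0%N)) h0.
have h3 := mulr_ge0 (mulr_ge0 T0 (sqr_ge0 (1 + T))) S0.
have h4 : 0 <= (T + 4 * (1 + 8 * rho)) * x 0%N ^+ 2.
  by apply: mulr_ge0; [lra|exact: sqr_ge0].
rewrite /B /bessel_bound /=; lra.
Qed.

Lemma riesz_K (a b : R) N (x : nat -> R) : 0 <= a -> a <= b -> b <= T ->
  integ a b (fun s => (\sum_(n < N) x n * (freq n * K n (b - s))) ^+ 2) <=
    B * \sum_(n < N) x n ^+ 2.
Proof.
move=> a0 ab bT; have [rho0 _ mr mm] := F.
apply: (@riesz_aux a b (fun n s => freq n * K n (b - s))) => //.
- by move=> n; exact: family_cont.
- move=> s /andP[as_ sb]; apply: le_trans (@family_scaled_le 0 (b - s) _) _; lra.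
- move=> n s /andP[as_ sb]; rewrite /freq/=.
  apply: (osc_scaled_le1 (family_osc n.+1) (family_m0 n.+1)).
  + exact: sqr_ge0.
  + by rewrite -exprM.
  + lra.
- move=> n k kn; have [m1 m2] := mm k.+1 n.+1 (ltnW kn).
  have /andP[mk0 mk] := mr k.+1; have /andP[_ mn] := mr n.+1.
  have := @gram_oscillators rho (m n.+1) (m k.+1) a b k.+1 n.+1 _ _ _ _ rho0 ab
    kn (family_osc n.+1) (family_osc k.+1) _ mn mk m2.
  rewrite mk0 m1 => /(_ isT)[+ _].
  rewrite -integZ; last by apply: itg_cont; apply: continuousM;
    apply: continuous_rev; exact: osc_cont (family_osc _).
  rewrite -[n.+1%:R]natr1 -[k.+1%:R]natr1 opprD addrACA subrr addr0.
  apply: le_trans; rewrite le_eqVlt; apply/orP; left; apply/eqP; congr (`|_|).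
  by apply: eq_integ => s _; rewrite /freq/= -![_.+1%:R]natr1; ring.
Qed.

Lemma riesz_dK (a b : R) N (x : nat -> R) : 0 <= a -> a <= b -> b <= T ->
  integ a b (fun s => (\sum_(n < N) x n * dK n (b - s)) ^+ 2) <=
    B * \sum_(n < N) x n ^+ 2.
Proof.
move=> a0 ab bT; have [rho0 _ mr mm] := F; have t0 := T0.
apply: (@riesz_aux a b (fun n s => dK n (b - s))) => //.
- by move=> n; exact: family_contd.
- move=> s /andP[as_ sb]; apply: le_trans (@family_d_le1 0 (b - s) _) _; lra.
- move=> n s /andP[as_ sb]; apply: family_d_le1; lra.
- move=> n k kn; have [m1 m2] := mm k.+1 n.+1 (ltnW kn).
  have /andP[mk0 mk] := mr k.+1; have /andP[_ mn] := mr n.+1.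
  have := @gram_oscillators rho (m n.+1) (m k.+1) a b k.+1 n.+1 _ _ _ _ rho0 ab
    kn (family_osc n.+1) (family_osc k.+1) _ mn mk m2.
  rewrite mk0 m1 => /(_ isT)[_].
  by rewrite -[n.+1%:R]natr1 -[k.+1%:R]natr1 opprD addrACA subrr addr0.
Qed.

Lemma bessel_K (a b : R) N h : 0 <= a -> a <= b -> b <= T -> sqitg a b h ->
  \sum_(n < N) integ a b (fun s => freq n * K n (b - s) * h s) ^+ 2 <=
    B * integ a b (fun s => h s ^+ 2).
Proof.
move=> a0 ab bT hi.
apply: (@bessel_of_riesz _ a b B (fun n s => freq n * K n (b - s))) => //.
- exact: bessel_bound_gt0.
- by move=> n; apply: sqitg_cont; exact: family_cont.
- by move=> x; exact: riesz_K.
Qed.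

Lemma bessel_dK (a b : R) N h : 0 <= a -> a <= b -> b <= T -> sqitg a b h ->
  \sum_(n < N) integ a b (fun s => dK n (b - s) * h s) ^+ 2 <=
    B * integ a b (fun s => h s ^+ 2).
Proof.
move=> a0 ab bT hi.
apply: (@bessel_of_riesz _ a b B (fun n s => dK n (b - s))) => //.
- exact: bessel_bound_gt0.
- by move=> n; apply: sqitg_cont; exact: family_contd.
- by move=> x; exact: riesz_dK.
Qed.

End bessel.
End family.

(** * One-sided derivatives on segments *)

Section derivative_on_segment.
Context {R : realType}.
Implicit Types (a b t l : R) (f g : R -> R).

Lemma near_within_segment a b t (P : set R) :
  (\forall s \near within `[a, b] (nbhs t), P s) <->
  exists2 d, 0 < d & forall s, a <= s <= b -> `|s - t| < d -> P s.
Proof.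
rewrite /within/=; split.
  move=> /nbhs_ballP[d /= d0 H]; exists d => // s sab st; apply: H.
    by rewrite /ball/= distrC.
  by rewrite /= in_itv.
move=> [d d0 H]; apply/nbhs_ballP; exists d => //= s; rewrite /ball/= distrC.
by move=> st; rewrite in_itv/= => sab; exact: H.
Qed.

Lemma near_within_dnbhs a b t (P : set R) :
  (\forall s \near within `[a, b] t^', P s) <->
  exists2 d, 0 < d & forall s, a <= s <= b -> s != t -> `|s - t| < d -> P s.
Proof.
rewrite /dnbhs /within/=; split.
  move=> /nbhs_ballP[d /= d0 H]; exists d => // s sab snt st.
  apply: (H s _ snt); first by rewrite /ball/= distrC.
  by rewrite /= in_itv.
move=> [d d0 H]; apply/nbhs_ballP; exists d => //= s; rewrite /ball/= distrC.
by move=> st snt; rewrite in_itv/= => sab; exact: H.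
Qed.

(** Gives uniqueness of derivatives relative to the segment, endpoints included: a nearby point is
    taken to the right of [t], or to the left when [t = b]. *)
Lemma within_dnbhs_proper a b t : a < b -> a <= t <= b ->
  ProperFilter (within `[a, b] t^').
Proof.
move=> ab /andP[at_ tb]; split; last exact: within_filter.
move=> /near_within_dnbhs[d d0 H].
have [tb'|bt] := ltP t b.
  pose s := Num.min (t + d / 2) b.
  have ts : t < s by rewrite lt_min tb' andbT; lra.
  have sd : s <= t + d / 2 by rewrite ge_min lexx.
  apply: (H s); [|by rewrite gt_eqF|rewrite gtr0_norm; lra].
  by rewrite (le_trans at_ (ltW ts)) ge_min lexx orbT.
have {}bt : t = b by apply/eqP; rewrite eq_le tb bt.
pose s := Num.max (t - d / 2) a.
have st : s < t by rewrite gt_max bt ab andbT; lra.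
have sd : t - d / 2 <= s by rewrite le_max lexx.
apply: (H s); [|by rewrite lt_eqF|rewrite ltr0_norm; lra].
by rewrite (le_trans (ltW st) tb) le_max lexx orbT.
Qed.

(** Relational form: [deriveI] is a [lim] and says nothing without convergence, whereas this asserts
    existence together with the value. *)
Definition has_derI a b g t l : Prop :=
  quotientI g t s @[s --> within `[a, b] t^'] --> l.

Lemma has_derIP a b g t l : has_derI a b g t l <->
  forall eps, 0 < eps -> exists2 d, 0 < d &
    forall s, a <= s <= b -> s != t -> `|s - t| < d ->
      `|l - (g s - g t) / (s - t)| <= eps.
Proof.
rewrite /has_derI cvgrPdist_le; split => H eps eps0.
  exact/near_within_dnbhs/H.
exact/near_within_dnbhs/H.
Qed.

Lemma has_derI_deriveI a b g t l : a < b -> a <= t <= b ->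
  has_derI a b g t l -> deriveI a b g t = l.
Proof.
by move=> ab tab H; have := within_dnbhs_proper ab tab => ?; exact: cvg_lim.
Qed.

Lemma derivableI_has_derI a b g t : derivableI a b g t ->
  has_derI a b g t (deriveI a b g t).
Proof. by []. Qed.

Lemma eq_has_derI a b f g t l : (forall s, a <= s <= b -> f s = g s) ->
  a <= t <= b -> has_derI a b f t l -> has_derI a b g t l.
Proof.
move=> fg tab /has_derIP H; apply/has_derIP => eps /H[d d0 Hd]; exists d => //.
by move=> s sab; rewrite -(fg s)// -(fg t)//; exact: Hd.
Qed.

Lemma has_derIB a b f g t l l' : has_derI a b f t l -> has_derI a b g t l' ->
  has_derI a b (fun s => f s - g s) t (l - l').
Proof.
move=> H H'; rewrite /has_derI.
have -> : quotientI (fun s => f s - g s) t =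
    (fun s => quotientI f t s - quotientI g t s).
  by apply/funext => s; rewrite /quotientI; ring.
exact: cvgB.
Qed.

Lemma has_derIZ a b f t l r : has_derI a b f t l ->
  has_derI a b (fun s => r * f s) t (r * l).
Proof.
move=> H; rewrite /has_derI.
have -> : quotientI (fun s => r * f s) t = (fun s => r * quotientI f t s).
  by apply/funext => s; rewrite /quotientI; ring.
by apply: cvgM => //; exact: cvg_cst.
Qed.

Lemma has_derI_cvg a b g t l : has_derI a b g t l ->
  g s @[s --> within `[a, b] (nbhs t)] --> g t.
Proof.
move=> /has_derIP H; apply/cvgrPdist_le => eps eps0; apply/near_within_segment.
have [d d0 Hd] := H 1 ltr01.
exists (Num.min d (eps / (`|l| + 1))).
  by rewrite lt_min d0 divr_gt0// ltr_pwDr.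
move=> s sab; rewrite lt_min => /andP[sd se].
have [->|st] := eqVneq s t; first by rewrite subrr normr0 ltW.
have st0 : s - t != 0 by rewrite subr_eq0.
have h : `|(g s - g t) / (s - t)| <= `|l| + 1.
  have -> : (g s - g t) / (s - t) = l - (l - (g s - g t) / (s - t)) by ring.
  by apply: le_trans (ler_normB _ _) _; rewrite lerD2l; exact: Hd.
have -> : g t - g s = - ((g s - g t) / (s - t) * (s - t)) by rewrite divfK// opprB.
rewrite normrN normrM; apply: le_trans (ler_wpM2r (normr_ge0 _) h) _.
by rewrite mulrC -ler_pdivlMr ?ltr_pwDr// ltW.
Qed.

Lemma has_derI_is_derive a b g t l : a < t < b -> has_derI a b g t l ->
  is_derive t 1 g l.
Proof.
move=> /andP[at_ tb] /has_derIP H.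
have Hc : h^-1 *: ((g \o shift t) (h *: 1) - g t) @[h --> 0^'] --> l.
  apply/cvgrPdist_le => eps /H[d d0 Hd].
  have e0 : 0 < Num.min d (Num.min (t - a) (b - t)) by rewrite !lt_min d0 !subr_gt0 at_.
  near=> h.
  have h0 : h != 0 by near: h; exact: nbhs_dnbhs_neq.
  have : `|h| < Num.min d (Num.min (t - a) (b - t)) by near: h; exact: dnbhs0_lt.
  rewrite !lt_min => /and3P[hd /ltr_normlP[h1 h2] /ltr_normlP[h3 h4]].
  have := Hd (h + t); rewrite addrK /= /GRing.scale/= mulr1.
  rewrite [h^-1 * _]mulrC; apply => //.
    by apply/andP; split; lra.
  by rewrite -subr_eq0 addrK.
by split; [apply/cvg_ex; exists l|exact: cvg_lim].
Unshelve. all: by end_near. Qed.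

Lemma is_derive_has_derI a b g t l : is_derive t 1 g l -> has_derI a b g t l.
Proof.
move=> [dg gl]; apply/has_derIP => eps eps0.
move: dg; rewrite /derivable -[X in cvg X]/(_ @ 0^') => dg.
have : h^-1 *: ((g \o shift t) (h *: 1) - g t) @[h --> 0^'] --> l.
  by rewrite -gl.
move=> /cvgrPdist_le/(_ _ eps0); rewrite /dnbhs /within/= => /nbhs_ballP[d /= d0 Hd].
exists d => // s sab st sd; have := Hd (s - t).
rewrite /ball/= sub0r normrN subr_eq0 => /(_ sd st).
by rewrite /GRing.scale/= mulr1 subrK [(s - t)^-1 * _]mulrC.
Qed.

Lemma mvt_segment (f df : R -> R) a b : a <= b ->
  (forall x : R, a < x < b -> is_derive x 1 f (df x)) ->
  (forall x, a <= x <= b -> f s @[s --> within `[a, b] (nbhs x)] --> f x) ->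
  exists2 c, a <= c <= b & f b - f a = df c * (b - a).
Proof.
move=> ab H cf; have H' x : x \in `]a, b[ -> is_derive x (1 : R) f (df x).
  by rewrite in_itv/= => /H.
have [|c] := @MVT_segment R f df a b ab H'.
  by apply/subspace_continuousP => x; rewrite /= in_itv/= => /cf.
by rewrite in_itv/=; exists c.
Qed.

End derivative_on_segment.

(** * Convolution with the oscillator kernels *)

Section bounded_sums.
Context {R : realType}.

Lemma bounded_sum_tail (a : nat -> R) (M eps : R) : (forall n, 0 <= a n) ->
  (forall N, \sum_(n < N) a n <= M) -> 0 < eps ->
  exists N0, forall N, \sum_(N0 <= n < N) a n <= eps.
Proof.
move=> a0 aM eps0.
pose E : set R := range (fun N => \sum_(n < N) a n).
have hE : has_sup E.
  by split; [exists (\sum_(n < 0) a n), 0%N|exists M => _ [N _ <-]].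
have [_ [N0 _ <-]] := sup_adherent eps0 hE; rewrite -(big_mkord xpredT a) => supE.
exists N0 => N; have [NN0|N0N] := leqP N N0; first by rewrite big_geq// ltW.
have : \sum_(n < N) a n <= sup E by apply: ub_le_sup; [case: hE|exists N].
rewrite -(big_mkord xpredT a) (big_cat_nat (n := N0))//=; last exact: ltnW.
lra.
Qed.

Lemma ler_norm_sqrt (x y : R) : x ^+ 2 <= y -> `|x| <= Num.sqrt y.
Proof. by move=> xy; rewrite -sqrtr_sqr ler_sqrt// (le_trans _ xy) ?sqr_ge0. Qed.

End bounded_sums.

Section convolution.
Context {R : realType}.
Variables (rho T : R) (m : nat -> R) (K dK : nat -> R -> R) (h : R -> R).
Hypotheses (F : oscillator_family rho m K dK) (T0 : 0 <= T).
Hypothesis hi : sqitg 0 T h.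

Let B := bessel_bound rho T.
Let H := integ 0 T (fun s => h s ^+ 2).

Definition convK n (t : R) := integ 0 t (fun s => K n (t - s) * h s).
Definition convdK n (t : R) := integ 0 t (fun s => dK n (t - s) * h s).

Let H0 : 0 <= H. Proof. by apply: integ_ge0 => s _; exact: sqr_ge0. Qed.

Let B0 : 0 < B. Proof. exact: bessel_bound_gt0 F T0. Qed.

Let osc n := family_osc F n.
Let m0 n := family_m0 F n.
Let v0 n := @family_v0 R n.

Let cK n (b : R) : continuous (fun s => K n (b - s)).
Proof. exact: continuous_rev (osc_cont (osc n)). Qed.

Let cdK n (b : R) : continuous (fun s => dK n (b - s)).
Proof. exact: continuous_rev (osc_contd (osc n)). Qed.

Let hab (a b : R) : 0 <= a -> b <= T -> sqitg a b h.
Proof. by move=> a0 bT; exact: sqitgS a0 bT hi. Qed.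

Let hab_le (a b : R) : 0 <= a -> a <= b -> b <= T ->
  integ a b (fun s => h s ^+ 2) <= H.
Proof.
move=> a0 ab bT; have [_ hi2] := hi.
rewrite /H (@integ_split _ 0 a T) ?a0 ?(le_trans ab)//.
rewrite (@integ_split _ a b T) ?ab//; last exact: itgS a0 (lexx T) hi2.
have h1 : 0 <= integ 0 a (fun s => h s ^+ 2) by apply: integ_ge0 => s _; exact: sqr_ge0.
have h2 : 0 <= integ b T (fun s => h s ^+ 2) by apply: integ_ge0 => s _; exact: sqr_ge0.
lra.
Qed.

Let itgf (f : R -> R) (a b : R) : continuous f -> 0 <= a -> b <= T ->
  itg a b (fun s => f s * h s).
Proof. by move=> cf a0 bT; apply: sqitg_mul; [exact: sqitg_cont|exact: hab]. Qed.

(** Duhamel's formula restarted at time [a]: the state at [a] is propagated freely, and the control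
    after [a] enters through the last integral. *)
Lemma convK_step n (a b : R) : 0 <= a -> a <= b -> b <= T ->
  convK n b = (dK n (b - a) + m n * K n (b - a)) * convK n a
    + K n (b - a) * convdK n a + integ a b (fun s => K n (b - s) * h s).
Proof.
move=> a0 ab bT; have aT := le_trans ab bT.
rewrite /convK (@integ_split _ 0 a b) ?a0 ?ab//; last exact: itgf.
congr (_ + _); rewrite /convdK -!integZ; [|exact: itgf|exact: itgf].
rewrite -integD; [|by apply/itgZ/itgf|by apply/itgZ/itgf].
apply: eq_integ => s _; have -> : b - s = (b - a) + (a - s) by ring.
by rewrite (osc_add (osc n)); ring.
Qed.

Lemma convdK_step n (a b : R) : 0 <= a -> a <= b -> b <= T ->
  convdK n b = dK n (b - a) * convdK n a - n%:R ^+ 4 * K n (b - a) * convK n a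
    + integ a b (fun s => dK n (b - s) * h s).
Proof.
move=> a0 ab bT; have aT := le_trans ab bT.
rewrite /convdK (@integ_split _ 0 a b) ?a0 ?ab//; last exact: itgf.
congr (_ + _); rewrite /convK -!integZ; [|exact: itgf|exact: itgf].
rewrite -integB; [|by apply/itgZ/itgf|by apply/itgZ/itgf].
apply: eq_integ => s _; have -> : b - s = (b - a) + (a - s) by ring.
by rewrite (osc_addd (osc n)); ring.
Qed.

Lemma convK_bessel N (t : R) : 0 <= t <= T ->
  \sum_(n < N) (freq n * convK n t) ^+ 2 <= B * H.
Proof.
move=> /andP[t0 tT].
apply: le_trans (ler_wpM2l (ltW B0) (hab_le (lexx 0) t0 tT)).
apply: le_trans (bessel_K F T0 N (lexx 0) t0 tT (hab (lexx 0) tT)).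
apply: ler_sum => n _; rewrite /convK -integZ; last exact: itgf.
by under eq_integ do rewrite mulrA.
Qed.

Lemma convdK_bessel N (t : R) : 0 <= t <= T -> \sum_(n < N) convdK n t ^+ 2 <= B * H.
Proof.
move=> /andP[t0 tT].
apply: le_trans (ler_wpM2l (ltW B0) (hab_le (lexx 0) t0 tT)).
exact: (bessel_dK F T0 N (lexx 0) t0 tT (hab (lexx 0) tT)).
Qed.

Lemma convK_le n (t : R) : 0 <= t <= T -> `|convK n t| <= Num.sqrt (B * H).
Proof.
move=> tT; apply: ler_norm_sqrt; apply: le_trans (convK_bessel n.+1 tT).
rewrite big_ord_recr/= -[leLHS]add0r; apply: lerD.
  by apply: sumr_ge0 => i _; exact: sqr_ge0.
rewrite exprMn ler_peMl ?sqr_ge0// exprn_ege1//; exact: freq_ge1.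
Qed.

Lemma convdK_le n (t : R) : 0 <= t <= T -> `|convdK n t| <= Num.sqrt (B * H).
Proof.
move=> tT; apply: ler_norm_sqrt; apply: le_trans (convdK_bessel n.+1 tT).
rewrite big_ord_recr/= -[leLHS]add0r; apply: lerD => //.
by apply: sumr_ge0 => i _; exact: sqr_ge0.
Qed.

Let remainder_le (f : R -> R) (a b M : R) : 0 <= a -> a <= b -> b <= T -> 0 <= M ->
  continuous f -> (forall s, a < s < b -> `|f s| <= M) ->
  `|integ a b (fun s => f s * h s)| <= M * Num.sqrt ((b - a) * H).
Proof.
move=> a0 ab bT M0 cf fM.
have -> : M = Num.sqrt (M ^+ 2) by rewrite sqrtr_sqr ger0_norm.
rewrite -sqrtrM ?sqr_ge0//; apply: ler_norm_sqrt.
apply: le_trans (cauchy_schwarz_integ (sqitg_cont a b cf) (hab a0 bT)) _.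
rewrite mulrA; apply: ler_pM.
- by apply: integ_ge0 => s _; exact: sqr_ge0.
- by apply: integ_ge0 => s _; exact: sqr_ge0.
- exact: integ_sqr_le.
- exact: hab_le.
Qed.

(** [omega n] is a modulus of continuity for mode [n]: the linear part collects the errors of the
    small-time expansions, the square root is Cauchy-Schwarz on the control over the step. [L n]
    depends on [n]; uniformity over the modes is the business of [conv_tail]. *)
Let L n := (n%:R ^+ 4 + (m n + n%:R ^+ 4 * T)) * Num.sqrt (B * H).
Let omega n (d : R) := L n * d + Num.sqrt (d * H).

Let L0 n : 0 <= L n.
Proof.
by rewrite mulr_ge0 ?sqrtr_ge0// !addr_ge0 ?mulr_ge0 ?m0 ?v0.
Qed.

Let omega_small n (eps : R) : 0 < eps ->
  exists2 d, 0 < d & forall x, 0 <= x < d -> omega n x <= eps.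
Proof.
move=> eps0; have Ln := L0 n; have h0 := H0.
exists (Num.min (eps / 2 / (L n + 1)) ((eps / 2) ^+ 2 / (H + 1))).
  by rewrite lt_min !divr_gt0 ?exprn_gt0 ?divr_gt0//; lra.
have L1 : 0 < L n + 1 by lra.
have H1 : 0 < H + 1 by lra.
move=> x /andP[x0]; rewrite lt_min (ltr_pdivlMr _ _ L1) (ltr_pdivlMr _ _ H1).
move=> /andP[h1 h2].
have h3 : Num.sqrt (x * H) <= eps / 2.
  rewrite -(@ger0_norm _ (eps / 2)) ?divr_ge0 ?(ltW eps0)// -sqrtr_sqr.
  by rewrite ler_sqrt ?sqr_ge0//; lra.
rewrite /omega; lra.
Qed.

(** Restarting at [a] and expanding the kernels there avoids differentiating under the integral of a
    merely square integrable control. In the remainder the factor [b - a] comes from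
    [|K n x| <= x]. *)
Let convK_taylor n (a b : R) : 0 <= a -> a <= b -> b <= T ->
  `|convK n b - convK n a - (b - a) * convdK n a| <= (b - a) * omega n (b - a).
Proof.
move=> a0 ab bT; have aT : 0 <= a <= T by rewrite a0 (le_trans ab).
have d0 : 0 <= b - a by rewrite subr_ge0.
have dT : b - a <= T by lra.
rewrite (convK_step n a0 ab bT).
have h1 := normM_le (osc_dm_near1 (osc n) (m0 n) (v0 n) d0) (convK_le n aT).
have h2 := normM_le (osc_near_id (osc n) (m0 n) (v0 n) d0) (convdK_le n aT).
have h3 : `|integ a b (fun s => K n (b - s) * h s)| <=
    (b - a) * Num.sqrt ((b - a) * H).
  apply: remainder_le => // s /andP[as_ sb].
  apply: le_trans (osc_le_id (osc n) (m0 n) (v0 n) _) _; lra.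
have := normD_le (normD_le h1 h2) h3.
set S := Num.sqrt (B * H); have S0 : 0 <= S by exact: sqrtr_ge0.
set d := b - a in d0 dT *.
have h4 : n%:R ^+ 4 * d * d * d * S <= n%:R ^+ 4 * T * d * d * S.
  move: (n%:R ^+ 4) (@family_v0 R n) => v v_ge0.
  rewrite -!mulrA; apply: (ler_wpM2l v_ge0).
  by apply: ler_wpM2r => //; apply: mulr_ge0 => //; exact: mulr_ge0.
rewrite /omega /L -/S.
set J := integ _ _ _; set k := convK n a; set dk := convdK n a.
have -> : (dK n d + m n * K n d) * k + K n d * dk + J - k - d * dk =
  (dK n d + m n * K n d - 1) * k + (K n d - d) * dk + J by ring.
lra.
Qed.

Let convdK_lip n (a b : R) : 0 <= a -> a <= b -> b <= T ->
  `|convdK n b - convdK n a| <= omega n (b - a).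
Proof.
move=> a0 ab bT; have aT : 0 <= a <= T by rewrite a0 (le_trans ab).
have d0 : 0 <= b - a by rewrite subr_ge0.
have dT : b - a <= T by lra.
rewrite (convdK_step n a0 ab bT).
have h1 := normM_le (osc_d_near1 (osc n) (m0 n) (v0 n) d0) (convdK_le n aT).
have nv : `|- n%:R ^+ 4 : R| <= n%:R ^+ 4 by rewrite normrN ger0_norm.
have h2 := normM_le (normM_le nv (osc_le_id (osc n) (m0 n) (v0 n) d0)) (convK_le n aT).
have h3 : `|integ a b (fun s => dK n (b - s) * h s)| <=
    1 * Num.sqrt ((b - a) * H).
  apply: remainder_le => // s /andP[as_ sb].
  apply: (osc_d_le1 (osc n) (m0 n) (v0 n)); lra.
have := normD_le (normD_le h1 h2) h3.
set S := Num.sqrt (B * H); have S0 : 0 <= S by exact: sqrtr_ge0.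
set d := b - a in d0 dT *.
have h4 : n%:R ^+ 4 * d * d * S <= n%:R ^+ 4 * T * d * S.
  move: (n%:R ^+ 4) (@family_v0 R n) => v v_ge0.
  rewrite -!mulrA; apply: (ler_wpM2l v_ge0).
  by apply: ler_wpM2r => //; exact: mulr_ge0.
rewrite /omega /L -/S.
set J := integ _ _ _; set k := convK n a; set dk := convdK n a.
have -> : dK n d * dk - n%:R ^+ 4 * K n d * k + J - dk =
  (dK n d - 1) * dk + - n%:R ^+ 4 * K n d * k + J by ring.
lra.
Qed.

Let dist_lt (x y d : R) : x <= y -> `|x - y| < d -> 0 <= y - x < d.
Proof. by move=> xy; rewrite distrC ger0_norm ?subr_ge0// => ->; rewrite xy. Qed.

Lemma convdK_cvg n (t : R) : 0 <= t <= T ->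
  convdK n s @[s --> within `[0, T] (nbhs t)] --> convdK n t.
Proof.
move=> /andP[t0 tT]; apply/cvgrPdist_le => eps /(omega_small n)[d d0 Hd].
apply/near_within_segment; exists d => // s /andP[s0 sT] std.
have [st|/ltW ts] := leP s t.
  by apply: le_trans (convdK_lip n s0 st tT) _; apply: Hd; exact: dist_lt.
rewrite distrC; apply: le_trans (convdK_lip n t0 ts sT) _; apply: Hd.
by apply: dist_lt => //; rewrite distrC.
Qed.

Lemma convK_has_derI n (t : R) : 0 <= t <= T -> has_derI 0 T (convK n) t (convdK n t).
Proof.
move=> /andP[t0 tT]; apply/has_derIP => eps eps0.
have [d d0 Hd] := @omega_small n (eps / 2) ltac:(lra).
exists d => // s /andP[s0 sT] snt std.
have quot (x y : R) : x != y -> (convK n x - convK n y) / (x - y) =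
    (convK n y - convK n x) / (y - x).
  move=> xy; rewrite -(opprB (convK n y)) -(opprB y x) invrN mulrNN//.
have est (a b c : R) : a < b -> `|convK n b - convK n a - (b - a) * c| <=
    (b - a) * eps -> `|c - (convK n b - convK n a) / (b - a)| <= eps.
  move=> ab; have ba : 0 < b - a by rewrite subr_gt0.
  have -> : c - (convK n b - convK n a) / (b - a) =
    - ((convK n b - convK n a - (b - a) * c) / (b - a)).
    by field; rewrite gt_eqF.
  rewrite normrN normrM normfV (gtr0_norm ba) ler_pdivrMr// [leRHS]mulrC; exact.
(* For [s < t] the expansion is centered at [s], and the derivative there has to be moved to [t] by
   [convdK_lip]; this is why [eps / 2] was requested. *)
have [st|ts] := ltP s t.
  have std' : omega n (t - s) <= eps / 2.
    by apply: Hd; apply: dist_lt => //; exact: ltW.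
  have h1 := convK_taylor n s0 (ltW st) tT.
  have h2 := convdK_lip n s0 (ltW st) tT.
  have ts0 : 0 < t - s by rewrite subr_gt0.
  have h3 : `|(t - s) * (convdK n s - convdK n t)| <= (t - s) * omega n (t - s).
    by rewrite normrM (gtr0_norm ts0) distrC ler_wpM2l ?(ltW ts0).
  rewrite quot//; apply: est => //.
  have := normD_le h1 h3.
  have -> : convK n t - convK n s - (t - s) * convdK n s +
    (t - s) * (convdK n s - convdK n t) =
    convK n t - convK n s - (t - s) * convdK n t by ring.
  move/le_trans; apply; rewrite -mulrDr ler_wpM2l ?(ltW ts0)//; lra.
have {}ts : t < s by rewrite lt_neqAle eq_sym snt.
have std' : omega n (s - t) <= eps / 2.
  by apply: Hd; apply: dist_lt; [exact: ltW|rewrite distrC].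
apply: est => //; apply: le_trans (convK_taylor n t0 (ltW ts) sT) _.
rewrite ler_wpM2l ?subr_ge0 ?(ltW ts)//; lra.
Qed.

Let C := (1 + rho) * (1 + T).

(** The weight [freq n] absorbs damping and stiffness, since [m n <= rho * freq n] and [n^4 K convK]
    splits into [n^2 K] times [n^2 convK]. Hence [C] is independent of [n]. *)
Let tail_step n (a b : R) : 0 <= a -> a <= b -> b <= T ->
  `|freq n * convK n b| <= C * (`|freq n * convK n a| + `|convdK n a|)
     + `|integ a b (fun s => freq n * K n (b - s) * h s)| /\
  `|convdK n b| <= C * (`|freq n * convK n a| + `|convdK n a|)
     + `|integ a b (fun s => dK n (b - s) * h s)|.
Proof.
move=> a0 ab bT; have d0 : 0 <= b - a by rewrite subr_ge0.
have [rho0 _ mr _] := F.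
have fK : `|freq n * K n (b - a)| <= 1 + T.
  by apply: le_trans (family_scaled_le F n d0) _; lra.
have nf := @sqr_le_freq R n.
have f0 : 0 < freq n :> R := freq_gt0 n.
have n2 : 0 <= n%:R ^+ 2 :> R by exact: sqr_ge0.
have mK : `|m n * K n (b - a)| <= rho * (1 + T).
  have /andP[m_ge0 mn] := mr n; rewrite normrM ger0_norm//.
  apply: le_trans (ler_wpM2r (normr_ge0 _) mn) _; rewrite -mulrA ler_wpM2l//.
  apply: le_trans (ler_wpM2r (normr_ge0 _) nf) _.
  by rewrite -{1}(gtr0_norm f0) -normrM.
have nK : `|n%:R ^+ 2 * K n (b - a)| <= 1 + T.
  rewrite normrM ger0_norm//; apply: le_trans (ler_wpM2r (normr_ge0 _) nf) _.
  by rewrite -{1}(gtr0_norm f0) -normrM.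
have dK1 := family_d_le1 F n d0.
set x := freq n * convK n a; set y := convdK n a.
have t0 := T0.
have x0 := normr_ge0 x; have y0 := normr_ge0 y.
have rT := mulr_ge0 rho0 T0.
have rTx := mulr_ge0 rT x0; have rTy := mulr_ge0 rT y0.
have rx := mulr_ge0 rho0 x0; have ry := mulr_ge0 rho0 y0.
have Tx := mulr_ge0 T0 x0; have Ty := mulr_ge0 T0 y0.
have aT := le_trans ab bT.
split.
  have -> : integ a b (fun s => freq n * K n (b - s) * h s) =
      freq n * integ a b (fun s => K n (b - s) * h s).
    by rewrite -integZ; [under eq_integ do rewrite -mulrA|exact: itgf].
  rewrite (convK_step n a0 ab bT) mulrDr.
  have -> : freq n * ((dK n (b - a) + m n * K n (b - a)) * convK n a +
      K n (b - a) * convdK n a) =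
    (dK n (b - a) + m n * K n (b - a)) * x + freq n * K n (b - a) * y.
    by rewrite /x /y; ring.
  apply: le_trans (ler_normD _ _) _; rewrite lerD2r.
  have := normD_le (normM_le (normD_le dK1 mK) (lexx `|x|))
    (normM_le fK (lexx `|y|)).
  rewrite /C; lra.
rewrite (convdK_step n a0 ab bT).
apply: le_trans (ler_normD _ _) _; rewrite lerD2r.
have nx : `|n%:R ^+ 2 * convK n a| <= `|x|.
  rewrite /x (normrM (n%:R ^+ 2)) (normrM (freq n)).
  by rewrite (ger0_norm n2) (gtr0_norm f0) ler_wpM2r.
have := normD_le (normM_le dK1 (lexx `|y|)) (normM_le nK nx).
rewrite -[`|_ + _|]normrN.
have -> : dK n (b - a) * convdK n a - n%:R ^+ 4 * K n (b - a) * convK n a =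
   dK n (b - a) * y - n%:R ^+ 2 * K n (b - a) * (n%:R ^+ 2 * convK n a).
  by rewrite /y; ring.
move=> _; apply: le_trans (ler_normB _ _) _.
have := lerD (normM_le dK1 (lexx `|y|)) (normM_le nK nx).
rewrite /C; lra.
Qed.

Lemma conv_tail (t eps : R) : 0 <= t <= T -> 0 < eps ->
  exists (eta : R) N0, 0 < eta /\ forall s N, 0 <= s <= T -> `|s - t| < eta ->
    \sum_(N0 <= n < N) (freq n * convK n s) ^+ 2 <= eps /\
    \sum_(N0 <= n < N) convdK n s ^+ 2 <= eps.
Proof.
move=> /andP[t0 tT] eps0; have [_ hi2] := hi; have [rho0 _ _ _] := F.
have b0 := B0.
have C0 : 0 <= C by rewrite mulr_ge0 ?addr_ge0.
(* The 6 here and in [e2] is 3, from the square of a sum of three terms, times 2 for the two halves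
   of [eps]. *)
pose e1 := eps / (6 * B); have e10 : 0 < e1 by rewrite divr_gt0//; lra.
have [eta eta0 Heta] := integ_small t hi2 e10.
(* The restart time precedes every [s] considered, on either side of [t], and still lies in the
   window of [Heta]. *)
pose a := Num.max 0 (t - eta / 2).
have a0 : 0 <= a by rewrite le_max lexx.
have aeta : t - eta < a by rewrite lt_max; apply/orP; right; lra.
have at_ : a <= t by rewrite ge_max t0; lra.
have aT : 0 <= a <= T by rewrite a0 (le_trans at_).
pose w n := (freq n * convK n a) ^+ 2 + convdK n a ^+ 2.
pose e2 := eps / (6 * (C ^+ 2 + 1)).
have C2 : 0 <= C ^+ 2 by exact: sqr_ge0.
have e20 : 0 < e2 by rewrite divr_gt0//; lra.
have [N0 HN0] : exists N0, forall N, \sum_(N0 <= n < N) w n <= e2.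
  apply: (@bounded_sum_tail _ w (B * H + B * H)) => //.
    by move=> n; rewrite addr_ge0 ?sqr_ge0.
  by move=> N; rewrite big_split/= lerD ?convK_bessel ?convdK_bessel.
exists (eta / 2), N0; split; first by rewrite divr_gt0.
move=> s N /andP[s0 sT] /ltr_normlP[st1 st2].
have as_ : a <= s by rewrite ge_max s0; lra.
have small : integ a s (fun s => h s ^+ 2) < e1 by apply: Heta => //; lra.
have BJ : B * integ a s (fun s => h s ^+ 2) <= eps / 6.
  have -> : eps / 6 = B * e1 by rewrite /e1; field; rewrite gt_eqF//.
  by rewrite ler_wpM2l ?(ltW b0)// ltW.
have Ce : 3 * C ^+ 2 * e2 <= eps / 2.
  have -> : eps / 2 = 3 * (C ^+ 2 + 1) * e2 by rewrite /e2; field; lra.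
  by rewrite ler_wpM2r ?(ltW e20)//; lra.
have main (X J : nat -> R) : (forall n, `|X n| <=
     C * (`|freq n * convK n a| + `|convdK n a|) + `|J n|) ->
   \sum_(n < N) J n ^+ 2 <= B * integ a s (fun s => h s ^+ 2) ->
   \sum_(N0 <= n < N) X n ^+ 2 <= eps.
  move=> XJ Jle; apply: (@le_trans _ _ (\sum_(N0 <= n < N)
      (3 * C ^+ 2 * w n + 3 * J n ^+ 2))).
    apply: ler_sum => n _; rewrite /w.
    rewrite -[X n ^+ 2]real_normK ?num_real// -[J n ^+ 2]real_normK ?num_real//.
    rewrite -[(freq n * _) ^+ 2]real_normK ?num_real//.
    rewrite -[convdK n a ^+ 2]real_normK ?num_real//.
    have := XJ n; have := normr_ge0 (X n); set x := `|X n|.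
    have := normr_ge0 (J n); set j := `|J n|.
    have := normr_ge0 (convdK n a); set y := `|convdK n a|.
    have := normr_ge0 (freq n * convK n a); set z := `|freq n * convK n a|.
    move=> z0 y0 j0 x0 xle.
    rewrite mulrDr in xle.
    have h1 : x ^+ 2 <= (C * z + C * y + j) ^+ 2.
      by rewrite ler_pXn2r// nnegrE; exact: le_trans xle.
    have := sqr_ge0 (C * z - C * y); have := sqr_ge0 (C * z - j).
    have := sqr_ge0 (C * y - j); lra.
  rewrite big_split/= -!mulr_sumr.
  have h1 : 3 * C ^+ 2 * \sum_(N0 <= n < N) w n <= eps / 2.
    by apply: le_trans Ce; apply: ler_wpM2l; [exact: mulr_ge0|exact: HN0].
  have h2 : \sum_(N0 <= n < N) J n ^+ 2 <= \sum_(n < N) J n ^+ 2.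
    have [NN0|N0N] := leqP N N0.
      by rewrite big_geq//; apply: sumr_ge0 => n _; exact: sqr_ge0.
    rewrite -(big_mkord xpredT (fun n => J n ^+ 2)) [leRHS](big_cat_nat (n := N0))//=.
      by rewrite lerDr; apply: sumr_ge0 => n _; exact: sqr_ge0.
    exact: ltnW.
  lra.
split.
  apply: (main _ (fun n => integ a s (fun r => freq n * K n (s - r) * h r))).
    by move=> n; have [] := tail_step n a0 as_ sT.
  exact: (bessel_K F T0 N a0 as_ sT (hab a0 sT)).
apply: (main _ (fun n => integ a s (fun r => dK n (s - r) * h r))).
  by move=> n; have [] := tail_step n a0 as_ sT.
exact: (bessel_dK F T0 N a0 as_ sT (hab a0 sT)).
Qed.

End convolution.

(** * Completeness of L^2 *)

Section L2.
Context {R : realType}.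
Implicit Types (a b T : R) (f g h z : R -> R).

Lemma integ_EFin a b f : itg a b f ->
  (\int[lebesgue_measure]_(x in `]a, b[) (f x)%:E)%E = (integ a b f)%:E.
Proof.
move=> fi; rewrite /integ /Rintegral fineK//.
exact: (integrable_fin_num (measurable_itvR _) fi).
Qed.

Lemma normL2_EFin T f : sqitg 0 T f ->
  normL2 T f = (Num.sqrt (integ 0 T (fun s => f s ^+ 2)))%:E.
Proof.
move=> [mf fi]; rewrite /normL2 unlock.
have -> : (\int[lebesgue_measure]_x `|(EFin \o f \_ `]0%R, T[) x| `^ 2 =
    (integ 0 T (fun s => f s ^+ 2))%:E)%E.
  rewrite -integ_EFin// [RHS]integral_mkcond; apply: eq_integral => x _.
  rewrite /= !patchE; case: ifPn => // _; last first.
    by rewrite normr0 powR0// ?pnatr_eq0.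
  by rewrite powR_mulrn// -normrX ger0_norm// sqr_ge0.
rewrite poweR_EFin powR12_sqrt//; apply: integ_ge0 => s _; exact: sqr_ge0.
Qed.

Lemma inL2P T f : inL2 T f <-> sqitg 0 T f.
Proof.
split=> fL.
  have fi := Lfun2_integrable_sqr fL.
  have mf : measurable_fun `]0, T[ f.
    apply/(measurable_restrictT _ (measurable_itvR _)).
    by move: fL; rewrite /inL2 inE => /andP[]; rewrite inE.
  split => //; rewrite /itg; apply/(integrable_mkcond _ (measurable_itvR _)).
  apply: eq_integrable fi => // x _ /=; rewrite !patchE.
  by case: ifPn => // _; rewrite expr0n.
have [mf fi] := fL.
rewrite /inL2 inE; apply/andP; split; rewrite inE/=.
  exact/(measurable_restrictT _ (measurable_itvR _)).
rewrite /finite_norm; change (normL2 T f < +oo)%E.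
by rewrite normL2_EFin// ltry.
Qed.

Lemma limn_einf_le (u : nat -> \bar R) (M : \bar R) N0 :
  (forall k, (N0 <= k)%N -> (u k <= M)%E) -> (limn_einf u <= M)%E.
Proof.
move=> uM; rewrite limn_einf_lim; apply: lime_le; first exact: is_cvg_einfs.
apply: nearW => n; apply: (@le_trans _ _ (u (maxn n N0))).
  by apply: ereal_inf_lbound; exists (maxn n N0) => //=; rewrite leq_maxl.
by apply: uM; rewrite leq_maxr.
Qed.

(* Riesz--Fischer: a subsequence with summable increments converges almost
   everywhere, and Fatou's lemma turns its limit into an L^2 limit. *)
Lemma L2_complete T (S : nat -> R -> R) : 0 <= T ->
  (forall N, sqitg 0 T (S N)) ->
  (forall eps : R, 0 < eps -> exists N0, forall N M, (N0 <= N)%N -> (N0 <= M)%N ->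
     integ 0 T (fun s => (S N s - S M s) ^+ 2) <= eps) ->
  exists2 z, sqitg 0 T z & forall eps : R, 0 < eps ->
    exists N0, forall N, (N0 <= N)%N ->
      integ 0 T (fun s => (S N s - z s) ^+ 2) <= eps.
Proof.
move=> T0 Si SC; pose D : set (measurableTypeR R) := `]0, T[%classic.
have mD : measurable D by exact: measurable_itvR.
have [N_ HN_] : {N_ : nat -> nat & forall k N M, (N_ k <= N)%N -> (N_ k <= M)%N ->
    integ 0 T (fun s => (S N s - S M s) ^+ 2) <= (2^-1 ^+ k) ^+ 2}.
  apply: (@choice _ _ (fun k n => forall N M, (n <= N)%N -> (n <= M)%N ->
    integ 0 T (fun s => (S N s - S M s) ^+ 2) <= (2^-1 ^+ k) ^+ 2)) => k.
  by apply: SC; rewrite !exprn_gt0.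
(* [ph k] dominates all [N_ i] with [i <= k], and also [k], so it tends to infinity. *)
pose ph k := (k + \sum_(i < k.+1) N_ i)%N.
have ph_ge k j : (k <= j)%N -> (N_ k <= ph j)%N.
  move=> kj; rewrite /ph (bigD1 (Ordinal (kj : (k < j.+1)%N)))//=.
  by rewrite addnCA leq_addr.
have ph_id k : (k <= ph k)%N by rewrite leq_addr.
pose d k s := `|S (ph k.+1) s - S (ph k) s|.
have di k : itg 0 T (d k) by apply/itg_norm/sqitg_itg/sqitgB.
(* By [|x| <= x^2 / e + e] with [e = 2^-k]: the square integral is at most [e^2], so the increments
   are summable in L^1. *)
have dle k : integ 0 T (d k) <= (1 + T) * 2^-1 ^+ k.
  have e0 : 0 < 2^-1 ^+ k :> R by rewrite exprn_gt0.
  set e := 2^-1 ^+ k in e0 *.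
  have [_ i2] := sqitgB (Si (ph k.+1)) (Si (ph k)).
  apply: (@le_trans _ _ (integ 0 T (fun s =>
     e^-1 * (S (ph k.+1) s - S (ph k) s) ^+ 2 + e))).
    apply: le_integ => //.
      by apply: itgD; [exact: itgZ|apply: itg_cont; exact: cst_continuous].
    move=> s _; rewrite /d; set x := _ - _; rewrite -[x ^+ 2]real_normK ?num_real//.
    rewrite -(ler_pM2l e0) mulrDr mulVKf ?gt_eqF//.
    have := sqr_ge0 (`|x| - e); have := sqr_ge0 `|x|; have := sqr_ge0 e; nra.
  rewrite integD; [|exact: itgZ|by apply: itg_cont; exact: cst_continuous].
  rewrite integZ// integ_cst// subr0 mulrDl mul1r [e * T]mulrC lerD2r.
  rewrite -(ler_pM2l e0) mulVKf ?gt_eqF// -expr2; apply: HN_; exact: ph_ge.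
pose G x := (\sum_(k <oo) (d k x)%:E)%E.
have d0 k x : (0 <= (d k x)%:E)%E by rewrite lee_fin normr_ge0.
have md k : measurable_fun D (fun x => (d k x)%:E).
  by apply/measurable_EFinP; exact: itg_meas (di k).
have mG : measurable_fun D G by exact: ge0_emeasurable_sum.
have G0 x : (0 <= G x)%E by exact: nneseries_ge0.
have Gi : lebesgue_measure.-integrable D G.
  apply/integrableP; split => //.
  under eq_integral do rewrite gee0_abs//.
  rewrite integral_nneseries//.
  apply: (@le_lt_trans _ _ ((1 + T) * 2)%:E); last exact: ltry.
  apply: lime_le.
    by apply: is_cvg_nneseries => k _ _; exact: integral_ge0.
  apply: nearW => n; rewrite big_mkord.
  under eq_bigr do rewrite integ_EFin//.
  rewrite sumEFin lee_fin.
  apply: (@le_trans _ _ (\sum_(k < n) (1 + T) * 2^-1 ^+ k)); first exact: ler_sum.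
  rewrite -(big_mkord xpredT (fun k => (1 + T) * 2^-1 ^+ k)).
  have half : 1 - 2^-1 = 2^-1 :> R by lra.
  have := @geometric_le_lim R n (1 + T) 2^-1; rewrite half invrK; apply.
  - by rewrite addr_ge0.
  - by rewrite invr_gt0.
  - by rewrite gtr0_norm ?invr_gt0// invf_lt1// ltr1n.
have Gae := integrable_ae mD Gi.
(* A limit superior is measurable wherever the sequence behaves badly too; it is the true limit
   where [G] is finite, hence almost everywhere. *)
pose z x := fine (limn_esup (fun k => (S (ph k) x)%:E)).
have mS N : measurable_fun D (S N) by case: (Si N).
have mz : measurable_fun D z.
  apply: measurableT_comp => //; apply: measurable_fun_limn_esup => k.
  exact/measurable_EFinP.
have Sz x : G x \is a fin_num -> S (ph k) x @[k --> \oo] --> z x.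
  move=> Gx; have cS : cvgn (fun k => S (ph k) x).
    have : cvgn (series (telescope (fun k => S (ph k) x))).
      apply: normed_cvg; apply: nondecreasing_is_cvgn.
        by apply: nondecreasing_series => k _ _; exact: normr_ge0.
      exists (fine (G x)) => _ [n _ <-]; rewrite -lee_fin fineK// /series/= -sumEFin.
      exact: nneseries_lim_ge.
    rewrite telescopeK => /cvg_ex[l Hl]; apply/cvg_ex; exists (l + S (ph 0%N) x).
    have -> : (fun k => S (ph k) x) =
        (fun k => (S (ph k) x - S (ph 0%N) x) + S (ph 0%N) x).
      by apply/funext => k; rewrite subrK.
    by apply: cvgD => //; exact: cvg_cst.
  have /cvg_ex[l Hl] := cS.
  rewrite /z; have -> : limn_esup (fun k => (S (ph k) x)%:E) = l%:E; last exact: Hl.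
  have HlE : (S (ph k) x)%:E @[k --> \oo] --> l%:E.
    by apply: cvg_EFin => //; exact: nearW.
  by rewrite (cvg_limn_einf_sup HlE).2.
have fatouz eps N0 N : (forall M, (N0 <= M)%N ->
    integ 0 T (fun s => (S N s - S M s) ^+ 2) <= eps) ->
    (\int[lebesgue_measure]_(x in D) ((S N x - z x) ^+ 2)%:E <= eps%:E)%E.
  move=> HM; pose f k x := ((S N x - S (ph k) x) ^+ 2)%:E.
  have mf k : measurable_fun D (f k).
    by apply/measurable_EFinP; apply: measurable_funX; exact: measurable_funB.
  have f0 k x : (0 <= f k x)%E by rewrite lee_fin sqr_ge0.
  rewrite (@ge0_ae_eq_integral _ _ _ _ D _ (fun x => limn_einf (f ^~ x)))//.
  - apply: le_trans (fatou _ mD mf _) _; first by [].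
    apply: (@limn_einf_le _ _ N0) => k N0k; rewrite integ_EFin.
      by rewrite lee_fin HM// (leq_trans N0k).
    by have [] := sqitgB (Si N) (Si (ph k)).
  - by apply/measurable_EFinP; apply: measurable_funX; exact: measurable_funB.
  - rewrite /limn_einf; apply: measurableT_comp => //.
    by apply: measurable_fun_limn_esup => k; exact: measurableT_comp.
  - by move=> x _; rewrite lee_fin sqr_ge0.
  - move=> x _; rewrite limn_einf_lim; apply: lime_ge; first exact: is_cvg_einfs.
    by apply: nearW => n; apply: le_ereal_inf_tmp => _ [k _ <-].
  - apply: filterS Gae => x /= Gx Dx; have Hz := Sz x (Gx Dx).
    have HE : f k x @[k --> \oo] --> ((S N x - z x) ^+ 2)%:E.
      apply: cvg_EFin; first exact: nearW.
      rewrite /comp /f/=; under eq_fun do rewrite expr2.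
      by rewrite expr2; apply: cvgM; apply: cvgB => //; exact: cvg_cst.
    by rewrite (cvg_limn_einf_sup HE).1.
have zi N : sqitg 0 T (fun s => S N s - z s) -> sqitg 0 T z.
  move=> H; have := sqitgB (Si N) H.
  by under eq_fun do rewrite opprB addrC subrK.
have Szi eps N0 N : (forall M, (N0 <= M)%N ->
    integ 0 T (fun s => (S N s - S M s) ^+ 2) <= eps) ->
    sqitg 0 T (fun s => S N s - z s).
  move=> HM; have mSz : measurable_fun D (fun s => S N s - z s) by exact: measurable_funB.
  split => //; apply/integrableP; split.
    by apply/measurable_EFinP; exact: measurable_funX.
  under eq_integral do rewrite /= ger0_norm ?sqr_ge0//.
  exact: le_lt_trans (fatouz eps N0 N HM) (ltry _).
exists z.
  have [N0 HN0] := SC 1 ltr01.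
  by apply: (zi N0); apply: (Szi 1 N0) => M; exact: HN0.
move=> eps eps0; have [N0 HN0] := SC eps eps0; exists N0 => N N0N.
have HM M : (N0 <= M)%N -> integ 0 T (fun s => (S N s - S M s) ^+ 2) <= eps.
  exact: HN0.
have [_ i2] := Szi _ _ _ HM.
by rewrite -lee_fin -integ_EFin//; exact: fatouz HM.
Qed.

End L2.

(** * The adjoint modes *)

Section adjoint.
Context {R : realType}.

Lemma is_derive_shift_sub (f df : R -> R) (t x : R) :
  (forall y : R, is_derive y 1 f (df y)) ->
  is_derive x 1 (fun y => f (y - t)) (df (x - t)).
Proof.
move=> H; have Hb : is_derive x 1 (fun y : R => y - t) 1.
  by have := is_deriveB (is_derive_id x 1) (is_derive_cst t x 1); rewrite subr0.
have := @is_derive1_comp R f (fun y => y - t) x _ _ (H (x - t)) Hb.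
by rewrite mulr1.
Qed.

(* The bracket [w' K(. - t) - w K'(. - t) - m w K(. - t)] is constant. *)
Lemma adjoint_repr (tau m v : R) (K dK w : R -> R) : 0 < tau ->
  oscillator m v K dK ->
  (forall t : R, 0 <= t <= tau ->
    [/\ derivableI 0 tau w t, derivableI 0 tau (deriveI 0 tau w) t &
      deriveI 0 tau (deriveI 0 tau w) t - m * deriveI 0 tau w t + v * w t = 0]) ->
  forall t, 0 <= t <= tau ->
    w t = w tau * (dK (tau - t) + m * K (tau - t))
          - deriveI 0 tau w tau * K (tau - t).
Proof.
move=> tau0 osc Hw t /andP[t0 tt]; set w' := deriveI 0 tau w.
have dw x : 0 <= x <= tau -> has_derI 0 tau w x (w' x).
  by move=> /Hw[/derivableI_has_derI].
have dw' x : 0 <= x <= tau -> has_derI 0 tau w' x (m * w' x - v * w x).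
  move=> /Hw[_ /derivableI_has_derI + e].
  suff -> : deriveI 0 tau (deriveI 0 tau w) x = m * w' x - v * w x by [].
  by move: e; rewrite -/w'; lra.
have dK1 (x : R) : is_derive x 1 (fun s => K (s - t)) (dK (x - t)).
  by apply: is_derive_shift_sub; exact: osc_derive osc.
have dK2 (x : R) : is_derive x 1 (fun s => dK (s - t))
    (- m * dK (x - t) - v * K (x - t)).
  exact: is_derive_shift_sub (osc_derive2 osc).
pose f s := w' s * K (s - t) - (w s * dK (s - t) + m * (w s * K (s - t))).
have df (x : R) : t < x < tau -> is_derive x 1 f 0.
  move=> /andP[tx xt].
  have x01 : 0 < x < tau by rewrite (le_lt_trans t0 tx).
  have x01' : 0 <= x <= tau by case/andP: x01 => /ltW-> /ltW->.
  have d1 := has_derI_is_derive x01 (dw _ x01').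
  have d2 := has_derI_is_derive x01 (dw' _ x01').
  apply: (is_derive_eq (is_deriveBR (is_deriveMR d2 (dK1 x))
    (is_deriveDR (is_deriveMR d1 (dK2 x)) (is_deriveZR m (is_deriveMR d1 (dK1 x)))))).
  by ring.
have cf x : t <= x <= tau -> f s @[s --> within `[t, tau] (nbhs x)] --> f x.
  move=> /andP[tx xt]; have x01 : 0 <= x <= tau by rewrite (le_trans t0).
  have sub : within `[t, tau] (nbhs x) `=>` within `[0, tau] (nbhs x).
    by apply: within_subset => s /=; rewrite !in_itv/= => /andP[/(le_trans t0)-> ->].
  have c1 : w s @[s --> within `[t, tau] (nbhs x)] --> w x.
    exact: cvg_trans (cvg_app _ sub) (has_derI_cvg (dw _ x01)).
  have c2 : w' s @[s --> within `[t, tau] (nbhs x)] --> w' x.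
    exact: cvg_trans (cvg_app _ sub) (has_derI_cvg (dw' _ x01)).
  have c3 : K (s - t) @[s --> within `[t, tau] (nbhs x)] --> K (x - t).
    by apply: cvg_within_filter; exact: (is_derive_continuous dK1).
  have c4 : dK (s - t) @[s --> within `[t, tau] (nbhs x)] --> dK (x - t).
    by apply: cvg_within_filter; exact: (is_derive_continuous dK2).
  apply: cvgB; first exact: cvgM.
  by apply: cvgD; [exact: cvgM|apply: cvgM; [exact: cvg_cst|exact: cvgM]].
have [c _] := @mvt_segment R f (fun=> 0) t tau tt df cf.
rewrite mul0r => /eqP; rewrite subr_eq0 => /eqP.
rewrite /f subrr (osc0 osc) (osc_d0 osc) !mulr0 mulr1 addr0 sub0r => e.
by rewrite -[LHS]opprK -e; ring.
Qed.

(** Time reversal turns the antidamped adjoint equation into the damped oscillator in [tau - t];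
    [K' + m K] and [- K] carry the two final data. Uniqueness needs such a solution to test with. *)
Lemma adjoint_exists (rho alpha tau : R) (K dK : nat -> R -> R) (w0 w1 : nat -> R) :
  0 < tau ->
  (forall n, oscillator (rho * n%:R `^ (2 * alpha)) (n%:R ^+ 4) (K n) (dK n)) ->
  adjoint_solution rho alpha tau w0 w1 (fun n t =>
    w0 n * (dK n (tau - t) + rho * n%:R `^ (2 * alpha) * K n (tau - t))
    - w1 n * K n (tau - t)).
Proof.
move=> tau0 oscs n; have osc := oscs n; set m := rho * _.
set v : R := n%:R ^+ 4.
set w := fun t => _; pose w' t := w0 n * (v * K n (tau - t)) + w1 n * dK n (tau - t).
pose w'' t := - (w0 n * (v * dK n (tau - t)))
  + w1 n * (m * dK n (tau - t) + v * K n (tau - t)).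
have dK1 (x : R) := @is_derive_compr _ _ _ tau x (osc_derive osc).
have dK2 (x : R) := @is_derive_compr _ _ _ tau x (osc_derive2 osc).
have dw (x : R) : is_derive x 1 w (w' x).
  apply: (is_derive_eq (is_deriveBR
    (is_deriveZR _ (is_deriveDR (dK2 x) (is_deriveZR _ (dK1 x))))
    (is_deriveZR _ (dK1 x)))).
  by rewrite /w' /v -/m; ring.
have dw' (x : R) : is_derive x 1 w' (w'' x).
  apply: (is_derive_eq (is_deriveDR (is_deriveZR _ (is_deriveZR _ (dK1 x)))
    (is_deriveZR _ (dK2 x)))).
  by rewrite /w'' /v -/m; ring.
have Dw x : 0 <= x <= tau -> deriveI 0 tau w x = w' x.
  by move=> xt; apply: has_derI_deriveI => //; exact: is_derive_has_derI.
have Hdw x : 0 <= x <= tau -> has_derI 0 tau (deriveI 0 tau w) x (w'' x).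
  move=> xt; apply: (@eq_has_derI _ 0 tau w') => //; last exact: is_derive_has_derI.
  by move=> s /Dw.
have tt : 0 <= tau <= tau by rewrite ltW/=.
split=> [t||].
- rewrite in_itv/= => t01; split.
  + by apply/cvg_ex; exists (w' t); exact: is_derive_has_derI.
  + by apply/cvg_ex; exists (w'' t); exact: Hdw.
  + rewrite (has_derI_deriveI tau0 t01 (Hdw t t01)) Dw//.
    by rewrite /w'' /w' /w -/m -/v; ring.
- by rewrite /w subrr (osc0 osc) (osc_d0 osc); ring.
- by rewrite Dw// /w' subrr (osc0 osc) (osc_d0 osc); ring.
Qed.

End adjoint.

(** * The spaces X_N^p *)

Section weighted_norms.
Context {R : realType}.

(** The square of [normX p a] is the sum of [wt p n * a n ^+ 2]; mode 0 has weight 1 for every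
    [p]. *)
Definition wt (p : R) (n : nat) : R := if n == 0%N then 1 else n%:R `^ (2 * p).

Lemma wt_gt0 p n : 0 < wt p n.
Proof. by rewrite /wt; case: n => //= n; rewrite powR_gt0. Qed.

Let wt_term_ge0 p n (a : nat -> R) : (0 <= (n%:R `^ (2 * p) * a n ^+ 2)%:E)%E.
Proof. by rewrite lee_fin mulr_ge0 ?powR_ge0 ?sqr_ge0. Qed.

Let wt_sum p (a : nat -> R) N : ((a 0%N ^+ 2)%:E +
  \sum_(1 <= n < N.+1) (n%:R `^ (2 * p) * a n ^+ 2)%:E)%E =
  (\sum_(n < N.+1) wt p n * a n ^+ 2)%:E.
Proof.
rewrite -(big_mkord xpredT (fun n => wt p n * a n ^+ 2)) big_nat_recl//=.
rewrite EFinD mul1r sumEFin big_add1/=; congr (_ + (_)%:E)%E.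
Qed.

Lemma normX_ge0 p (a : nat -> R) : (0 <= normX p a)%E.
Proof. exact: poweR_ge0. Qed.

Lemma normX_le p (a : nat -> R) r : 0 <= r ->
  (forall N, \sum_(n < N) wt p n * a n ^+ 2 <= r ^+ 2) -> (normX p a <= r%:E)%E.
Proof.
move=> r0 H; have -> : r%:E = ((r ^+ 2)%:E `^ 2^-1)%E.
  by rewrite poweR_EFin powR12_sqrt ?sqr_ge0// sqrtr_sqr ger0_norm.
have S0 : (0 <= \sum_(1 <= n <oo) (n%:R `^ (2 * p) * a n ^+ 2)%:E)%E.
  exact: nneseries_ge0.
apply: gt0_ler_poweR.
- by rewrite invr_ge0.
- by rewrite in_itv/= leey andbT adde_ge0// lee_fin sqr_ge0.
- by rewrite in_itv/= leey andbT lee_fin sqr_ge0.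
rewrite -leeBrDl//; apply: lime_le; first exact: is_cvg_nneseries.
apply: nearW => -[|N].
  rewrite big_geq// leeBrDl// adde0 lee_fin.
  by have := H 1%N; rewrite big_ord1 mul1r.
by rewrite leeBrDl// wt_sum lee_fin.
Qed.

Lemma inX_bounded p (a : nat -> R) : inX p a ->
  exists M, forall N, \sum_(n < N) wt p n * a n ^+ 2 <= M.
Proof.
move=> /lty_poweRy; rewrite invr_eq0 pnatr_eq0 => /(_ isT) aoo.
set S := (_ + _)%E in aoo.
have S0 : (0 <= S)%E by rewrite adde_ge0 ?lee_fin ?sqr_ge0//; exact: nneseries_ge0.
have Sfin : S \is a fin_num by rewrite ge0_fin_numE.
exists (fine S) => -[|N].
  by rewrite big_ord0 fine_ge0.
rewrite -lee_fin fineK// -wt_sum leeD2l//.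
by apply: nneseries_lim_ge => n _ _; exact: wt_term_ge0.
Qed.

Lemma bounded_inX p (a : nat -> R) M :
  (forall N, \sum_(n < N) wt p n * a n ^+ 2 <= M) -> inX p a.
Proof.
move=> H; apply: le_lt_trans (ltry (Num.sqrt M)); apply: normX_le.
  exact: sqrtr_ge0.
move=> N; rewrite sqr_sqrtr//; have := H 0%N; by rewrite big_ord0.
Qed.

(** Reduces limits of extended real norms to bounds on finite sums, uniform in [N]. *)
Lemma normX_cvg0 (F : set_system R) (FF : Filter F) p (v : R -> nat -> R) :
  (forall eps : R, 0 < eps ->
    \forall s \near F, forall N, \sum_(n < N) wt p n * v s n ^+ 2 <= eps) ->
  normX p (v s) @[s --> F] --> 0%E.
Proof.
move=> H.
have H' (eps : R) : 0 < eps -> \forall s \near F, (normX p (v s) <= eps%:E)%E.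
  move=> eps0; have := H (eps ^+ 2) (exprn_gt0 _ eps0).
  by apply: filterS => s; apply: normX_le; exact: ltW.
have fin : \forall s \near F, normX p (v s) \is a fin_num.
  apply: filterS (H' 1 ltr01) => s h.
  by rewrite ge0_fin_numE ?normX_ge0// (le_lt_trans h)// ltry.
apply/fine_cvgP; split => //; apply/cvgrPdist_le => eps eps0.
near=> s; rewrite /= sub0r normrN ger0_norm ?fine_ge0 ?normX_ge0//.
rewrite -lee_fin fineK; last by near: s.
by near: s; exact: H'.
Unshelve. all: by end_near. Qed.

End weighted_norms.

(** * Duality pairings and trace integrals as limits of partial sums *)

Section pairing_and_trace.
Context {R : realType}.

Lemma eq_sqitg (a b : R) (f g : R -> R) : (forall x, a < x < b -> f x = g x) ->
  sqitg a b f -> sqitg a b g.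
Proof.
move=> fg [mf fi]; split.
  by apply: eq_measurable_fun mf => x; rewrite inE/= in_itv/=; exact: fg.
by apply: eq_itg fi => x /fg ->.
Qed.

Lemma cvg_series_le (a b : nat -> R) (M : R) : (forall n, `|a n| <= b n) ->
  (forall N, \sum_(n < N) b n <= M) -> cvgn (series a).
Proof.
move=> ab bM; apply: normed_cvg; apply: nondecreasing_is_cvgn.
  by apply: nondecreasing_series => n _ _; exact: normr_ge0.
exists M => _ [N _ <-]; change (series (fun n => `|a n|) N <= M).
rewrite seriesEord/=; apply: le_trans (bM N).
by apply: ler_sum => n _; exact: ab.
Qed.

(** Scaling [a n] by [sqrt (wt q n)] and [b n] by its inverse gives
    [|a n b n| <= wt q n a_n^2 + wt r n b_n^2], hence absolute convergence, without which the [limn]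
    in [pairing] carries no information. *)
Lemma pairing_cvg (q r : R) (a b : nat -> R) : (forall n, wt q n * wt r n = 1) ->
  inX q a -> inX r b ->
  \sum_(n < N) a n * b n @[N --> \oo] --> pairing a b.
Proof.
move=> qr /inX_bounded[M aM] /inX_bounded[M' bM].
have : cvgn (series (fun n => a n * b n)).
  apply: (@cvg_series_le _ (fun n => wt q n * a n ^+ 2 + wt r n * b n ^+ 2) (M + M')).
    move=> n; have := qr n; have := @wt_gt0 R q n; have := @wt_gt0 R r n.
    set x := wt q n; set y := wt r n => y0 x0 xy.
    have sx0 : 0 < Num.sqrt x by rewrite sqrtr_gt0.
    have sx2 : Num.sqrt x ^+ 2 = x by rewrite sqr_sqrtr// ltW.
    have ye : y = (Num.sqrt x)^-1 ^+ 2.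
      rewrite exprVn sx2; apply: (mulfI (lt0r_neq0 x0)).
      by rewrite xy divff// gt_eqF.
    pose u := Num.sqrt x * a n; pose v' := (Num.sqrt x)^-1 * b n.
    have uE : x * a n ^+ 2 = u ^+ 2 by rewrite /u exprMn sx2.
    have vE : y * b n ^+ 2 = v' ^+ 2 by rewrite /v' exprMn -ye.
    have -> : a n * b n = u * v' by rewrite /u /v'; field; rewrite gt_eqF.
    rewrite uE vE ler_norml.
    have := sqr_ge0 (u + v'); have := sqr_ge0 (u - v').
    have := sqr_ge0 u; have := sqr_ge0 v' => h1 h2 h3 h4.
    by apply/andP; split; lra.
  by move=> N; rewrite big_split/=; apply: lerD; [exact: aM|exact: bM].
move=> /cvg_ex[l Hl]; rewrite /pairing (cvg_lim _ Hl)//.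
have -> : (fun N => \sum_(n < N) a n * b n) = series (fun n => a n * b n).
  by apply/funext => N; rewrite seriesEord.
exact: Hl.
Qed.

(** Cauchy-Schwarz against the L^2 error of the partial sums. The sequence does not mention [z], so
    any two traces of one adjoint solution have the same integral against [h]. *)
Lemma trace_integ_cvg (tau : R) (c : nat -> R) (w : nat -> R -> R) (z h : R -> R) :
  (forall n, sqitg 0 tau (w n)) -> sqitg 0 tau h -> is_trace tau c w z ->
  \sum_(n < N) c n * integ 0 tau (fun t => w n t * h t) @[N --> \oo] -->
    integ 0 tau (fun t => z t * h t).
Proof.
move=> wi hi [/inL2P zi Sz]; apply/cvgrPdist_le => eps eps0.
pose S N t := \sum_(n < N) c n * w n t.
have Si N : sqitg 0 tau (S N).
  by apply: (@sqitg_sum _ _ _ _ (fun n t => c n * w n t)) => n; exact: sqitgZ.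
set H := Num.sqrt (integ 0 tau (fun t => h t ^+ 2)).
have H0 : 0 <= H by exact: sqrtr_ge0.
have e0 : 0 < eps / (H + 1) by rewrite divr_gt0// ltr_pwDr.
have /fine_cvgP[_ /cvgrPdist_le/(_ _ e0) Hn] := Sz.
near=> N; have : `|0 - fine (normL2 tau (fun t => S N t - z t))| <= eps / (H + 1).
  by near: N; exact: Hn.
have Szi := sqitgB (Si N) zi.
rewrite normL2_EFin//= sub0r normrN ger0_norm ?sqrtr_ge0// => Hs.
have -> : \sum_(n < N) c n * integ 0 tau (fun t => w n t * h t) =
    integ 0 tau (fun t => S N t * h t).
  rewrite (@eq_integ _ _ _ _ (fun t => \sum_(n < N) c n * (w n t * h t))).
    rewrite (@integ_sum _ _ _ _ (fun n t => c n * (w n t * h t))).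
      by apply: eq_bigr => n _; rewrite integZ//; exact: sqitg_mul.
    by move=> n; apply: itgZ; exact: sqitg_mul.
  by move=> t _; rewrite /S mulr_suml; apply: eq_bigr => n _; rewrite mulrA.
rewrite distrC -integB; [|exact: sqitg_mul|exact: sqitg_mul].
under eq_integ do rewrite -mulrBl.
apply: le_trans (ler_norm_sqrt (cauchy_schwarz_integ Szi hi)) _.
rewrite sqrtrM; last by apply: integ_ge0 => s _; exact: sqr_ge0.
apply: le_trans (ler_wpM2r H0 Hs) _.
by rewrite -mulrA ler_piMr ?(ltW eps0)// mulrC ler_pdivrMr ?mul1r ?lerDl// ltr_pwDr.
Unshelve. all: by end_near. Qed.

End pairing_and_trace.

(** * A mean value inequality for square sums of modes *)

Section mean_value.
Context {R : realType}.

(* The mean value theorem for the scalar function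
   [r |-> <D, x(r) - r x'(t)>], where [(s - t) D = x(s) - x(t) - (s - t) x'(t)]. *)
Lemma vector_mvt (T t s eps : R) (N : nat) (x dx : nat -> R -> R) :
  0 <= t <= T -> 0 <= s <= T -> s != t ->
  (forall n r, 0 <= r <= T -> has_derI 0 T (x n) r (dx n r)) ->
  (forall r, 0 <= r <= T -> `|r - t| <= `|s - t| ->
    \sum_(n < N) (dx n r - dx n t) ^+ 2 <= eps) ->
  \sum_(n < N) ((s - t)^-1 * (x n s - x n t) - dx n t) ^+ 2 <= eps.
Proof.
move=> tT sT st Hx Hdx.
have st0 : s - t != 0 by rewrite subr_eq0.
pose D n := (s - t)^-1 * (x n s - x n t) - dx n t.
pose g r := \sum_(n < N) D n * (x n r - dx n t * r).
pose dg r := \sum_(n < N) D n * (dx n r - dx n t).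
pose a := Num.min s t; pose b := Num.max s t.
have ab : a <= b by rewrite ge_min !le_max lexx.
have [a0 bT] : 0 <= a /\ b <= T.
  by case/andP: tT sT => t0 tT /andP[s0 sT]; rewrite le_min ge_max t0 s0 tT sT.
have gd (r : R) : a < r < b -> is_derive r 1 g (dg r).
  move=> /andP[ar rb].
  have r0T : 0 < r < T by rewrite (le_lt_trans a0 ar) (lt_le_trans rb bT).
  have r0T' : 0 <= r <= T by case/andP: r0T => /ltW-> /ltW->.
  rewrite /g /dg; elim: N {g dg Hdx} => [|M IH].
    under eq_fun do rewrite big_ord0; rewrite big_ord0.
    exact: (is_derive_cst (0 : R) r 1).
  under eq_fun do rewrite big_ord_recr/=; rewrite big_ord_recr/=.
  have H1 := has_derI_is_derive r0T (Hx M r r0T').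
  exact: (is_deriveDR IH (is_deriveZR _ (is_deriveBR H1 (is_derive_lin _ _)))).
have cg (r : R) : a <= r <= b -> g q @[q --> within `[a, b] (nbhs r)] --> g r.
  move=> /andP[ar rb].
  have r0T : 0 <= r <= T by rewrite (le_trans a0 ar) (le_trans rb bT).
  have sub : within `[a, b] (nbhs r) `=>` within `[0, T] (nbhs r).
    apply: within_subset => q /=; rewrite !in_itv/= => /andP[/(le_trans a0)->].
    by move=> /le_trans ->.
  rewrite /g; elim: N {g dg Hdx gd} => [|M IH].
    by under eq_fun do rewrite big_ord0; rewrite big_ord0; exact: cvg_cst.
  under eq_fun do rewrite big_ord_recr/=; rewrite big_ord_recr/=.
  apply: cvgD => //; apply: cvgM; first exact: cvg_cst.
  apply: cvgB; first exact: cvg_trans (cvg_app _ sub) (has_derI_cvg (Hx M r r0T)).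
  apply: cvgM; first exact: cvg_cst.
  by apply: cvg_within_filter; exact: cvg_id.
have [r rab e] := mvt_segment ab gd cg.
have {e} e : g s - g t = dg r * (s - t).
  move: e; rewrite /a /b; case: (leP s t) => _; first by lra.
  by [].
have rt : `|r - t| <= `|s - t|.
  move: rab; rewrite /a /b; case: (leP s t) => st' /andP[h1 h2].
    by rewrite ler0_norm ?subr_le0// ler0_norm ?subr_le0//; lra.
  by rewrite ger0_norm ?subr_ge0// ger0_norm ?subr_ge0 ?(ltW st')//; lra.
have rT : 0 <= r <= T.
  by case/andP: rab => /(le_trans a0)-> /le_trans->.
have DD : \sum_(n < N) D n ^+ 2 = dg r.
  apply: (mulIf st0); rewrite -e /g -sumrB mulr_suml; apply: eq_bigr => n _.
  have Ds : D n * (s - t) = x n s - x n t - dx n t * (s - t).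
    by rewrite /D mulrBl mulrAC mulVf ?mul1r.
  by rewrite expr2 -mulrA Ds; ring.
(* [DD] writes the square sum of [D] as its inner product with the increment of [dx]; AM-GM lets
   half of it be absorbed on the left. *)
have h1 : dg r <= \sum_(n < N) (2^-1 * D n ^+ 2 + 2^-1 * (dx n r - dx n t) ^+ 2).
  apply: ler_sum => n _; have := sqr_ge0 (D n - (dx n r - dx n t)); lra.
rewrite big_split/= -!mulr_sumr -DD in h1.
have h2 := Hdx r rT rt.
change (\sum_(n < N) D n ^+ 2 <= eps); lra.
Qed.

End mean_value.

(** * Well-posedness *)

Section damping.
Context {R : realType}.

Lemma powR_natD (n : nat) (r s : R) :
  n.+1%:R `^ (r + s) = n.+1%:R `^ r * n.+1%:R `^ s.
Proof. by rewrite powRD// pnatr_eq0 implybT. Qed.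

Definition damping (rho alpha : R) (n : nat) : R := rho * n%:R `^ (2 * alpha).

Definition kernel (rho alpha : R) (n : nat) : R -> R :=
  (projT1 (cid (oscillator_exists (damping rho alpha n) (n%:R ^+ 4)))).1.

Definition dkernel (rho alpha : R) (n : nat) : R -> R :=
  (projT1 (cid (oscillator_exists (damping rho alpha n) (n%:R ^+ 4)))).2.

(** The ratio condition follows from [n^2 = n^(2 alpha) n^(2 - 2 alpha)] with a nonnegative last
    exponent; [alpha <= 1] enters there and in the quadratic growth. Mode 0 uses
    [2 * alpha != 0]. *)
Lemma kernel_family (rho alpha : R) : 0 <= rho -> 0 < alpha <= 1 ->
  oscillator_family rho (damping rho alpha) (kernel rho alpha) (dkernel rho alpha).
Proof.
move=> rho0 /andP[a0 a1].
have a20 : 2 * alpha != 0 by rewrite mulf_neq0// gt_eqF.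
have powle n : n%:R `^ (2 * alpha) <= n%:R ^+ 2 :> R.
  case: n => [|n]; first by rewrite powR0// expr0n.
  by rewrite -powR_mulrn// ler_powR ?ler1n//; lra.
split => //.
- by move=> n; rewrite /kernel /dkernel; case: cid.
- by move=> n; rewrite mulr_ge0 ?powR_ge0//= ler_wpM2l.
- move=> k n kn; split.
    by rewrite ler_wpM2l// ge0_ler_powR ?nnegrE ?ler_nat// mulr_ge0// ltW.
  rewrite /damping -!mulrA ler_wpM2l//; case: k kn => [|k] kn.
    by rewrite powR0// expr0n mulr0 mul0r.
  case: n kn => // n kn.
  have split2 j : j.+1%:R ^+ 2 =
      j.+1%:R `^ (2 * alpha) * j.+1%:R `^ (2 - 2 * alpha) :> R.
    by rewrite -powR_natD (addrC (2 * alpha)) subrK powR_mulrn.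
  rewrite !split2 mulrCA ler_wpM2l ?powR_ge0// ler_wpM2l ?powR_ge0//.
  by rewrite ge0_ler_powR ?nnegrE ?ler_nat//; lra.
Qed.

End damping.

(** * Well-posedness for a general order [p] and trace coefficients [c] *)

Section wellposed.
Context {R : realType}.
Variables (T rho alpha p kappa : R) (c : nat -> R).
Hypotheses (hT : 0 < T) (hrho : 0 < rho) (halpha : 0 < alpha <= 1).
Hypothesis hc : forall n, wt (p - 2) n * c n ^+ 2 <= kappa.

Let m := damping rho alpha.
Let K := kernel rho alpha.
Let dK := dkernel rho alpha.

Let F : oscillator_family rho m K dK.
Proof. by apply: kernel_family => //; exact: ltW. Qed.

Let T0 : 0 <= T. Proof. exact: ltW. Qed.

Let B := bessel_bound rho T.

Let B0 : 0 < B. Proof. exact: bessel_bound_gt0 F T0. Qed.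

Definition solution (h : R -> R) (t : R) (n : nat) : R :=
  - c n * convK K h n t.

Let kappa0 : 0 <= kappa.
Proof. by apply: le_trans (hc 0%N); rewrite mulr_ge0 ?sqr_ge0// ltW// wt_gt0. Qed.

Let wt_freq (q : R) n : wt q n = wt (q - 2) n * freq n ^+ 2.
Proof.
rewrite /wt /freq; case: n => [|n] /=; first by rewrite expr1n mulr1.
rewrite -exprM -powR_mulrn// -powR_natD.
by congr (_ `^ _); ring.
Qed.

Let wt_inv (q r : R) n : q + r = 0 -> wt q n * wt r n = 1.
Proof.
move=> qr; rewrite /wt; case: n => [|n] /=; first by rewrite mulr1.
by rewrite -powR_natD -mulrDr qr mulr0 powRr0.
Qed.

Let wt_le n : wt (p - 2) n <= wt p n.
Proof.
by rewrite (wt_freq p) ler_peMr ?(ltW (wt_gt0 _ _))// exprn_ege1// freq_ge1.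
Qed.

Let term_low n (x : R) : wt (p - 2) n * (- c n * x) ^+ 2 <= kappa * x ^+ 2.
Proof. by rewrite exprMn sqrrN mulrA ler_wpM2r ?sqr_ge0. Qed.

(** The weights of [X_N^p] and [X_N^(p - 2)] differ exactly by [freq n ^+ 2], so the single bound
    [hc] on [c] serves both the state and its velocity. *)
Let term_high n (x : R) : wt p n * (- c n * x) ^+ 2 <= kappa * (freq n * x) ^+ 2.
Proof.
have := term_low n (freq n * x); apply: le_trans; rewrite (wt_freq p).
by rewrite le_eqVlt; apply/orP; left; apply/eqP; ring.
Qed.

Let convB (f g : R -> R) n (t : R) : 0 <= t <= T -> sqitg 0 T f -> sqitg 0 T g ->
  convK K (f - g) n t = convK K f n t - convK K g n t /\
  convdK dK (f - g) n t = convdK dK f n t - convdK dK g n t.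
Proof.
move=> /andP[t0 tT] fi gi.
have fi' := sqitgS (lexx 0) tT fi; have gi' := sqitgS (lexx 0) tT gi.
have Ki : sqitg 0 t (fun s => K n (t - s)).
  exact/sqitg_cont/continuous_rev/(osc_cont (family_osc F n)).
have dKi : sqitg 0 t (fun s => dK n (t - s)).
  exact/sqitg_cont/continuous_rev/(osc_contd (family_osc F n)).
split.
  rewrite /convK -integB; [|exact: sqitg_mul|exact: sqitg_mul].
  by apply: eq_integ => s _; rewrite -mulrBr.
rewrite /convdK -integB; [|exact: sqitg_mul|exact: sqitg_mul].
by apply: eq_integ => s _; rewrite -mulrBr.
Qed.

(** Finitely many modes converge by continuity; the others are small at [s] and at [t] alike, with
    [2 (eps / 8 + eps / 8) = eps / 2]. *)
Let uniform_cvg (X : nat -> R -> R) (t : R) :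
  0 <= t <= T -> (forall n, X n s @[s --> within `[0, T] (nbhs t)] --> X n t) ->
  (forall eps : R, 0 < eps -> exists (eta : R) N0, 0 < eta /\
    forall s N, 0 <= s <= T -> `|s - t| < eta ->
      \sum_(N0 <= n < N) X n s ^+ 2 <= eps) ->
  forall eps : R, 0 < eps -> \forall s \near within `[0, T] (nbhs t),
    forall N, \sum_(n < N) (X n s - X n t) ^+ 2 <= eps.
Proof.
move=> tT cX tail eps eps0.
have [eta [N0 [eta0 HN0]]] := tail (eps / 8) ltac:(by rewrite divr_gt0).
have head : \forall s \near within `[0, T] (nbhs t),
    \sum_(n < N0) (X n s - X n t) ^+ 2 <= eps / 2.
  have : \sum_(n < N0) (X n s - X n t) ^+ 2
      @[s --> within `[0, T] (nbhs t)] --> (0 : R).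
    elim: N0 {HN0} => [|N0 IH].
      by under eq_fun do rewrite big_ord0; exact: cvg_cst.
    under eq_fun do rewrite big_ord_recr/= expr2.
    have FF : Filter (within `[0, T] (nbhs t)) by exact: within_filter.
    have c0 : X N0 s - X N0 t @[s --> within `[0, T] (nbhs t)] --> (0 : R).
      by have := cvgB (cX N0) (cvg_cst (X N0 t)); rewrite subrr; apply.
    by have := cvgD IH (cvgM c0 c0); rewrite mulr0 addr0; apply.
  have e2 : 0 < eps / 2 by rewrite divr_gt0.
  move=> /cvgrPdist_le/(_ _ e2); apply: filterS => s /=.
  by rewrite sub0r normrN; apply: le_trans; exact: ler_norm.
have close : \forall s \near within `[0, T] (nbhs t), 0 <= s <= T /\ `|s - t| < eta.
  by apply/near_within_segment; exists eta.
near=> s => N.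
have [sT st] : 0 <= s <= T /\ `|s - t| < eta by near: s.
have hs : \sum_(n < N0) (X n s - X n t) ^+ 2 <= eps / 2 by near: s.
have ts : \sum_(N0 <= n < N) (X n s - X n t) ^+ 2 <= eps / 2.
  apply: (@le_trans _ _ (\sum_(N0 <= n < N) (2 * X n s ^+ 2 + 2 * X n t ^+ 2))).
    by apply: ler_sum => n _; have := sqr_ge0 (X n s + X n t); lra.
  rewrite big_split/= -!mulr_sumr.
  have := HN0 s N sT st; have := HN0 t N tT; rewrite subrr normr0 => /(_ eta0).
  lra.
have [NN0|N0N] := leqP N N0.
  apply: (@le_trans _ _ (\sum_(n < N0) (X n s - X n t) ^+ 2)); last by lra.
  rewrite -(big_mkord xpredT (fun n => (X n s - X n t) ^+ 2)).
  rewrite -(big_mkord xpredT (fun n => (X n s - X n t) ^+ 2)).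
  rewrite [leRHS](big_cat_nat (n := N))//= lerDl.
  by apply: sumr_ge0 => n _; exact: sqr_ge0.
rewrite -(big_mkord xpredT (fun n => (X n s - X n t) ^+ 2)).
rewrite (big_cat_nat (n := N0))//=; last exact: ltnW.
rewrite big_mkord; lra.
Unshelve. all: by end_near. Qed.

Section fixed_control.
Variable h : R -> R.
Hypothesis hi : sqitg 0 T h.

Let solution_has_derI n (t : R) : 0 <= t <= T ->
  has_derI 0 T ((solution h)^~ n) t (- c n * convdK dK h n t).
Proof. by move=> tT; apply: has_derIZ; exact: (convK_has_derI F T0 hi). Qed.

Lemma solution_Dt n (t : R) : 0 <= t <= T ->
  Dt T (solution h) t n = - c n * convdK dK h n t.
Proof. by move=> tT; apply: has_derI_deriveI => //; exact: solution_has_derI. Qed.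

Let cvg_convK (t eps : R) : 0 <= t <= T -> 0 < eps ->
  \forall s \near within `[0, T] (nbhs t),
    forall N, \sum_(n < N)
      (freq n * convK K h n s - freq n * convK K h n t) ^+ 2 <= eps.
Proof.
move=> tT; apply: (@uniform_cvg (fun n s => freq n * convK K h n s)) => //.
  move=> n; apply: cvgM; first exact: cvg_cst.
  exact: (has_derI_cvg (convK_has_derI F T0 hi (n := n) tT)).
move=> e e0; have [eta [N0 [eta0 H]]] := conv_tail F T0 hi tT e0.
by exists eta, N0; split => // s N sT st; have [] := H s N sT st.
Qed.

Let cvg_convdK (t eps : R) : 0 <= t <= T -> 0 < eps ->
  \forall s \near within `[0, T] (nbhs t),
    forall N, \sum_(n < N) (convdK dK h n s - convdK dK h n t) ^+ 2 <= eps.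
Proof.
move=> tT; apply: (@uniform_cvg (convdK dK h)) => //.
  by move=> n; exact: (convdK_cvg F T0 hi).
move=> e e0; have [eta [N0 [eta0 H]]] := conv_tail F T0 hi tT e0.
by exists eta, N0; split => // s N sT st; have [] := H s N sT st.
Qed.

Let kappa1 (eps : R) : 0 < eps -> exists2 e, 0 < e & kappa * e <= eps.
Proof.
move=> eps0; have k1 : 0 < kappa + 1 by rewrite ltr_pwDr.
exists (eps / (kappa + 1)); first by rewrite divr_gt0.
by rewrite mulrCA ger_pMr// ler_pdivrMr// mul1r lerDl.
Qed.

Lemma solution_inX (t : R) : 0 <= t <= T -> inX p (solution h t).
Proof.
move=> tT.
apply: (@bounded_inX _ _ _ (kappa * (B * integ 0 T (fun s => h s ^+ 2)))) => N.
apply: le_trans (ler_wpM2l kappa0 (convK_bessel F T0 hi N tT)).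
by rewrite mulr_sumr; apply: ler_sum => n _; exact: term_high.
Qed.

Lemma Dt_solution_inX (t : R) : 0 <= t <= T -> inX (p - 2) (Dt T (solution h) t).
Proof.
move=> tT.
apply: (@bounded_inX _ _ _ (kappa * (B * integ 0 T (fun s => h s ^+ 2)))) => N.
apply: le_trans (ler_wpM2l kappa0 (convdK_bessel F T0 hi N tT)).
by rewrite mulr_sumr; apply: ler_sum => n _; rewrite solution_Dt//; exact: term_low.
Qed.

Lemma solution_C0X q : (forall n, wt q n <= wt p n) -> C0X T q (solution h).
Proof.
move=> qp t; rewrite in_itv/= => tT.
have qle n (x : R) : wt q n * x ^+ 2 <= wt p n * x ^+ 2 by rewrite ler_wpM2r ?sqr_ge0.
split.
  have [M HM] := inX_bounded (solution_inX tT); apply: (@bounded_inX _ _ _ M) => N.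
  by apply: le_trans (HM N); apply: ler_sum => n _; exact: qle.
apply: normX_cvg0 => eps /kappa1[e e0 ke].
apply: filterS (cvg_convK tT e0) => s H N; apply: le_trans ke.
apply: le_trans (ler_wpM2l kappa0 (H N)); rewrite mulr_sumr.
apply: ler_sum => n _; apply: le_trans (qle _ _) _.
have -> : (solution h s - solution h t) n = - c n * (convK K h n s - convK K h n t).
  by rewrite mulrBr.
by rewrite -[freq n * _ - _]mulrBr; exact: term_high.
Qed.

Lemma Dt_solution_C0X : C0X T (p - 2) (Dt T (solution h)).
Proof.
move=> t; rewrite in_itv/= => tT; split; first exact: Dt_solution_inX.
apply: normX_cvg0 => eps /kappa1[e e0 ke].
have sT : \forall s \near within `[0, T] (nbhs t), 0 <= s <= T.
  by apply/near_within_segment; exists 1.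
apply: filterS2 sT (cvg_convdK tT e0) => s sT H N; apply: le_trans ke.
apply: le_trans (ler_wpM2l kappa0 (H N)); rewrite mulr_sumr.
apply: ler_sum => n _.
have -> : (Dt T (solution h) s - Dt T (solution h) t) n =
    - c n * (convdK dK h n s - convdK dK h n t).
  by rewrite mulrBr -!solution_Dt.
exact: term_low.
Qed.

(** [vector_mvt] upgrades modewise derivatives to a derivative in norm: its hypothesis is the
    continuity of the velocities in square sum, with a radius [d] independent of [N]. *)
Lemma solution_C1X : C1X T (p - 2) (solution h).
Proof.
split; [exact/solution_C0X/wt_le|exact: Dt_solution_C0X|].
move=> t; rewrite in_itv/= => tT.
apply: normX_cvg0 => eps /kappa1[e e0 ke].
have /near_within_segment[d d0 Hd] := cvg_convdK tT e0.
apply/near_within_dnbhs; exists d => // s sT st std N; apply: le_trans ke.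
have := @vector_mvt R T t s e N (convK K h) (convdK dK h) tT sT st.
move=> /(_ (fun n r rT => convK_has_derI F T0 hi (n := n) rT)) H.
have {}H := H (fun r rT rt => Hd r rT (le_lt_trans rt std) N).
apply: le_trans (ler_wpM2l kappa0 H); rewrite mulr_sumr.
apply: ler_sum => n _.
have -> : ((s - t)^-1 *: (solution h s - solution h t) - Dt T (solution h) t) n =
    - c n * ((s - t)^-1 * (convK K h n s - convK K h n t) - convdK dK h n t).
  rewrite -[LHS]/((s - t)^-1 * (solution h s n - solution h t n)
    - Dt T (solution h) t n).
  by rewrite solution_Dt// /solution; ring.
exact: term_low.
Qed.

Lemma solution0 : solution h 0 = 0.
Proof.
by apply/funext => n; rewrite /solution /convK integ_nil mulr0.
Qed.

Lemma Dt_solution0 : Dt T (solution h) 0 = 0.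
Proof.
by apply/funext => n; rewrite solution_Dt ?lexx ?T0// /convdK integ_nil mulr0.
Qed.

(** * Traces of adjoint solutions and the weak identity *)

Section adjoint_data.
Variables (tau : R) (w0 w1 : nat -> R) (w : nat -> R -> R).
Hypotheses (tau0T : 0 < tau <= T) (adj : adjoint_solution rho alpha tau w0 w1 w).

Let tau0 : 0 < tau. Proof. by case/andP: tau0T. Qed.
Let tauT : tau <= T. Proof. by case/andP: tau0T. Qed.

Let adjE n (t : R) : 0 <= t <= tau ->
  w n t = w0 n * (dK n (tau - t) + m n * K n (tau - t)) - w1 n * K n (tau - t).
Proof.
move=> tt; have [ode e0 e1] := adj n.
have := @adjoint_repr R tau _ _ _ _ (w n) tau0 (family_osc F n) _ t tt.
rewrite e0 e1; apply => s st.
by apply: ode; rewrite in_itv.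
Qed.

Let hi' : sqitg 0 tau h. Proof. exact: sqitgS (lexx 0) tauT hi. Qed.

Let Ki n : sqitg 0 tau (fun s => K n (tau - s)).
Proof. exact/sqitg_cont/continuous_rev/(osc_cont (family_osc F n)). Qed.

Let dKi n : sqitg 0 tau (fun s => dK n (tau - s)).
Proof. exact/sqitg_cont/continuous_rev/(osc_contd (family_osc F n)). Qed.

Lemma adjoint_sqitg n : sqitg 0 tau (w n).
Proof.
apply: (@eq_sqitg _ _ _ (fun t =>
    w0 n * (dK n (tau - t) + m n * K n (tau - t)) - w1 n * K n (tau - t))).
  by move=> t /andP[/ltW t0 /ltW tt]; rewrite adjE ?t0.
by apply: sqitgB; apply: sqitgZ => //; apply: sqitgD => //; exact: sqitgZ.
Qed.

(** The weak identity for one mode: [w n] is a combination of reversed kernels, so its integral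
    against [h] combines the two convolutions at [tau]. *)
Lemma adjoint_mode n : c n * integ 0 tau (fun t => w n t * h t) =
  (w1 - rho *: AN alpha w0) n * solution h tau n
  - w0 n * Dt T (solution h) tau n.
Proof.
rewrite solution_Dt ?tauT ?(ltW tau0)//.
have i1 := sqitg_mul (dKi n) hi'; have i2 := sqitg_mul (Ki n) hi'.
have -> : integ 0 tau (fun t => w n t * h t) =
    w0 n * convdK dK h n tau + (w0 n * m n - w1 n) * convK K h n tau.
  rewrite /convdK /convK -!integZ// -integD; [|exact: itgZ|exact: itgZ].
  by apply: eq_integ => t /andP[/ltW t0 /ltW tt]; rewrite adjE ?t0//; ring.
have -> : (w1 - rho *: AN alpha w0) n = w1 n - m n * w0 n.
  by rewrite /m /damping -mulrA.
by rewrite /solution; ring.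
Qed.

(** [a] and [b] are the coefficients of the trace in the reversed families [K_n'] and
    [freq n * K_n], for which the Riesz inequalities hold. *)
Let a n := c n * w0 n.
Let b n := c n * (m n * w0 n - w1 n) / freq n.

Lemma adjoint_partial_sum N (t : R) : 0 <= t <= tau ->
  \sum_(n < N) c n * w n t =
  \sum_(n < N) (a n * dK n (tau - t) + b n * (freq n * K n (tau - t))).
Proof.
move=> tt; apply: eq_bigr => n _; rewrite adjE// /a /b.
have f0 : freq n != 0 :> R by rewrite gt_eqF// freq_gt0.
by field.
Qed.

Hypotheses (w0X : inX (2 - p) w0) (w1X : inX (- p) w1).

Let m_le n : 0 <= m n <= rho * freq n.
Proof.
have [_ _ mr _] := F; have /andP[-> mn] := mr n.
apply: le_trans mn _; apply: ler_wpM2l; first exact: ltW.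
by rewrite /freq; case: n => [|n]//; rewrite expr0n.
Qed.

Let freq_wt n : wt (2 - p) n = wt (- p) n * freq n ^+ 2.
Proof. by rewrite (wt_freq (2 - p)); congr (wt _ _ * _); ring. Qed.

(** The damping operator costs at most a factor [rho * freq n], which is the gap between the spaces
    of [w0] and [w1]. *)
Lemma AN_inX : inX (- p) (w1 - rho *: AN alpha w0).
Proof.
have [M0 H0] := inX_bounded w0X; have [M1 H1] := inX_bounded w1X.
apply: (@bounded_inX _ _ _ (2 * M1 + 2 * rho ^+ 2 * M0)) => N.
apply: le_trans (lerD (ler_wpM2l _ (H1 N)) (ler_wpM2l _ (H0 N))) => //; last first.
  by rewrite mulr_ge0 ?sqr_ge0.
rewrite !mulr_sumr -big_split/=; apply: ler_sum => n _.
have -> : (w1 - rho *: AN alpha w0) n = w1 n - m n * w0 n.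
  by rewrite /m /damping -mulrA.
have /andP[m0 mf] := m_le n; rewrite freq_wt.
have m2 : m n ^+ 2 <= rho ^+ 2 * freq n ^+ 2.
  by rewrite -exprMn ler_pXn2r ?nnegrE// mulr_ge0 ?(ltW hrho)// ltW// freq_gt0.
have x0 := ltW (@wt_gt0 R (- p) n).
have h1 := mulr_ge0 x0 (sqr_ge0 (w1 n + m n * w0 n)).
have h2 := ler_wpM2l x0 (ler_wpM2r (sqr_ge0 (w0 n)) m2).
lra.
Qed.

Lemma coefficients_bounded :
  exists M, forall N, \sum_(n < N) (a n ^+ 2 + b n ^+ 2) <= M.
Proof.
have [M0 H0] := inX_bounded w0X; have [M1 H1] := inX_bounded AN_inX.
exists (kappa * M0 + kappa * M1) => N.
apply: le_trans (lerD (ler_wpM2l kappa0 (H0 N)) (ler_wpM2l kappa0 (H1 N))).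
rewrite !mulr_sumr -big_split/=; apply: ler_sum => n _.
have -> : (w1 - rho *: AN alpha w0) n = - (m n * w0 n - w1 n).
  by rewrite opprB /m /damping -mulrA.
have f0 : freq n != 0 :> R by rewrite gt_eqF// freq_gt0.
have e1 : wt (p - 2) n * wt (2 - p) n = 1 by apply: wt_inv; ring.
apply: lerD.
  have -> : a n ^+ 2 = wt (p - 2) n * c n ^+ 2 * (wt (2 - p) n * w0 n ^+ 2).
    by rewrite [RHS]mulrACA e1 mul1r /a exprMn.
  by rewrite ler_wpM2r// mulr_ge0 ?sqr_ge0// ltW// wt_gt0.
rewrite sqrrN; set x := m n * w0 n - w1 n.
have -> : b n ^+ 2 = wt (p - 2) n * c n ^+ 2 * (wt (- p) n * x ^+ 2).
  apply: (mulIf (expf_neq0 2 f0)); rewrite /b -/x.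
  rewrite -[RHS]mulrA [wt (- p) n * _ * _]mulrAC -freq_wt [RHS]mulrACA e1 mul1r.
  by field.
by rewrite ler_wpM2r// mulr_ge0 ?sqr_ge0// ltW// wt_gt0.
Qed.

Lemma trace_exists : exists z, is_trace tau c w z.
Proof.
pose S N t := \sum_(n < N) c n * w n t.
have Si N : sqitg 0 tau (S N).
  apply: (@sqitg_sum _ _ _ _ (fun n t => c n * w n t)) => n.
  exact/sqitgZ/adjoint_sqitg.
have [M HM] := coefficients_bounded.
have cauchy_le N1 N2 (eps : R) : 0 < eps -> (N1 <= N2)%N ->
    \sum_(N1 <= n < N2) (a n ^+ 2 + b n ^+ 2) <= eps ->
    integ 0 tau (fun s => (S N2 s - S N1 s) ^+ 2) <= 2 * B * eps.
  move=> eps0 N12 Heps.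
  (* Truncated coefficients let the Riesz inequalities, stated for sums starting at 0, control a
     block from [N1] to [N2]. *)
  pose xa n := if (N1 <= n)%N then a n else 0.
  pose xb n := if (N1 <= n)%N then b n else 0.
  pose fa s := \sum_(n < N2) xa n * dK n (tau - s).
  pose fb s := \sum_(n < N2) xb n * (freq n * K n (tau - s)).
  have fai : sqitg 0 tau fa.
    apply: (@sqitg_sum _ _ _ _ (fun n s => xa n * dK n (tau - s))) => n.
    exact: sqitgZ.
  have fbi : sqitg 0 tau fb.
    apply: (@sqitg_sum _ _ _ _ (fun n s => xb n * (freq n * K n (tau - s)))) => n.
    by apply: sqitgZ; exact: sqitgZ.
  have Sab s : 0 < s < tau -> S N2 s - S N1 s = fa s + fb s.
    move=> /andP[/ltW s0 /ltW st].
    rewrite /S !adjoint_partial_sum ?s0//.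
    set f := fun n => a n * dK n (tau - s) + b n * (freq n * K n (tau - s)).
    rewrite -(big_mkord xpredT f) -(big_mkord xpredT f).
    rewrite (big_cat_nat (n := N1))//= addrAC subrr add0r.
    rewrite /fa /fb -big_split/=.
    set g := fun n => xa n * dK n (tau - s) + xb n * (freq n * K n (tau - s)).
    rewrite -(big_mkord xpredT g) [RHS](big_cat_nat (n := N1))//=.
    have -> : \sum_(0 <= n < N1) g n = 0.
      rewrite big_nat_cond big1// => n /andP[/andP[_ nN1] _].
      by rewrite /g /xa /xb leqNgt nN1/= !mul0r addr0.
    by rewrite add0r; apply: eq_big_nat => n /andP[N1n _]; rewrite /f /g /xa /xb N1n.
  have [_ fai2] := fai; have [_ fbi2] := fbi.
  apply: (@le_trans _ _ (integ 0 tau (fun s => 2 * fa s ^+ 2 + 2 * fb s ^+ 2))).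
    apply: le_integ.
    - by have [] := sqitgB (Si N2) (Si N1).
    - by apply: itgD; exact: itgZ.
    - by move=> s /Sab ->; have := sqr_ge0 (fa s - fb s); lra.
  rewrite integD ?integZ//; [|exact: itgZ|exact: itgZ].
  have ha := riesz_dK F T0 N2 xa (lexx 0) (ltW tau0) tauT.
  have hb := riesz_K F T0 N2 xb (lexx 0) (ltW tau0) tauT.
  have xab : \sum_(n < N2) xa n ^+ 2 + \sum_(n < N2) xb n ^+ 2 <= eps.
    apply: le_trans Heps; rewrite -big_split/=.
    rewrite -(big_mkord xpredT (fun n => xa n ^+ 2 + xb n ^+ 2)).
    rewrite (big_cat_nat (n := N1))//=.
    have -> : \sum_(0 <= n < N1) (xa n ^+ 2 + xb n ^+ 2) = 0.
      rewrite big_nat_cond big1// => n /andP[/andP[_ nN1] _].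
      by rewrite /xa /xb leqNgt nN1/= expr0n addr0.
    rewrite add0r le_eqVlt; apply/orP; left; apply/eqP.
    by apply: eq_big_nat => n /andP[N1n _]; rewrite /xa /xb N1n.
  have := ler_wpM2l (ltW B0) xab; rewrite -/B -/(fa _) -/(fb _) in ha hb *.
  rewrite /fa /fb; lra.
have [z zi Sz] : exists2 z, sqitg 0 tau z & forall eps : R, 0 < eps ->
    exists N0, forall N, (N0 <= N)%N ->
      integ 0 tau (fun s => (S N s - z s) ^+ 2) <= eps.
  apply: L2_complete => //; first exact: ltW.
  move=> eps eps0; pose e := eps / (2 * (2 * B)).
  have e0 : 0 < e by rewrite divr_gt0 ?mulr_gt0.
  have ab0 n : 0 <= a n ^+ 2 + b n ^+ 2 by rewrite addr_ge0 ?sqr_ge0.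
  have [N0 HN0] := bounded_sum_tail ab0 HM e0.
  have tailE N1 N2 : (N0 <= N1)%N -> (N1 <= N2)%N ->
      \sum_(N1 <= n < N2) (a n ^+ 2 + b n ^+ 2) <= e.
    move=> N01 N12; apply: le_trans (HN0 N2); rewrite [leRHS](big_cat_nat (n := N1))//=.
    by rewrite lerDr; apply: sumr_ge0 => n _; exact: ab0.
  have eB : 2 * B * e <= eps.
    by rewrite /e mulrCA -[leRHS]mulr1 ler_wpM2l ?(ltW eps0)// invfM mulrCA divff
      ?mulr1 ?invf_le1 ?ler1n// gt_eqF// mulr_gt0.
  exists N0 => N1 N2 N01 N02; apply: le_trans eB.
  have [N12|/ltnW N21] := leqP N1 N2.
    under eq_integ do rewrite -sqrrN opprB.
    by apply: cauchy_le => //; exact: tailE.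
  by apply: cauchy_le => //; exact: tailE.
exists z; split; first exact/inL2P.
apply/fine_cvgP; split.
  by apply: nearW => N; rewrite (normL2_EFin (sqitgB (Si N) zi)).
apply/cvgrPdist_le => eps eps0.
have [N0 HN0] := Sz (eps ^+ 2) (exprn_gt0 _ eps0).
near=> N; rewrite /= (normL2_EFin (sqitgB (Si N) zi))/= sub0r normrN.
rewrite ger0_norm ?sqrtr_ge0// -(@ger0_norm _ eps (ltW eps0)) -sqrtr_sqr.
rewrite ler_sqrt ?sqr_ge0//; apply: HN0; near: N; exact: nbhs_infty_ge.
Unshelve. all: by end_near. Qed.

Lemma weak_identity z : is_trace tau c w z ->
  0 = pairing (w1 - rho *: AN alpha w0) (solution h tau)
      - pairing w0 (Dt T (solution h) tau)
      - \int[lebesgue_measure]_(t in `]0, tau[) (z t * h t).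
Proof.
move=> Hz; have tT : 0 <= tau <= T by rewrite tauT ltW.
have H1 := trace_integ_cvg adjoint_sqitg hi' Hz.
have H2 := pairing_cvg (fun n => wt_inv n (addNr p)) AN_inX (solution_inX tT).
have H3 := pairing_cvg (fun n => wt_inv n _) w0X (Dt_solution_inX tT).
have {}H3 := H3 ltac:(ring).
have E : (fun N => \sum_(n < N) c n * integ 0 tau (fun t => w n t * h t)) =
  (fun N => \sum_(n < N) (w1 - rho *: AN alpha w0) n * solution h tau n
    - \sum_(n < N) w0 n * Dt T (solution h) tau n).
  apply/funext => N; rewrite -sumrB; apply: eq_bigr => n _; exact: adjoint_mode.
rewrite E in H1; rewrite -/(integ 0 tau (fun t => z t * h t)).
rewrite -(cvg_lim (@Rhausdorff R) H1) (cvg_lim (@Rhausdorff R) (cvgB H2 H3)).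
by rewrite subrr.
Qed.

End adjoint_data.

Lemma solution_weak : weak_solution rho alpha T p c h (solution h).
Proof.
split; [exact: solution_C0X|exact: solution_C1X|exact: solution0|exact: Dt_solution0|].
move=> tau w0 w1 w tauT w0X w1X adj.
have [z Hz] := trace_exists tauT adj w0X w1X.
by exists z => //; exact: weak_identity Hz.
Qed.

End fixed_control.

(** The data [w0 = 0] and [w1] the unit sequence at [k] isolate the coefficient [u_k(t)]. The two
    solutions may come with different traces, so both values are identified as the limit of one
    scalar sequence. *)
Lemma weak_solution_unique (h : R -> R) (u v : R -> nat -> R) : sqitg 0 T h ->
  weak_solution rho alpha T p c h u -> weak_solution rho alpha T p c h v ->
  forall t, 0 <= t <= T -> u t = v t.
Proof.
move=> hi [_ _ u0 _ Hu] [_ _ v0 _ Hv] t /andP[].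
(* The weak identity needs a positive final time; at [t = 0] the initial condition decides. *)
rewrite le_eqVlt => /predU1P[<- _|t0 tT]; first by rewrite u0 v0.
apply/funext => k.
pose w0 : nat -> R := fun=> 0.
pose w1 : nat -> R := fun n => (n == k)%:R.
have adj := adjoint_exists w0 w1 t0 (family_osc F).
set w := (fun n : nat => _) in adj.
have w0X : inX (2 - p) w0.
  apply: (@bounded_inX _ _ _ 0) => N.
  by rewrite big1// => n _; rewrite /w0 expr0n mulr0.
have w1X : inX (- p) w1.
  apply: (@bounded_inX _ _ _ (wt (- p) k)) => N.
  apply: (@le_trans _ _ (\sum_(n < N) (if n == k :> nat then wt (- p) k else 0))).
    apply: ler_sum => n _; rewrite /w1; case: eqP => [->|_].
      by rewrite expr1n mulr1.
    by rewrite expr0n mulr0.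
  have [kN|Nk] := ltnP k N.
    by rewrite -big_mkcond/= (big_pred1 (Ordinal kN)).
  rewrite big1 ?(ltW (wt_gt0 _ _))// => n _.
  by rewrite ltn_eqF// (leq_trans (ltn_ord n)).
have tT' : 0 < t <= T by rewrite t0.
have pair0 (x : nat -> R) : pairing w0 x = 0.
  rewrite /pairing; apply: cvg_lim => //.
  rewrite (_ : series _ = fun=> 0); first exact: cvg_cst.
  by apply/funext => N; rewrite seriesEord/= big1// => n _; rewrite mul0r.
have pair1 (x : nat -> R) : pairing (w1 - rho *: AN alpha w0) x = x k.
  rewrite /pairing; apply: cvg_lim => //; apply: cvg_near_cst.
  near=> N; have kN : (k < N)%N by near: N; exact: nbhs_infty_gt.
  rewrite seriesEord/= (bigD1 (Ordinal kN))//= big1 ?addr0.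
    rewrite -[(w1 - _) k]/(w1 k - rho * (k%:R `^ (2 * alpha) * 0)).
    by rewrite /w1 eqxx !mulr0 subr0 mul1r.
  move=> n nk; rewrite -[(w1 - _) n]/(w1 n - rho * (n%:R `^ (2 * alpha) * 0)).
  have nk' : (n == k :> nat) = false by apply/negbTE; exact: nk.
  by rewrite /w1 nk' !mulr0 subr0 mul0r.
have key (x : R -> nat -> R) z : is_trace t c w z ->
    0 = pairing (w1 - rho *: AN alpha w0) (x t) - pairing w0 (Dt T x t)
      - \int[lebesgue_measure]_(s in `]0, t[) (z s * h s) ->
    \sum_(n < N) c n * integ 0 t (fun s => w n s * h s) @[N --> \oo] --> x t k.
  move=> Hz; rewrite pair0 pair1 subr0 => /esym/eqP; rewrite subr_eq0 => /eqP ->.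
  apply: trace_integ_cvg => //; last exact: sqitgS (lexx 0) tT hi.
  by move=> n; exact: adjoint_sqitg adj n.
have [zu tu eu] := Hu t w0 w1 w tT' w0X w1X adj.
have [zv tv ev] := Hv t w0 w1 w tT' w0X w1X adj.
rewrite -(cvg_lim (@Rhausdorff R) (key u zu tu eu)).
by rewrite (cvg_lim (@Rhausdorff R) (key v zv tv ev)).
Unshelve. all: by end_near. Qed.

(** By linearity the difference is the solution for [f - f0]. Each of the three norms is at most
    [A * r], with [r] the L^2 distance of the controls, hence the constant [3 * A + 1]. *)
Lemma solution_continuous : continuous_L2_C0X_C1X T p (p - 2) solution.
Proof.
move=> f0 /inL2P f0i eps eps0.
pose A := Num.sqrt (kappa * B).
have A0 : 0 <= A by exact: sqrtr_ge0.
have A1 : 0 < 3 * A + 1 by lra.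
exists (eps / (3 * A + 1)); first by rewrite divr_gt0.
move=> f /inL2P fi; have gi : sqitg 0 T (f - f0) by exact: sqitgB.
rewrite normL2_EFin// lte_fin ltr_pdivlMr//.
set H := integ 0 T _; set r := Num.sqrt H => rle.
have H0 : 0 <= H by apply: integ_ge0 => s _; exact: sqr_ge0.
have r0 : 0 <= r by exact: sqrtr_ge0.
have Ar0 : 0 <= A * r by exact: mulr_ge0.
have Ar2 : (A * r) ^+ 2 = kappa * (B * H).
  by rewrite exprMn !sqr_sqrtr// ?mulrA// mulr_ge0 ?(ltW B0).
have uE t n : 0 <= t <= T ->
    (solution f - solution f0) t n = - c n * convK K (f - f0) n t.
  by move=> tT; rewrite (convB n tT fi f0i).1 mulrBr.
have DuE t n : 0 <= t <= T ->
    Dt T (solution f - solution f0) t n = - c n * convdK dK (f - f0) n t.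
  move=> tT; rewrite (convB n tT fi f0i).2 mulrBr.
  (* [deriveI] is additive only where both derivatives exist, so the difference is handled through
     [has_derI]. *)
  apply: has_derI_deriveI => //; apply: has_derIB; apply: has_derIZ.
    exact: (convK_has_derI F T0 fi tT).
  exact: (convK_has_derI F T0 f0i tT).
have bound q (x : R -> nat -> R) : (forall t, 0 <= t <= T -> forall N,
    \sum_(n < N) wt q n * x t n ^+ 2 <= kappa * (B * H)) ->
    (normC0X T q x <= (A * r)%:E)%E.
  move=> Hx; apply: ge_ereal_sup => _ [t /= tT <-]; apply: normX_le => // N.
  by rewrite Ar2; apply: Hx; move: tT; rewrite in_itv.
have sumK t N : 0 <= t <= T ->
    \sum_(n < N) kappa * (freq n * convK K (f - f0) n t) ^+ 2 <= kappa * (B * H).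
  by move=> tT; rewrite -mulr_sumr ler_wpM2l//; exact: (convK_bessel F T0 gi N tT).
have h1 : (normC0X T p (solution f - solution f0)%R <= (A * r)%:E)%E.
  apply: bound => t tT N; apply: le_trans (sumK t N tT).
  by apply: ler_sum => n _; rewrite uE//; exact: term_high.
have h2 : (normC0X T (p - 2)%R (solution f - solution f0)%R <= (A * r)%:E)%E.
  apply: bound => t tT N; apply: le_trans (sumK t N tT).
  apply: ler_sum => n _; rewrite uE//; apply: le_trans (term_high _ _).
  by rewrite ler_wpM2r ?sqr_ge0.
have h3 : (normC0X T (p - 2)%R (Dt T (solution f - solution f0)%R) <= (A * r)%:E)%E.
  apply: bound => t tT N.
  apply: le_trans (ler_wpM2l kappa0 (convdK_bessel F T0 gi N tT)).
  by rewrite mulr_sumr; apply: ler_sum => n _; rewrite DuE//; exact: term_low.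
apply: le_lt_trans (leeD h1 (leeD h2 h3)) _.
rewrite -!EFinD lte_fin; lra.
Qed.

Lemma wellposed : exists S : (R -> R) -> R -> nat -> R,
  (forall f, inL2 T f -> weak_solution rho alpha T p c f (S f) /\
     (forall u, weak_solution rho alpha T p c f u ->
        forall t : R, t \in `[0, T] -> u t = S f t)) /\
  continuous_L2_C0X_C1X T p (p - 2) S.
Proof.
exists solution; split; last exact: solution_continuous.
move=> f /inL2P fi; split; first exact: solution_weak.
move=> u Hu t; rewrite in_itv/=.
exact: weak_solution_unique fi Hu (solution_weak fi) t.
Qed.

End wellposed.

Theorem theorem3 (R : realType) (T rho : R) (hT : 0 < T) (hrho : 0 < rho) :
  (forall alpha : R, 0 < alpha < 1 ->
     exists S : (R -> R) -> R -> nat -> R,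
       (forall f, inL2 T f ->
          weak_solution_Neumann rho alpha T f (S f) /\
          (forall u, weak_solution_Neumann rho alpha T f u ->
             forall t : R, t \in `[0, T] -> u t = S f t)) /\
       continuous_L2_C0X_C1X T 0 (- 2) S)
  /\
  (forall alpha : R, 0 < alpha <= 1 ->
     exists S : (R -> R) -> R -> nat -> R,
       (forall g, inL2 T g ->
          weak_solution_shear rho alpha T g (S g) /\
          (forall u, weak_solution_shear rho alpha T g u ->
             forall t : R, t \in `[0, T] -> u t = S g t)) /\
       continuous_L2_C0X_C1X T 2 0 S).
Proof.
(* The sum covers both normalizations of [phi n], for [n = 0] and for [n >= 1]. *)
pose kappa : R := (Num.sqrt pi)^-1 ^+ 2 + Num.sqrt (2 / pi) ^+ 2.
have phi_le (n : nat) : phi n pi ^+ 2 <= kappa.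
  rewrite /phi; case: ifPn => _; first by rewrite lerDl sqr_ge0.
  rewrite exprMn -[leLHS]add0r lerD ?sqr_ge0// ler_piMr ?sqr_ge0//.
split=> alpha.
- move=> /andP[a0 a1]; have a01 : 0 < alpha <= 1 by rewrite a0 ltW.
  rewrite -(sub0r 2); apply: (@wellposed _ _ _ _ _ kappa) => // -[|n].
    have -> : - (0%:R ^+ 2 * phi 0%N pi) = 0 :> R by rewrite expr0n mul0r oppr0.
    by rewrite expr0n mulr0; apply: addr_ge0; exact: sqr_ge0.
  (* The second derivative in the trace brings [n^2], whose square is cancelled exactly by the
     weight [n^(-4)] of [X_N^(-2)]. *)
  have e : n.+1%:R `^ (2 * (0 - 2)) * (n.+1%:R ^+ 2) ^+ 2 = 1 :> R.
    rewrite -exprM -powR_mulrn// -powR_natD.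
    by have -> : 2 * (0 - 2) + (2 * 2)%:R = 0 :> R; [ring|rewrite powRr0].
  by apply: le_trans (phi_le n.+1); rewrite /wt/= sqrrN exprMn mulrA e mul1r.
- move=> a01; rewrite -{2}(subrr 2); apply: (@wellposed _ _ _ _ _ kappa) => // n.
  apply: le_trans (phi_le n); rewrite /wt subrr mulr0 powRr0.
  by case: ifP; rewrite mul1r.
Qed.
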